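(* Let $\mathfrak{g}$ be a Kac-Moody algebra with symmetric generalized Cartan matrix, $W$ its Weyl group, $\mathbf{d}\in(\mathbb{Z}_{\ge0})^I$ and $w\in W$. For $X\in B(\mathbf{d})$, we have $X\in B_w(\mathbf{d})$ if and only if all points of $X$ are ($G_{\mathbf{V}}$-orbits of) subrepresentations, up to isomorphism, of $(x_w,t_w)$.
   Context: Let $C$ be the Cartan matrix, $I$ the vertex set of the Dynkin graph of $\mathfrak{g}$, with simple roots $\alpha_i$, simple coroots $h_i$, fundamental weights $\omega_i$ and simple reflections $r_i$, $i\in I$. For $\mathbf{v},\mathbf{d}\in(\mathbb{Z}_{\ge0})^I$ put $\alpha_{\mathbf{v}}=\sum_i\mathbf{v}_i\alpha_i$ and $\lambda_{\mathbf{d}}=\sum_i\mathbf{d}_i\omega_i$. Let $\mathbf{e}^i\in\mathbb{Z}^I$ be the $i$-th standard basis vector. Quiver varieties. Let $H$ be the set of pairs (edge of the Dynkin graph, orientation of it). For $h\in H$ let $\mathrm{in}(h)$ and $\mathrm{out}(h)$ be its target and source, and $\bar h$ the opposite of $h$. Fix an orientation $\Omega\subset H$ ($\Omega\cup\bar\Omega=H$, $\Omega\cap\bar\Omega=\emptyset$); $\varepsilon(h)=1$ for $h\in\Omega$, $-1$ for $h\in\bar\Omega$. For $I$-graded complex vector spaces $\mathbf{V},\mathbf{D}$ of graded dimensions $\mathbf{v},\mathbf{d}$, let $\Lambda_{\mathbf{V}}$ be the set of $x=(x_h)\in\bigoplus_{h\in H}\mathrm{Hom}(\mathbf{V}_{\mathrm{out}(h)},\mathbf{V}_{\mathrm{in}(h)})$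 that are nilpotent (there is $N\ge 1$ such that all compositions $x_{h_N}\cdots x_{h_1}$ along composable sequences vanish) and satisfy $\sum_{h:\,\mathrm{in}(h)=i}\varepsilon(h)x_hx_{\bar h}=0$ for all $i$. Let $\Lambda(\mathbf{v},\mathbf{d})^{\mathrm{st}}$ be the set of $(x,t)\in\Lambda_{\mathbf{V}}\times\bigoplus_i\mathrm{Hom}(\mathbf{V}_i,\mathbf{D}_i)$ such that the only $I$-graded $x$-stable $\mathbf{S}\subset\mathbf{V}$ with $t_i(\mathbf{S}_i)=0$ for all $i$ is $\mathbf{S}=0$. Then $\mathfrak{L}(\mathbf{v},\mathbf{d})=\Lambda(\mathbf{v},\mathbf{d})^{\mathrm{st}}/G_{\mathbf{V}}$, where $G_{\mathbf{V}}=\prod_i\mathrm{Aut}(\mathbf{V}_i)$ acts (freely) by $g\cdot(x,t)=((g_{\mathrm{in}(h)}x_hg_{\mathrm{out}(h)}^{-1}),(t_ig_i^{-1}))$. The orbit of $(x,t)$ is written $[x,t]$. Subrepresentations. A pair $(x,t)$ on $\mathbf{V}$ is isomorphic to a subrepresentation of $(x',t')$ on $\mathbf{V}'$ (same $\mathbf{D}$) if there is an injective $I$-graded linear map $\phi:\mathbf{V}\to\mathbf{V}'$ with $\phi_{\mathrm{in}(h)}x_h=x'_h\phi_{\mathrm{out}(h)}$ for all $h$ and $t_i=t'_i\phi_i$ for all $i$. The point $(x_w,t_w)$. For $w\in W$ let $\mathbf{v}_w$ be defined by $\lambda_{\mathbf{d}}-\alpha_{\mathbf{v}_w}=w\lambda_{\mathbf{d}}$.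 It is known that $\mathfrak{L}(\mathbf{v}_w,\mathbf{d})$ is a single point; it is denoted $X_w=[x_w,t_w]$. Crystal. $B(\mathbf{d})$ is the set of irreducible components of $\bigsqcup_{\mathbf{v}}\mathfrak{L}(\mathbf{v},\mathbf{d})$, with the Kashiwara-Saito crystal structure, isomorphic to the crystal $B(\lambda_{\mathbf{d}})$ of the irreducible highest weight module $V(\lambda_{\mathbf{d}})$: put $\varepsilon_i([x,t])=\dim\mathrm{coker}\big(\bigoplus_{\mathrm{in}(h)=i}\mathbf{V}_{\mathrm{out}(h)}\xrightarrow{(x_h)}\mathbf{V}_i\big)$ and let $\varepsilon_i(X)$ be the generic (minimal) value of $\varepsilon_i$ on $X$. If $X\subset\mathfrak{L}(\mathbf{v},\mathbf{d})$ and $\varepsilon_i(X)=c$, let $\tilde e_i^{c}X$ be the component of $\mathfrak{L}(\mathbf{v}-c\mathbf{e}^i,\mathbf{d})$ which is the closure of the set of $[x|_{\mathbf{S}},t|_{\mathbf{S}}]$, for $[x,t]\in X$ with $\varepsilon_i([x,t])=c$, where $\mathbf{S}_j=\mathbf{V}_j$ for $j\ne i$ and $\mathbf{S}_i=\sum_{\mathrm{in}(h)=i}x_h(\mathbf{V}_{\mathrm{out}(h)})$. This gives a bijection from components $X$ of $\mathfrak{L}(\mathbf{v},\mathbf{d})$ with $\varepsilon_i(X)=c$ to components $X'$ of $\mathfrak{L}(\mathbf{v}-c\mathbf{e}^i,\mathbf{d})$ with $\varepsilon_i(X')=0$, provided $c\le\langle h_i,\lambda_{\mathbf{d}}-\alpha_{\mathbf{v}-c\mathbf{e}^i}\rangle$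 (otherwise there are no such $X$). The inverse is written $X=\tilde f_i^{c}X'$, with $\tilde f_i^cX'=0$ if no such $X$ exists. In general, for an arbitrary component $X$ of $\mathfrak{L}(\mathbf{v},\mathbf{d})$ with $c=\varepsilon_i(X)$, let $X'=\tilde e_i^cX$ be the corresponding component of $\mathfrak{L}(\mathbf{v}-c\mathbf{e}^i,\mathbf{d})$ with $\varepsilon_i(X')=0$, so that $X=\tilde f_i^cX'$; then $\tilde f_iX=\tilde f_i^{c+1}X'$, and $\tilde e_iX=\tilde f_i^{c-1}X'$ if $c\ge1$, $\tilde e_iX=0$ if $c=0$. Demazure crystal. For a reduced expression $w=r_{i_l}\cdots r_{i_1}$, $B_w(\mathbf{d})=\{\tilde f_{i_l}^{n_l}\cdots\tilde f_{i_1}^{n_1}X_{\lambda_{\mathbf{d}}}\mid n_1,\dots,n_l\in\mathbb{Z}_{\ge0}\}\setminus\{0\}$, where $X_{\lambda_{\mathbf{d}}}=\mathfrak{L}(0,\mathbf{d})$ (a point); by Kashiwara this is independent of the reduced expression and corresponds to the crystal of the Demazure module $V_w(\lambda_{\mathbf{d}})$. *)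

(* Defs.v *)
From HB Require Import structures.
From mathcomp Require Import all_boot all_order all_algebra.
From mathcomp Require Import all_classical all_reals topology.
From mathcomp Require Export complex.

Set Implicit Arguments.
Unset Strict Implicit.
Unset Printing Implicit Defensive.

Import GRing.Theory.
Local Open Scope classical_set_scope.
Local Open Scope ring_scope.
Local Open Scope quotient_scope.

Record sym_gcm (n : nat) := SymGcm {
  gcm :> 'M[int]_n;
  gcm_diag : forall i, gcm i i = 2;
  gcm_offdiag : forall i j, i != j -> gcm i j <= 0;
  gcm_sym : forall i j, gcm i j = gcm j i
}.

(* Realization of [A] in the sense of Kac. The Kac-Moody algebra enters only
   through it: [realization_cartan] is the Cartan subalgebra h, and its dual
   h^* is the space of linear forms 'Hom(h, K^o). *)
Record realization (K : fieldType) (n : nat) (A : sym_gcm n) := Realization {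
  realization_cartan :> vectType K;
  simple_root : 'I_n -> 'Hom(realization_cartan, K^o);
  simple_coroot : 'I_n -> realization_cartan;
  simple_root_free : free [seq simple_root i | i : 'I_n];
  simple_coroot_free : free [seq simple_coroot i | i : 'I_n];
  simple_pairing : forall i j,
    simple_root j (simple_coroot i) = (A i j)%:~R;
  realization_dim :
    (\dim {:realization_cartan}
     + \rank (map_mx (fun z : int => z%:~R : K) A) = n.*2)%N
}.

Section WeylGroup.
Context {K : fieldType} {n : nat} {A : sym_gcm n} (h : realization K A).

Definition is_fundamental_weights (omega : 'I_n -> 'Hom(h, K^o)) : Prop :=
  forall i j, omega j (simple_coroot h i) = (i == j)%:R.

Definition root_of (v : {ffun 'I_n -> nat}) : 'Hom(h, K^o) :=
  \sum_i simple_root h i *+ v i.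

Definition weight_of (omega : 'I_n -> 'Hom(h, K^o)) (d : {ffun 'I_n -> nat}) :
    'Hom(h, K^o) :=
  \sum_i omega i *+ d i.

Definition simple_reflection (i : 'I_n) (l : 'Hom(h, K^o)) : 'Hom(h, K^o) :=
  l - (l (simple_coroot h i) : K) *: simple_root h i.

Inductive weyl_group : ('Hom(h, K^o) -> 'Hom(h, K^o)) -> Prop :=
| weyl_id : weyl_group id
| weyl_refl i : weyl_group (simple_reflection i)
| weyl_comp w1 w2 : weyl_group w1 -> weyl_group w2 -> weyl_group (w1 \o w2)
| weyl_inv w w' : weyl_group w -> cancel w w' -> cancel w' w -> weyl_group w'.

(* The word [:: i_l; ...; i_1] stands for the product r_{i_l} ... r_{i_1}. *)
Definition word_reflection (s : seq 'I_n) : 'Hom(h, K^o) -> 'Hom(h, K^o) :=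
  foldr (fun i w => simple_reflection i \o w) id s.

Definition reduced_expression (w : 'Hom(h, K^o) -> 'Hom(h, K^o))
    (s : seq 'I_n) : Prop :=
  word_reflection s = w /\
  forall s', word_reflection s' = w -> (size s <= size s')%N.

End WeylGroup.

Section Darts.
Context {n : nat} (A : sym_gcm n).

Definition edge_mult (i j : 'I_n) : nat := if i == j then 0%N else `|A i j|%N.

Lemma edge_multC i j : edge_mult i j = edge_mult j i.
Proof. by rewrite /edge_mult eq_sym gcm_sym. Qed.

(* [dart i j] is the set of h in H with out(h) = i and in(h) = j, so that H is
   the disjoint union of all the [dart i j]. *)
Definition dart (i j : 'I_n) : finType := 'I_(edge_mult i j).

Definition dart_rev i j (k : dart i j) : dart j i :=
  cast_ord (edge_multC i j) k.

(* [om i j k] says that the dart [k] belongs to Omega. *)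
Record orientation := Orientation {
  in_orientation :> forall i j, dart i j -> bool;
  orientationP : forall i j (k : dart i j),
    in_orientation (dart_rev k) = ~~ in_orientation k
}.

End Darts.

(* V_i = K^(v i) and D_i = K^(d i) are spaces of row vectors, and a linear map
   is the matrix acting on the right. Hence the composite of [f] followed by
   [g] is [f *m g], images are row spaces, and injective means [row_free]. *)

Section Representations.
Context {K : fieldType} {n : nat} {A : sym_gcm n}.
Implicit Types v d : {ffun 'I_n -> nat}.

Record rep v d := Rep {
  rep_x : forall i j, dart A i j -> 'M[K]_(v i, v j);
  rep_t : forall i, 'M[K]_(v i, d i)
}.

HB.instance Definition _ v d := gen_eqMixin (rep v d).
HB.instance Definition _ v d := gen_choiceMixin (rep v d).

(* The algebra generated by the constants and the matrix entries. *)
Inductive polyfun v d : (rep v d -> K) -> Prop :=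
| polyfun_cst c : polyfun (fun=> c)
| polyfun_x i j (k : dart A i j) a b : polyfun (fun p => rep_x p k a b)
| polyfun_t i a b : polyfun (fun p => rep_t p i a b)
| polyfun_add f g : polyfun f -> polyfun g -> polyfun (fun p => f p + g p)
| polyfun_mul f g : polyfun f -> polyfun g -> polyfun (fun p => f p * g p).

Definition zero_locus v d (F : set (rep v d -> K)) : set (rep v d) :=
  [set p | forall f, F f -> f p = 0].

Definition zariski_open v d (U : set (rep v d)) : Prop :=
  exists2 F, F `<=` @polyfun v d & ~` U = zero_locus F.

Lemma zariski_openT v d : zariski_open [set: rep v d].
Proof.
exists [set fun=> 1]; first by move=> _ ->; exact: polyfun_cst.
rewrite setCT; apply/seteqP; split=> // p /(_ _ erefl) /eqP.
by rewrite oner_eq0.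
Qed.

Lemma zariski_openI v d : setI_closed (@zariski_open v d).
Proof.
move=> U V [F Fp FE] [G Gp GE].
exists [set f | exists2 g1, F g1 & exists2 g2, G g2 &
                  f = fun p => g1 p * g2 p].
  by move=> _ [g1 /Fp ? [g2 /Gp ? ->]]; exact: polyfun_mul.
rewrite setCI FE GE; apply/seteqP; split=> p.
  case=> H _ [g1 F1 [g2 G2 ->]]; first by rewrite (H _ F1) mul0r.
  by rewrite (H _ G2) mulr0.
move=> H; apply: contrapT => /not_orP[/existsNP[g1 /not_implyP[F1 n1]]].
move=> /existsNP[g2 /not_implyP[G2 n2]].
have /eqP := H _ (ex_intro2 _ _ g1 F1 (ex_intro2 _ _ g2 G2 erefl)).
by rewrite mulf_eq0 => /orP[] /eqP.
Qed.

Lemma zariski_open_bigU v d (I : Type) (U : I -> set (rep v d)) :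
  (forall i, zariski_open (U i)) -> zariski_open (\bigcup_i U i).
Proof.
move=> oU; exists [set f | exists i, polyfun f /\ ~` U i `<=` [set p | f p = 0]].
  by move=> f [i []].
rewrite setC_bigcup; apply/seteqP; split=> p.
  by move=> H f [i [_]]; apply; exact: H.
move=> H i _; have [F Fp FE] := oU i; rewrite FE => f Ff.
by apply: H; exists i; split; [exact: Fp|rewrite FE => q; exact].
Qed.

HB.instance Definition _ v d := isOpenTopological.Build (rep v d)
  (@zariski_openT v d) (@zariski_openI v d) (@zariski_open_bigU v d).

(* [x_path p N i j M]: [M] is a composite x_{h_N} ... x_{h_1} along a
   composable sequence of darts leading from [i] to [j]. *)
Inductive x_path v d (p : rep v d) : nat -> forall i j, 'M[K]_(v i, v j) -> Prop :=
| x_path0 i : x_path p 0 (1%:M : 'M_(v i, v i))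
| x_pathS N i j l (M : 'M_(v i, v j)) (k : dart A j l) :
    x_path p N M -> x_path p N.+1 (M *m rep_x p k).

Definition nilpotent v d (p : rep v d) : Prop :=
  exists2 N, (0 < N)%N &
    forall i j (M : 'M_(v i, v j)), x_path p N M -> M = 0.

Definition dart_sign (Om : orientation A) i j (k : dart A i j) : K :=
  if Om i j k then 1 else -1.

Definition preprojective (Om : orientation A) v d (p : rep v d) : Prop :=
  forall i, \sum_j \sum_(k : dart A j i)
    dart_sign Om k *: (rep_x p (dart_rev k) *m rep_x p k) = 0.

Definition stable v d (p : rep v d) : Prop :=
  forall S : (forall i, 'M[K]_(v i)),
    (forall i j (k : dart A i j), (S i *m rep_x p k <= S j)%MS) ->
    (forall i, S i *m rep_t p i = 0) ->
    forall i, S i = 0.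

(* Lambda(v, d)^st *)
Definition lambda_st (Om : orientation A) v d : set (rep v d) :=
  [set p | [/\ nilpotent p, preprojective Om p & stable p]].

(* [phi] is a morphism of pairs (x, t) -> (x', t') which is the identity on D. *)
Definition is_morphism v v' d (p : rep v d) (p' : rep v' d)
    (phi : forall i, 'M[K]_(v i, v' i)) : Prop :=
  (forall i j (k : dart A i j), rep_x p k *m phi j = phi i *m rep_x p' k) /\
  (forall i, rep_t p i = phi i *m rep_t p' i).

Definition is_subrep v v' d (p : rep v d) (p' : rep v' d) : Prop :=
  exists2 phi : (forall i, 'M[K]_(v i, v' i)),
    is_morphism p p' phi & forall i, row_free (phi i).

(* Sum over in(h) = i of x_h(V_out(h)), as a row space. *)
Definition incoming v d (p : rep v d) (i : 'I_n) : 'M[K]_(v i) :=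
  (\sum_j \sum_(k : dart A j i) <<rep_x p k>>)%MS.

(* The dimension of the cokernel of (x_h) : (+)_{in(h) = i} V_out(h) -> V_i. *)
Definition eps v d (i : 'I_n) (p : rep v d) : nat := (v i - \rank (incoming p i))%N.

(* [q] is isomorphic to the restriction of [p] to the graded subspace S with
   S_j = V_j for j != i and S_i = incoming p i. *)
Definition is_restriction v v' d (i : 'I_n) (p : rep v d) (q : rep v' d) : Prop :=
  exists2 phi : (forall j, 'M[K]_(v' j, v j)),
    is_morphism q p phi &
    forall j, row_free (phi j) /\
      (phi j :=: if j == i then incoming p j else 1%:M)%MS.

(* Matrices acting on the right, g sends x_h to g_out^-1 x_h g_in. *)
Definition gv_act v d (g : forall i, 'M[K]_(v i)) (p : rep v d) : rep v d :=
  Rep (fun i j k => invmx (g i) *m rep_x p k *m g j)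
      (fun i => invmx (g i) *m rep_t p i).

Definition same_orbit v d (p q : rep v d) : bool :=
  `[< exists2 g : (forall i, 'M[K]_(v i)),
      forall i, g i \in unitmx & q = gv_act g p >].

Lemma eq_rep v d (p q : rep v d) :
  (forall i j (k : dart A i j), rep_x p k = rep_x q k) ->
  (forall i, rep_t p i = rep_t q i) -> p = q.
Proof.
case: p q => [x t] [x' t'] /= ex et; congr Rep; apply: functional_extensionality_dep => i //.
apply: functional_extensionality_dep => j.
exact: functional_extensionality_dep.
Qed.

Lemma same_orbit_refl v d : reflexive (@same_orbit v d).
Proof.
move=> p; apply/asboolP; exists (fun=> 1%:M) => [i|]; first exact: unitmx1.
by apply: eq_rep => *; rewrite /= invmx1 mul1mx ?mulmx1.
Qed.

Lemma same_orbit_sym v d : symmetric (@same_orbit v d).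
Proof.
suff sub p q : @same_orbit v d p q -> same_orbit q p.
  by move=> p q; apply/idP/idP; exact: sub.
move=> /asboolP[g gu ->]; apply/asboolP; exists (fun i => invmx (g i)).
  by move=> i; rewrite unitmx_inv.
by apply: eq_rep => *; rewrite /= invmxK !mulmxA mulmxV ?mul1mx ?mulmxK.
Qed.

Lemma same_orbit_trans v d : transitive (@same_orbit v d).
Proof.
move=> q p r /asboolP[g gu ->] /asboolP[g' g'u ->]; apply/asboolP.
have invM i : invmx (g i *m g' i) = invmx (g' i) *m invmx (g i).
  have u : g i *m g' i \in unitmx by rewrite unitmx_mul gu g'u.
  apply: (can_inj (mulKmx u)).
  by rewrite mulmxV // mulmxA mulmxK // mulmxV.
exists (fun i => g i *m g' i) => [i|]; first by rewrite unitmx_mul gu g'u.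
by apply: eq_rep => *; rewrite /= invM !mulmxA.
Qed.

End Representations.

Arguments rep K {n} A v d.

Section QuiverVariety.
Context {K : fieldType} {n : nat} {A : sym_gcm n} (Om : orientation A).
Implicit Types v d : {ffun 'I_n -> nat}.

(* [set_type] carries the subspace topology. *)
Definition stable_rep v d : Type := set_type (@lambda_st K n A Om v d).
HB.instance Definition _ v d := Topological.on (stable_rep v d).

Definition orbit_rel v d (p q : stable_rep v d) : bool :=
  same_orbit (set_val p) (set_val q).

Lemma orbit_rel_equiv v d : equiv_class_of (@orbit_rel v d).
Proof.
split=> [p|p q|q p r]; [exact: same_orbit_refl|exact: same_orbit_sym|].
exact: same_orbit_trans.
Qed.

Canonical orbit_equiv v d := EquivRelPack (orbit_rel_equiv v d).

(* L(v, d) = Lambda(v, d)^st / G_V. As the quotient is geometric, the quotient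
   of the Zariski topology is the topology of the variety L(v, d). *)
Definition quiver_variety v d : Type :=
  quotient_topology {eq_quot @orbit_equiv v d}.
HB.instance Definition _ v d := Topological.on (quiver_variety v d).

Definition pt v d (p : stable_rep v d) : quiver_variety v d :=
  \pi_({eq_quot @orbit_equiv v d}) p.

Definition eps_pt v d (i : 'I_n) (y : quiver_variety v d) : nat :=
  eps i (set_val (repr (y : {eq_quot @orbit_equiv v d}))).

End QuiverVariety.

Arguments quiver_variety K {n A} Om v d.

Definition irreducible (T : topologicalType) (X : set T) : Prop :=
  X !=set0 /\ forall F G : set T, closed F -> closed G ->
    X `<=` F `|` G -> X `<=` F \/ X `<=` G.

Definition irreducible_component (T : topologicalType) (X : set T) : Prop :=
  irreducible X /\ forall Y : set T, irreducible Y -> X `<=` Y -> Y = X.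

Section Crystal.
Context {K : fieldType} {n : nat} {A : sym_gcm n} (Om : orientation A)
  (d : {ffun 'I_n -> nat}).

(* Subsets of the disjoint union of the L(v, d) lying in a single L(v, d). *)
Definition graded_subset : Type :=
  {v : {ffun 'I_n -> nat} & set (quiver_variety K Om v d)}.

(* B(d) *)
Definition crystal : set graded_subset :=
  [set X | irreducible_component (tagged X)].

Definition eps_comp (i : 'I_n) (X : graded_subset) : nat :=
  get [set c | (exists2 y, tagged X y & eps_pt i y = c) /\
               forall y, tagged X y -> (c <= eps_pt i y)%N].

(* [etilde_max i X] is e~_i^c X for c = eps_i(X), a subset of L(v - c e^i, d). *)
Definition etilde_max (i : 'I_n) (X : graded_subset) : graded_subset :=
  let c := eps_comp i X in
  let v' := [ffun j => (tag X j - c * (j == i))%N] in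
  Tagged (fun v => set (quiver_variety K Om v d))
    (closure [set pt q | q in
       [set q : stable_rep Om v' d |
         exists p : stable_rep Om (tag X) d,
           [/\ tagged X (pt p), eps i (set_val p) = c
             & is_restriction i (set_val p) (set_val q)]]]).

(* [ftilde_pow i c X'] is f~_i^c X' for a component X' with eps_i(X') = 0;
   [None] stands for 0. *)
Definition ftilde_pow (i : 'I_n) (c : nat) (X' : graded_subset) :
    option graded_subset :=
  xget None [set Some X | X in
    [set X | [/\ crystal X, eps_comp i X = c & etilde_max i X = X']]].

Definition ftilde (i : 'I_n) (X : graded_subset) : option graded_subset :=
  ftilde_pow i (eps_comp i X).+1 (etilde_max i X).

(* L(0, d), which is a point. *)
Definition crystal_top : graded_subset :=
  Tagged (fun v => set (quiver_variety K Om v d))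
    [set: quiver_variety K Om [ffun=> 0%N] d].

(* For s = [:: i_l; ...; i_1] and m = [:: n_l; ...; n_1], this is
   f~_{i_l}^{n_l} ... f~_{i_1}^{n_1} applied to the highest weight element. *)
Definition ftilde_monomial (s : seq 'I_n) (m : seq nat) : option graded_subset :=
  foldr (fun im X => iter im.2 (obind (ftilde im.1)) X)
        (Some crystal_top) (zip s m).

(* B_w(d), for the reduced expression [s] of w. *)
Definition demazure_crystal (s : seq 'I_n) : set graded_subset :=
  [set X | exists2 m : seq nat, size m = size s & ftilde_monomial s m = Some X].

End Crystal.

(* Main.v *)
Require Import Defs.
From HB Require Import structures.
From mathcomp Require Import all_boot all_order all_algebra.
From mathcomp Require Import all_classical all_reals topology.
From mathcomp Require Import complex ring zify.

Set Implicit Arguments.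
Unset Strict Implicit.
Unset Printing Implicit Defensive.

Import Order.TTheory GRing.Theory Num.Theory.
Local Open Scope classical_set_scope.
Local Open Scope ring_scope.

(* At a vertex i, a pair (x, t) is recovered from its restriction to the image of
   the incoming maps at i together with a map into the kernel of those maps. This
   makes the extensions of an irreducible family of pairs irreducible, and it
   computes their dimension, so that components correspond to components under
   restriction at i.

   Let w = r_i w' with w' shorter. Positivity of roots forces (x_w, t_w) to
   restrict at i to (x_w', t_w'), and (x_w, t_w) is the largest extension of
   that restriction. Hence a pair is a subrepresentation of (x_w, t_w) exactly
   when its restriction at i is one of (x_w', t_w'). By stability, being a
   subrepresentation is a closed condition, so this passes to components, and
   the theorem follows by induction on w, with B_w the set of all f~_i^n X for X
   in B_w'. *)

(** * Positivity of roots *)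

(** Restriction at i carries components to components by maximality alone: an irreducible set
    containing the restrictions can be extended back. The opposite direction is the obstacle,
    because an irreducible set containing the extensions may have a smaller generic cokernel at i,
    and then nothing is known of its restrictions. Dimension settles it: every irreducible subset
    has dimension at most [half_dim], every component reaches it (the Lagrangian property of the
    quiver variety, lifted to pairs), and both facts follow by induction on the total dimension of
    V, since nilpotency provides a vertex with a generically nonzero cokernel. Dimension is read off
    the number of independent polynomial functions of degree at most N on a set, so that charts,
    given by fractions with one fixed denominator, compare dimensions by linear algebra alone.
    Irreducibility, likewise, is tested on values of polynomial functions, and is carried from a
    base to a total space by joining two points of a fibre with a rational curve. *)

Section Coxeter.
Context {K : numFieldType} {n : nat} {A : sym_gcm n} (h : realization K A).
Local Notation V := 'Hom(h, K^o).
Local Notation r := (@simple_reflection K n A h).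
Local Notation word := (@word_reflection K n A h).
Local Notation al := (simple_root h).
Local Notation pr l i := ((l (simple_coroot h i)) : K).
Implicit Types (l : V) (s t : seq 'I_n) (i j : 'I_n).

Lemma reflE i l : r i l = l - pr l i *: al i.
Proof. by []. Qed.

Lemma refl_lin i (c : K) l l' : r i (c *: l + l') = c *: r i l + r i l'.
Proof.
rewrite !reflE add_lfunE scale_lfunE scalerDl opprD scalerBr scalerA.
by rewrite addrACA.
Qed.

Lemma word_lin s (c : K) l l' : word s (c *: l + l') = c *: word s l + word s l'.
Proof. by elim: s => //= i s IH; rewrite IH refl_lin. Qed.

Lemma wordD s l l' : word s (l + l') = word s l + word s l'.
Proof. by have := word_lin s 1 l l'; rewrite !scale1r. Qed.

Lemma wordZ s (c : K) l : word s (c *: l) = c *: word s l.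
Proof.
have w0 : word s 0 = 0.
  by have := word_lin s (-1) 0 0; rewrite addr0 scaleN1r oppr0 scaleN1r addNr.
by have := word_lin s c l 0; rewrite w0 !addr0.
Qed.

Lemma wordMn s l m : word s (l *+ m) = word s l *+ m.
Proof. by rewrite -!scaler_nat wordZ. Qed.

Lemma reflD i l l' : r i (l + l') = r i l + r i l'.
Proof. exact: (wordD [:: i]). Qed.

Lemma reflMn i l m : r i (l *+ m) = r i l *+ m.
Proof. exact: (wordMn [:: i]). Qed.

Lemma reflK i : involutive (r i).
Proof.
move=> l; rewrite !reflE add_lfunE opp_lfunE scale_lfunE simple_pairing gcm_diag.
rewrite -addrA -opprD -scalerDl.
set c := (X in X *: _); have -> : c = 0 by rewrite /c /GRing.scale /=; ring.
by rewrite scale0r subr0.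
Qed.

Lemma word_cat s t l : word (s ++ t) l = word s (word t l).
Proof. by elim: s => //= i s ->. Qed.

Lemma word_revK s : cancel (word s) (word (rev s)).
Proof.
elim: s => //= i s IH l; rewrite rev_cons -cats1 word_cat /= reflK.
exact: IH.
Qed.

Lemma word_Krev s : cancel (word (rev s)) (word s).
Proof. by move=> l; rewrite -{1}[s]revK word_revK. Qed.

Definition reduced s := forall s', word s' = word s -> (size s <= size s')%N.

Lemma reduced_catl s t : reduced (s ++ t) -> reduced s.
Proof.
move=> red s' e; rewrite -(leq_add2r (size t)) -!size_cat; apply: red.
by apply: funext => l; rewrite !word_cat e.
Qed.

Lemma reduced_catr s t : reduced (s ++ t) -> reduced t.
Proof.
move=> red s' e; rewrite -(leq_add2l (size s)) -!size_cat; apply: red.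
by apply: funext => l; rewrite !word_cat e.
Qed.

Lemma reduced_rev s : reduced s -> reduced (rev s).
Proof.
move=> red s' e; rewrite size_rev -(size_rev s'); apply: red.
by apply: funext => l; rewrite -{1}[l](word_revK s) -e word_revK.
Qed.

(** Repeated application of [r i] and [r j] to [l] never leaves this affine plane through [l]; a
    word in two letters becomes an affine map of the coordinates (a, b), and braid relations become
    ring identities. *)
Definition nf i j l (a b : K) : V := l - (a *: al i + b *: al j).

Lemma nf_l i j l : r i l = nf i j l (pr l i) 0.
Proof. by rewrite /nf scale0r addr0. Qed.

Lemma nf_r i j l : r j l = nf i j l 0 (pr l j).
Proof. by rewrite /nf scale0r add0r. Qed.

Lemma nfC i j l a b : nf i j l a b = nf j i l b a.
Proof. by rewrite /nf addrC [a *: _ + _]addrC addrC. Qed.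

Lemma pr_nf i j k l (a b : K) :
  pr (nf i j l a b) k = pr l k - (a * (A k i)%:~R + b * (A k j)%:~R).
Proof. by rewrite !(add_lfunE, opp_lfunE, scale_lfunE) !simple_pairing. Qed.

Lemma refl_nfl i j l (a b : K) :
  r i (nf i j l a b) = nf i j l (pr l i - a - b * (A i j)%:~R) b.
Proof.
rewrite reflE pr_nf gcm_diag /nf -addrA -opprD addrAC -scalerDl.
have key (x y z t : K) : y + (x - (y * 2%:~R + z * t)) = x - y - z * t by ring.
by rewrite key.
Qed.

Lemma refl_nfr i j l (a b : K) :
  r j (nf i j l a b) = nf i j l a (pr l j - b - a * (A i j)%:~R).
Proof. by rewrite nfC refl_nfl nfC gcm_sym. Qed.

Lemma braid2 i j l : A i j = 0 -> r i (r j (r i l)) = r j l.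
Proof.
move=> e; rewrite (nf_l i j l) (nf_r i j l) refl_nfr refl_nfl e.
have key (x y : K) : x - x - (y - 0 - x * 0%:~R) * 0%:~R = 0 by ring.
have key' (x y : K) : y - 0 - x * 0%:~R = y by ring.
by rewrite key key'.
Qed.

Lemma braid3 i j l : A i j = -1 -> r i (r j (r i l)) = r j (r i (r j l)).
Proof.
move=> e; rewrite (nf_l i j l) (nf_r i j l).
rewrite refl_nfr refl_nfl refl_nfl refl_nfr e.
have key (x y : K) : x - x - (y - 0 - x * (-1)%:~R) * (-1)%:~R =
    x - 0 - y * (-1)%:~R by ring.
have key' (x y : K) : y - 0 - x * (-1)%:~R =
  y - y - (x - 0 - y * (-1)%:~R) * (-1)%:~R by ring.
by rewrite key (key' (pr l i)).
Qed.

(** The last letter is [j], and it is the first reflection to act: a reduced word in two letters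
    that does not end in [i] has to be of this form. *)
Fixpoint alt i j m : seq 'I_n :=
  if m is m'.+1 then (if odd m then j else i) :: alt i j m' else [::].

Lemma size_alt i j m : size (alt i j m) = m.
Proof. by elim: m => //= m ->. Qed.

Lemma reduced_neq x s : ~ reduced (x :: x :: s).
Proof.
move=> /(_ s); suff /[swap] /[apply] : word s = word [:: x, x & s] by rewrite /=; lia.
by apply: funext => l /=; rewrite reflK.
Qed.

Lemma reduced_alt i j s : reduced s -> all (pred2 i j) s ->
  (exists s', s = rcons s' i /\ all (pred2 i j) s') \/ s = alt i j (size s).
Proof.
elim: s => [|x s IH] red; first by right.
move=> /= /andP[xij sij].
have := IH (@reduced_catr [:: x] s red) sij.
case=> [[s' [-> s'ij]]|es]; first by left; exists (x :: s'); rewrite /= xij.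
case: s es red {sij IH} => [|y s] es red.
  case/orP: xij => /eqP ->; last by right.
  by left; exists [::].
right; congr (_ :: _) => //.
have xy : x != y by apply/eqP => e; rewrite e in red; exact: reduced_neq red.
move: es; rewrite /=; case=> ey es; move: ey xij xy => ->.
by case: (odd (size s)) => /= /orP[]/eqP -> //; rewrite eqxx.
Qed.

(** A word ending in [i] gets shorter when [i] is appended, and the others alternate and end in [j].
    The image of the root is then explicit in a dihedral group: if [A i j] is at most -2 the
    coefficients never decrease below zero, and otherwise a braid relation leaves finitely many
    words. *)
Lemma rank2_pos i j s : i != j -> reduced s -> all (pred2 i j) s ->
  (exists x y : nat, word s (al i) = al i *+ x + al j *+ y) \/
  (exists s', (size s' < size s)%N /\ word s' = word (s ++ [:: i])).
Proof.
move=> ij red sij; case: (reduced_alt red sij) => [[s' [es _]]|es].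
  right; exists s'; rewrite es size_rcons ltnS leqnn; split => //.
  by apply: funext => l; rewrite -cats1 !word_cat /= reflK.
rewrite {}es in red * => {sij}; move: (size s) red => {s} m red.
rewrite size_alt.
have ai : r i (al i) = - al i.
  by rewrite reflE simple_pairing gcm_diag scaler_nat mulr2n opprD addrA subrr add0r.
have aj : r j (al j) = - al j.
  by rewrite reflE simple_pairing gcm_diag scaler_nat mulr2n opprD addrA subrr add0r.
have [a ea] : exists a : nat, A i j = - a%:Z.
  by have := gcm_offdiag A ij; exists `|A i j|%N; lia.
have aij : r i (al j) = al j + al i *+ a.
  by rewrite reflE simple_pairing ea rmorphN /= scaleNr opprK scaler_nat.
have aji : r j (al i) = al i + al j *+ a.
  by rewrite reflE simple_pairing gcm_sym ea rmorphN /= scaleNr opprK scaler_nat.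
have redL x y t s : (forall l, word x l = word y l) -> (size y < size x)%N ->
    s = x ++ t -> reduced s -> False.
  move=> e lt -> /reduced_catl/(_ y); have /[swap]/[apply] : word y = word x.
    by apply: funext => z; rewrite e.
  by lia.
case: (leqP 2 a) => [a2|].
  (* The coefficient changed last is the larger one; carrying this comparison along makes the
     induction close. *)
  left; suff [x [y [-> _]]] : exists x y : nat,
      word (alt i j m) (al i) = al i *+ x + al j *+ y /\
      (if odd m then x <= y else y <= x)%N by exists x, y.
  elim: {red} m => [|m [x [y [e le]]]] /=.
    by exists 1%N, 0%N; rewrite mulr1n mulr0n addr0.
  rewrite e; case: (odd m) le => /= le.
    (* The truncated subtraction is exact, since x <= y <= a y. *)
    exists (a * y - x)%N, y; split; last by nia.
    rewrite reflD !reflMn ai aij mulrnDl mulNrn -mulrnA addrA addrAC.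
    by rewrite [- _ + _]addrC -mulrnBr //; nia.
  exists x, (a * x - y)%N; split; last by nia.
  rewrite reflD !reflMn aj aji mulrnDl mulNrn -mulrnA -addrA.
  by rewrite -mulrnBr //; nia.
(* By symmetry of the Cartan matrix, only the dihedral groups of order 4 and 6 remain. *)
case: a ea aij aji => [|[|//]] ea aij aji _.
  have b2 x y l : [|| (x == i) && (y == j) | (x == j) && (y == i)] ->
      word [:: x; y; x] l = word [:: y] l.
    by case/orP => /andP[/eqP-> /eqP->]; rewrite /= braid2 // gcm_sym ea.
  case: m red => [|[|[|m]]] red.
  - by left; exists 1%N, 0%N; rewrite mulr1n mulr0n addr0.
  - by left; exists 1%N, 0%N; rewrite /= aji.
  - right; exists [:: j]; split=> //; apply: funext => l.
    by rewrite -(b2 i j) ?eqxx.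
  - exfalso; move: red; apply: (redL _ _ (alt i j m)).
    + by move=> l; apply: (b2 (if odd m then i else j) (if odd m then j else i) l);
        case: (odd m); rewrite !eqxx ?orbT.
    + by [].
    + by rewrite /=; case: (odd m).
have b3 x y l : [|| (x == i) && (y == j) | (x == j) && (y == i)] ->
    word [:: x; y; x; y] l = word [:: y; x] l.
  case/orP => /andP[/eqP-> /eqP->]; rewrite /= braid3 ?reflK //.
  by rewrite gcm_sym ea.
case: m red => [|[|[|[|m]]]] red.
- by left; exists 1%N, 0%N; rewrite mulr1n mulr0n addr0.
- by left; exists 1%N, 1%N; rewrite /= aji.
- left; exists 0%N, 1%N; rewrite /= aji reflD reflMn ai aij.
  by rewrite mulr0n mulr1n addrC addrK add0r.
- right; exists [:: i; j]; split => //; apply: funext => l.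
  by rewrite -(b3 j i) ?eqxx ?orbT.
- exfalso; move: red; apply: (redL _ _ (alt i j m)).
  + by move=> l; apply: (b3 (if odd m then j else i) (if odd m then i else j) l);
      case: (odd m); rewrite !eqxx ?orbT.
  + by [].
  + by rewrite /=; case: (odd m).
Qed.

Definition nonneg_root (l : V) := exists u, l = root_of h u.

Lemma nonneg_rootD l l' : nonneg_root l -> nonneg_root l' -> nonneg_root (l + l').
Proof.
move=> [u ->] [u' ->]; exists [ffun i => (u i + u' i)%N].
by rewrite /root_of -big_split /=; apply: eq_bigr => i _; rewrite ffunE mulrnDr.
Qed.

Lemma nonneg_rootMn l m : nonneg_root l -> nonneg_root (l *+ m).
Proof.
move=> [u ->]; exists [ffun i => (u i * m)%N].
by rewrite /root_of -sumrMnl; apply: eq_bigr => i _; rewrite ffunE mulrnA.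
Qed.

Lemma nonneg_root_simple i : nonneg_root (al i).
Proof.
exists [ffun j => nat_of_bool (j == i)]; rewrite /root_of (bigD1 i) //= ffunE eqxx.
rewrite big1 ?addr0 // => j /negbTE ji.
by rewrite ffunE ji.
Qed.

(* Humphreys, Reflection groups and Coxeter groups, Theorem 5.4: split [s] as
   [a ++ b] with [b] a word in two letters and [a] as short as possible, so that
   the induction hypothesis applies to [a] and both letters. *)
Lemma reduced_nonneg s i : reduced s ->
  nonneg_root (word s (al i)) \/
  exists s', (size s' < size s)%N /\ word s' = word (s ++ [:: i]).
Proof.
have [m] := ubnP (size s); elim: m s i => // m IH s i ltm red.
case/lastP: s ltm red => [|s1 j] ltm red.
  by left; exact: nonneg_root_simple.
have [eij|nij] := eqVneq i j.
  right; exists s1; rewrite size_rcons ltnS leqnn; split => //.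
  by apply: funext => l; rewrite -cats1 eij !word_cat /= reflK.
set s := rcons s1 j in ltm red *.
pose P k := `[< exists a b : seq 'I_n, [/\ size a = k, all (pred2 i j) b,
  (size a + size b)%N = size s & word (a ++ b) = word s] >].
have exP : exists k, P k.
  exists (size s1); apply/asboolP; exists s1, [:: j]; split => //=.
  - by rewrite eqxx orbT.
  - by rewrite size_rcons addn1.
  - by rewrite cats1.
have lek : (ex_minn exP <= size s1)%N.
  case: ex_minnP => k _; apply; apply/asboolP; exists s1, [:: j]; split => //=.
  - by rewrite eqxx orbT.
  - by rewrite size_rcons addn1.
  - by rewrite cats1.
case: ex_minnP lek => k /asboolP[a [b [ka bij sab eab]]] kmin lek.
have redab : reduced (a ++ b).
  by move=> s' e; rewrite size_cat sab; apply: red; rewrite e.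
have reda := reduced_catl redab; have redb := reduced_catr redab.
have sa : (size a < m)%N.
  by rewrite ka (leq_ltn_trans lek) //; move: ltm; rewrite size_rcons.
(* A word shorter than [a] for [a] followed by [x] could be put in front of [x :: b], against the
   minimal choice of [a]. *)
have pos (x : 'I_n) : pred2 i j x -> nonneg_root (word a (al x)).
  move=> xij; have [//|[a' [lt e]]] := IH a x sa reda.
  exfalso; have e' : word (a' ++ x :: b) = word s.
    rewrite -eab; apply: funext => l; rewrite !word_cat e word_cat /=.
    by rewrite reflK.
  have := red _ e'; rewrite size_cat /= => le.
  have /kmin : P (size a').
    apply/asboolP; exists a', (x :: b); split => //=; first by move: xij => /= ->.
    by lia.
  by lia.
have [[x [y e]]|[b' [lt e]]] := rank2_pos nij redb bij.
  left; rewrite -eab word_cat e wordD !wordMn.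
  by apply: nonneg_rootD; apply: nonneg_rootMn; apply: pos; rewrite /= eqxx ?orbT.
right; exists (a ++ b'); split; first by rewrite size_cat -sab ltn_add2l.
by apply: funext => l; rewrite !word_cat e -eab !word_cat.
Qed.

(** Since [rev] inverts a word, [rev s] followed by [i] is the inverse of a reduced word; the second
    alternative of [reduced_nonneg] would shorten it. *)
Lemma reduced_cons_nonneg i s :
  reduced (i :: s) -> nonneg_root (word (rev s) (al i)).
Proof.
move=> red; have reds := reduced_rev (@reduced_catr [:: i] s red).
have [//|[s' [lt e]]] := reduced_nonneg i reds; exfalso.
have e' : word (rev s') = word (i :: s).
  apply: funext => l; have ->: l = word (rev (i :: s)) (word (i :: s) l).
    by rewrite word_revK.
  by rewrite rev_cons -cats1 -e word_revK e cats1 -rev_cons word_Krev.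
by have := red _ e'; move: lt; rewrite !size_rev /=; lia.
Qed.

Lemma simple_root_free_sum (c : 'I_n -> K) :
  \sum_i c i *: al i = 0 :> V -> forall i, c i = 0.
Proof.
move=> e; pose X := [tuple al i | i < n].
have frX : free X by have := simple_root_free h; rewrite /= /image_mem.
apply: (elimT freeP frX); rewrite -[RHS]e; apply: eq_bigr => i _.
by rewrite -tnth_nth tnth_mktuple.
Qed.

Lemma root_of_inj : injective (root_of h).
Proof.
move=> u u' e; apply/ffunP => i.
suff /(_ i)/eqP : forall i, (u i)%:R - (u' i)%:R = 0 :> K.
  by rewrite subr_eq0 eqr_nat => /eqP.
apply: simple_root_free_sum; rewrite -[RHS](subrr (root_of h u)) [in X in _ - X]e.
rewrite /root_of -sumrB; apply: eq_bigr => j _.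
by rewrite scalerBl !scaler_nat.
Qed.

Lemma nonneg_root_opp l : nonneg_root l -> nonneg_root (- l) -> l = 0.
Proof.
move=> [u eu] [u' eu'].
have u0 : forall i, (u i + u' i)%:R = 0 :> K.
  apply: simple_root_free_sum; rewrite -[RHS](subrr l) eu' {1}eu /root_of.
  by rewrite -big_split /=; apply: eq_bigr => i _; rewrite scaler_nat mulrnDr.
rewrite eu /root_of big1 // => i _.
by have /eqP := u0 i; rewrite pnatr_eq0 addn_eq0 => /andP[/eqP -> _].
Qed.

End Coxeter.

(** * Irreducibility and growth of polynomial functions *)

Section Polynomials.
Context {K : numFieldType} {T : Type}.
Implicit Types (X : set (T -> K)) (f g D : T -> K) (P Q : set T).

(* Functions on [T] of degree at most [N] in the coordinates [X]. *)
Inductive pol X : nat -> (T -> K) -> Prop :=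
| pol_cst N c : pol X N (fun=> c)
| pol_gen N f : X f -> pol X N.+1 f
| pol_add N f g : pol X N f -> pol X N g -> pol X N (fun p => f p + g p)
| pol_mul N M f g : pol X N f -> pol X M g -> pol X (N + M)%N (fun p => f p * g p).

Definition regular X f := exists N, pol X N f.

Lemma pol_le X N M f : (N <= M)%N -> pol X N f -> pol X M f.
Proof.
move=> + H; elim: H M => {N f} [N c|N f Xf|N f g _ IHf _ IHg|N N' f g _ IHf Hg _] M le.
- exact: pol_cst.
- by case: M le => // M _; apply: pol_gen.
- by apply: pol_add; [apply: IHf|apply: IHg].
- by rewrite -(subnK le) addnA; apply: pol_mul => //; apply: IHf; lia.
Qed.

Lemma pol_eq X N f g : f =1 g -> pol X N f -> pol X N g.
Proof. by move=> /funext ->. Qed.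

Lemma pol_sum X N (I : Type) (r : seq I) (B : pred I) (F : I -> T -> K) :
  (forall i, pol X N (F i)) -> pol X N (fun p => \sum_(i <- r | B i) F i p).
Proof.
move=> HF; elim: r => [|i r IH].
  by apply: (pol_eq (f := fun=> 0)); [move=> p; rewrite big_nil|exact: pol_cst].
case Bi: (B i).
  apply: (pol_eq (f := fun p => F i p + \sum_(j <- r | B j) F j p)).
    by move=> p; rewrite big_cons Bi.
  exact: pol_add.
by apply: pol_eq IH => p; rewrite big_cons Bi.
Qed.

Lemma pol_scale X N c f : pol X N f -> pol X N (fun p => c * f p).
Proof. by move=> Hf; rewrite -[N]add0n; apply: pol_mul => //; exact: pol_cst. Qed.

Lemma pol_exp X N f m : pol X N f -> pol X (m * N) (fun p => f p ^+ m).
Proof.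
move=> Hf; elim: m => [|m IH].
  by apply: (pol_eq (f := fun=> 1)); [move=> p; rewrite expr0|exact: pol_cst].
apply: (pol_eq (f := fun p => f p * f p ^+ m)); first by move=> p; rewrite exprS.
by rewrite mulSn; apply: pol_mul.
Qed.

Lemma regular_eq X f g : f =1 g -> regular X f -> regular X g.
Proof. by move=> /funext ->. Qed.

Lemma regular_cst X c : regular X (fun=> c).
Proof. by exists 0%N; exact: pol_cst. Qed.

Lemma regular_gen X f : X f -> regular X f.
Proof. by exists 1%N; exact: pol_gen. Qed.

Lemma regularD X f g : regular X f -> regular X g -> regular X (fun p => f p + g p).
Proof.
move=> [N Hf] [M Hg]; exists (maxn N M).
by apply: pol_add; [apply: pol_le Hf|apply: pol_le Hg]; rewrite ?leq_maxl ?leq_maxr.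
Qed.

Lemma regularM X f g : regular X f -> regular X g -> regular X (fun p => f p * g p).
Proof. by move=> [N Hf] [M Hg]; exists (N + M)%N; exact: pol_mul. Qed.

Lemma regular_sum X (I : Type) (r : seq I) (B : pred I) (F : I -> T -> K) :
  (forall i, regular X (F i)) -> regular X (fun p => \sum_(i <- r | B i) F i p).
Proof.
move=> HF; elim: r => [|i r IH].
  by apply: (regular_eq (f := fun=> 0)); [move=> p; rewrite big_nil|exact: regular_cst].
case Bi: (B i).
  apply: (regular_eq (f := fun p => F i p + \sum_(j <- r | B j) F j p)).
    by move=> p; rewrite big_cons Bi.
  exact: regularD.
by apply: regular_eq IH => p; rewrite big_cons Bi.
Qed.

Lemma regular_prod X (I : Type) (r : seq I) (B : pred I) (F : I -> T -> K) :
  (forall i, regular X (F i)) -> regular X (fun p => \prod_(i <- r | B i) F i p).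
Proof.
move=> HF; elim: r => [|i r IH].
  by apply: (regular_eq (f := fun=> 1)); [move=> p; rewrite big_nil|exact: regular_cst].
case Bi: (B i).
  apply: (regular_eq (f := fun p => F i p * \prod_(j <- r | B j) F j p)).
    by move=> p; rewrite big_cons Bi.
  exact: regularM.
by apply: regular_eq IH => p; rewrite big_cons Bi.
Qed.

Definition regular_mx X a b (M : T -> 'M[K]_(a, b)) :=
  forall i j, regular X (fun p => M p i j).

Lemma regular_mx_cst X a b (M : 'M[K]_(a, b)) : regular_mx X (fun=> M).
Proof. by move=> i j; exact: regular_cst. Qed.

Lemma regular_mulmx X a b c (M : T -> 'M[K]_(a, b)) (N : T -> 'M[K]_(b, c)) :
  regular_mx X M -> regular_mx X N -> regular_mx X (fun p => M p *m N p).
Proof.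
move=> HM HN i j; apply: (regular_eq (f := fun p => \sum_k M p i k * N p k j)).
  by move=> p; rewrite mxE.
by apply: regular_sum => k; apply: regularM.
Qed.

Lemma regular_det X a (M : T -> 'M[K]_a) :
  regular_mx X M -> regular X (fun p => \det (M p)).
Proof.
move=> HM; apply: regular_sum => s; apply: regularM; first exact: regular_cst.
by apply: regular_prod => i.
Qed.

Lemma regular_adj X a (M : T -> 'M[K]_a) :
  regular_mx X M -> regular_mx X (fun p => \adj (M p)).
Proof.
move=> HM i j; apply: (regular_eq (f := fun p => cofactor (M p) j i)).
  by move=> p; rewrite mxE.
apply: regularM; first exact: regular_cst.
apply: regular_det => k l.
apply: (regular_eq (f := fun p => M p (lift j k) (lift i l))) => [p|].
  by rewrite !mxE.
exact: HM.
Qed.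

(** The polynomial functions vanishing on [P] form a prime ideal. No closedness is asked of [P], so
    the notion applies directly to dense parts, fibres and images. *)
Definition irr X P := P !=set0 /\ forall f g, regular X f -> regular X g ->
  (forall p, P p -> f p * g p = 0) ->
  (forall p, P p -> f p = 0) \/ (forall p, P p -> g p = 0).

(** Open sets enter only through a function that is nonzero at a given point; this form, with its
    converse [irrI], is how irreducibility is mostly used and proved. *)
Lemma irr_meet X P f g p q : irr X P -> regular X f -> regular X g ->
  P p -> f p != 0 -> P q -> g q != 0 ->
  exists r, [/\ P r, f r != 0 & g r != 0].
Proof.
move=> [_ iP] Hf Hg Pp fp Pq gq; apply: contrapT => H.
have [r Pr|f0|g0] := iP f g Hf Hg.
- apply/eqP; rewrite mulf_eq0; apply/negPn; rewrite negb_or; apply/negP => /andP[fr gr].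
  by apply: H; exists r.
- by rewrite f0 ?eqxx in fp.
- by rewrite g0 ?eqxx in gq.
Qed.

Lemma irrI X P : P !=set0 ->
  (forall f g p q, regular X f -> regular X g -> P p -> f p != 0 -> P q -> g q != 0 ->
    exists r, [/\ P r, f r != 0 & g r != 0]) -> irr X P.
Proof.
move=> P0 H; split=> // f g Hf Hg fg0; apply: contrapT => /not_orP[nf ng].
have [p [Pp fp]] : exists p, P p /\ f p != 0.
  apply: contrapT => H'; apply: nf => p Pp; apply/eqP/negPn/negP => fp.
  by apply: H'; exists p.
have [q [Pq gq]] : exists p, P p /\ g p != 0.
  apply: contrapT => H'; apply: ng => q Pq; apply/eqP/negPn/negP => gq.
  by apply: H'; exists q.
have [r [Pr fr gr]] := H f g p q Hf Hg Pp fp Pq gq.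
by have /eqP := fg0 r Pr; rewrite mulf_eq0 (negbTE fr) (negbTE gr).
Qed.

Definition zcl X P : set T :=
  [set p | forall f, regular X f -> (forall q, P q -> f q = 0) -> f p = 0].

Lemma sub_zcl X P : P `<=` zcl X P.
Proof. by move=> p Pp f _; apply. Qed.

Lemma zcl_sub X P Q : P `<=` zcl X Q -> zcl X P `<=` zcl X Q.
Proof. by move=> PQ p Pp f Hf f0; apply: Pp => // q /PQ; apply. Qed.

Lemma zcl_meet X P f p : zcl X P p -> regular X f -> f p != 0 ->
  exists2 q, P q & f q != 0.
Proof.
move=> cp Hf fp; apply: contrapT => H; move/eqP: fp; apply; apply: cp => // q Pq.
by apply/eqP/negPn/negP => fq; apply: H; exists q.
Qed.

Lemma irr_between X P Q : irr X P -> P `<=` Q -> Q `<=` zcl X P -> irr X Q.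
Proof.
move=> iP PQ QP; have [[p Pp] _] := iP; apply: irrI; first by exists p; exact: PQ.
move=> f g p1 p2 Hf Hg /QP c1 f1 /QP c2 g2.
have [q1 P1 fq] := zcl_meet c1 Hf f1; have [q2 P2 gq] := zcl_meet c2 Hg g2.
have [r [Pr fr gr]] := irr_meet iP Hf Hg P1 fq P2 gq.
by exists r; split => //; exact: PQ.
Qed.

Lemma irr_open X P Q D p : irr X P -> Q `<=` P -> regular X D -> P p -> D p != 0 ->
  (forall q, P q -> D q != 0 -> Q q) -> irr X Q /\ P `<=` zcl X Q.
Proof.
move=> iP QP HD Pp Dp DQ; split; last first.
  move=> r Pr f Hf f0; apply/eqP/negPn/negP => fr.
  have [q [Pq fq Dq]] := irr_meet iP Hf HD Pr fr Pp Dp.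
  by move: fq; rewrite f0 ?eqxx //; exact: DQ.
apply: irrI; first by exists p; exact: DQ.
move=> f g p1 p2 Hf Hg /QP P1 f1 /QP P2 g2.
have [q [Pq fq Dq]] := irr_meet iP Hf HD P1 f1 Pp Dp.
have [|r [Pr fDr gr]] := irr_meet iP (regularM Hf HD) Hg Pq _ P2 g2.
  by rewrite mulf_neq0.
move: fDr; rewrite mulf_eq0 negb_or => /andP[fr Dr].
by exists r; split => //; exact: DQ.
Qed.

Lemma irr_inter X P (I : eqType) (r : seq I) (F : I -> T -> K) :
  irr X P -> (forall i, i \in r -> regular X (F i) /\ exists2 p, P p & F i p != 0) ->
  exists2 p, P p & forall i, i \in r -> F i p != 0.
Proof.
move=> iP; suff H s : {subset s <= r} -> (forall i, i \in r -> regular X (F i) /\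
    exists2 p, P p & F i p != 0) -> exists2 p, P p & \prod_(i <- s) F i p != 0.
  move=> HF; have [p Pp Fp] := H r (fun _ => id) HF; exists p => // i ir.
  by apply/eqP => Fi; move: Fp; rewrite (big_rem i) //= Fi mul0r eqxx.
elim: s => [|i s IH] sr HF.
  by have [[p Pp] _] := iP; exists p; rewrite // big_nil oner_eq0.
have [|p Pp Fp] := IH _ HF; first by move=> j js; apply: sr; rewrite inE js orbT.
have [Hi [q Pq Fq]] := HF i (sr i (mem_head _ _)).
have Hs : regular X (fun p => \prod_(j <- s) F j p).
  elim: s sr {IH Fp} => [|j s IH] sr.
    by apply: (regular_eq (f := fun=> 1)); [move=> x; rewrite big_nil|exact: regular_cst].
  apply: (regular_eq (f := fun p => F j p * \prod_(j <- s) F j p)).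
    by move=> x; rewrite big_cons.
  apply: regularM; last first.
    by apply: IH => k; rewrite inE => /orP[/eqP ->|ks]; apply: sr;
       rewrite ?mem_head // !inE ks !orbT.
  by have [] := HF j; rewrite // sr // !inE eqxx orbT.
have [x [Px Fix Fsx]] := irr_meet iP Hi Hs Pq Fq Pp Fp.
by exists x; rewrite // big_cons mulf_neq0.
Qed.

End Polynomials.

(** * Fractions with a fixed denominator *)

Section Rational.
Context {K : numFieldType} {T : Type} (X : set (T -> K)) (D : T -> K).

(* [h] is the fraction [F / D ^ e] where [D] does not vanish; the bound on the
   degree of [F] makes sense when [D] has degree at most [m]. *)
Definition rat m e (h : T -> K) := exists2 F, pol X (e * m.+1) F &
  forall p, D p != 0 -> F p = h p * D p ^+ e.

Definition ratn m h := exists e, rat m e h.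

Context (m : nat) (Dm : pol X m D).

Lemma rat_cst c : rat m 0 (fun=> c).
Proof. by exists (fun=> c); [exact: pol_cst|move=> p _; rewrite expr0 mulr1]. Qed.

Lemma rat_le e e' h : (e <= e')%N -> rat m e h -> rat m e' h.
Proof.
move=> le [F HF FE]; exists (fun p => F p * D p ^+ (e' - e)).
  rewrite -{1}(subnKC le) mulnDl; apply: pol_mul => //.
  by apply: pol_le (pol_exp _ Dm); rewrite leq_mul2l leqnSn orbT.
by move=> p Dp; rewrite FE // -mulrA -exprD subnKC.
Qed.

Lemma rat_eq e h h' : (forall p, D p != 0 -> h p = h' p) -> rat m e h -> rat m e h'.
Proof. by move=> E [F HF FE]; exists F => // p Dp; rewrite FE // E. Qed.

Lemma rat_add e h h' : rat m e h -> rat m e h' -> rat m e (fun p => h p + h' p).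
Proof.
move=> [F HF FE] [F' HF' FE']; exists (fun p => F p + F' p); first exact: pol_add.
by move=> p Dp; rewrite FE // FE' // mulrDl.
Qed.

Lemma rat_mul e e' h h' : rat m e h -> rat m e' h' ->
  rat m (e + e') (fun p => h p * h' p).
Proof.
move=> [F HF FE] [F' HF' FE']; exists (fun p => F p * F' p).
  by rewrite mulnDl; exact: pol_mul.
by move=> p Dp; rewrite FE // FE' // exprD mulrACA.
Qed.

(** Taking [N] as exponent makes the degree N + N m of the numerator equal to the required bound. *)
Lemma rat_pol N f : pol X N f -> rat m N f.
Proof.
move=> Hf; exists (fun p => f p * D p ^+ N); last by [].
by rewrite mulnS; apply: pol_mul => //; exact: pol_exp.
Qed.

Lemma ratn_eq h h' : (forall p, D p != 0 -> h p = h' p) -> ratn m h -> ratn m h'.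
Proof. by move=> E [e H]; exists e; exact: rat_eq H. Qed.

Lemma ratn_regular f : regular X f -> ratn m f.
Proof. by move=> [N /rat_pol H]; exists N. Qed.

Lemma ratn_add h h' : ratn m h -> ratn m h' -> ratn m (fun p => h p + h' p).
Proof.
move=> [e H] [e' H']; exists (maxn e e').
by apply: rat_add; [apply: rat_le H|apply: rat_le H']; rewrite ?leq_maxl ?leq_maxr.
Qed.

Lemma ratn_mul h h' : ratn m h -> ratn m h' -> ratn m (fun p => h p * h' p).
Proof. by move=> [e H] [e' H']; exists (e + e')%N; exact: rat_mul. Qed.

Lemma ratn_div f : regular X f -> ratn m (fun p => f p / D p).
Proof.
move=> [N Hf]; exists N.+1, (fun p => f p * D p ^+ N).
  apply: (@pol_le _ _ _ (N + N * m)); first by nia.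
  by apply: pol_mul => //; exact: pol_exp.
by move=> p Dp; rewrite exprS mulrA divfK.
Qed.

Lemma ratn_sum (I : Type) (r : seq I) (B : pred I) (F : I -> T -> K) :
  (forall i, ratn m (F i)) -> ratn m (fun p => \sum_(i <- r | B i) F i p).
Proof.
move=> HF; elim: r => [|i r IH].
  apply: (ratn_eq (h := fun=> 0)); first by move=> p; rewrite big_nil.
  by exists 0%N; exact: rat_cst.
case Bi: (B i).
  apply: (ratn_eq (h := fun p => F i p + \sum_(j <- r | B j) F j p)).
    by move=> p; rewrite big_cons Bi.
  exact: ratn_add.
by apply: ratn_eq IH => p; rewrite big_cons Bi.
Qed.

Definition ratn_mx a b (M : T -> 'M[K]_(a, b)) :=
  forall i j, ratn m (fun p => M p i j).

Lemma ratn_mx_regular a b (M : T -> 'M[K]_(a, b)) : regular_mx X M -> ratn_mx M.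
Proof. by move=> H i j; apply: ratn_regular. Qed.

Lemma ratn_mx_cst a b (M : 'M[K]_(a, b)) : ratn_mx (fun=> M).
Proof. by apply: ratn_mx_regular; exact: regular_mx_cst. Qed.

Lemma ratn_mx_eq a b (M N : T -> 'M[K]_(a, b)) :
  (forall p, D p != 0 -> M p = N p) -> ratn_mx M -> ratn_mx N.
Proof. by move=> E H i j; apply: ratn_eq (H i j) => p /E ->. Qed.

Lemma ratn_mulmx a b c (M : T -> 'M[K]_(a, b)) (N : T -> 'M[K]_(b, c)) :
  ratn_mx M -> ratn_mx N -> ratn_mx (fun p => M p *m N p).
Proof.
move=> HM HN i j; apply: (ratn_eq (h := fun p => \sum_k M p i k * N p k j)).
  by move=> p _; rewrite mxE.
by apply: ratn_sum => k; apply: ratn_mul.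
Qed.

Lemma ratn_addmx a b (M N : T -> 'M[K]_(a, b)) :
  ratn_mx M -> ratn_mx N -> ratn_mx (fun p => M p + N p).
Proof.
move=> HM HN i j; apply: (ratn_eq (h := fun p => M p i j + N p i j)).
  by move=> p _; rewrite mxE.
exact: ratn_add.
Qed.

Lemma ratn_oppmx a b (M : T -> 'M[K]_(a, b)) : ratn_mx M -> ratn_mx (fun p => - M p).
Proof.
move=> HM; apply: (ratn_mx_eq (M := fun p => (- 1)%:M *m M p)).
  by move=> p _; rewrite mul_scalar_mx scaleN1r.
by apply: ratn_mulmx => //; exact: ratn_mx_cst.
Qed.

(** Cramer's rule; the complementary factor [E] lets one denominator serve several inverses at
    once. *)
Lemma ratn_invmx a (B : T -> 'M[K]_a) E :
  regular_mx X B -> regular X E -> (forall p, D p = \det (B p) * E p) ->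
  ratn_mx (fun p => invmx (B p)).
Proof.
move=> HB HE DE i j.
apply: (ratn_eq (h := fun p => \adj (B p) i j * E p / D p)).
  move=> p; rewrite DE mulf_eq0 negb_or => /andP[dp ep].
  have Bu : B p \in unitmx by rewrite unitmxE unitfE.
  by rewrite /invmx Bu [RHS]mxE invfM mulrACA mulfV // mulr1 mulrC.
by apply: ratn_div; apply: regularM => //; exact: regular_adj.
Qed.

(** Multiplying the numerator once more by [D] removes the points where the fraction has no
    meaning. *)
Lemma ratn_neq0 h : ratn m h -> exists2 F, regular X F &
  forall p, (F p != 0) = (D p != 0) && (h p != 0).
Proof.
move=> [e [F HF FE]]; exists (fun p => F p * D p).
  by apply: regularM; [exists (e * m.+1)%N|exists m].
move=> p; rewrite mulf_eq0 negb_or andbC; case: eqVneq => //= Dp.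
by rewrite FE // mulf_eq0 negb_or expf_eq0 (negbTE Dp) andbF andbT.
Qed.

Lemma ratn_comp T' (X' : set (T' -> K)) (s : T -> T') f :
  (forall g, X' g -> ratn m (g \o s)) -> regular X' f -> ratn m (f \o s).
Proof.
move=> H [N]; elim=> {N f} [N c|N f Xf|N f g _ IHf _ IHg|N M f g _ IHf _ IHg].
- by exists 0%N; exact: rat_cst.
- exact: H.
- exact: ratn_add.
- exact: ratn_mul.
Qed.

End Rational.

(** Over the constant denominator 1 fractions are polynomials, so that regularity can be deduced
    from the closure properties of [ratn]. *)
Lemma ratn1 {K : numFieldType} T (X : set (T -> K)) m h :
  ratn X (fun=> 1) m h -> regular X h.
Proof.
move=> [e [F HF FE]]; exists (e * m.+1)%N; apply: pol_eq HF => p.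
by rewrite FE ?oner_eq0 // expr1n mulr1.
Qed.

Lemma fin_unif (I : finType) (Q : I -> nat -> Prop) :
  (forall i e e', (e <= e')%N -> Q i e -> Q i e') ->
  (forall i, exists e, Q i e) -> exists e, forall i, Q i e.
Proof.
move=> mono /choice[e He]; exists (\max_i e i)%N => i.
by apply: mono (He i); exact: leq_bigmax.
Qed.

(** The correspondence [G] is regarded as a fibration of [Q] over [P]. The first condition says that
    a nonempty open part of [Q] covers a nonempty open part of [P], the second that the fibres are
    irreducible: two open parts of [Q] then meet over a common point of [P]. *)
Lemma irr_transfer {K : numFieldType} T T' (X : set (T -> K)) (X' : set (T' -> K))
    (P : set T) (Q : set T') (G : T -> T' -> Prop) :
  irr X P -> Q !=set0 ->
  (forall q f, Q q -> regular X' f -> f q != 0 ->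
    exists F, [/\ regular X F, exists2 p, P p & F p != 0 &
      forall p, P p -> F p != 0 -> exists q', [/\ Q q', G p q' & f q' != 0]]) ->
  (forall p f g q1 q2, P p -> regular X' f -> regular X' g -> Q q1 -> G p q1 ->
    f q1 != 0 -> Q q2 -> G p q2 -> g q2 != 0 ->
    exists q, [/\ Q q, f q != 0 & g q != 0]) ->
  irr X' Q.
Proof.
move=> iP Q0 sec fib; apply: irrI => // f g q1 q2 Hf Hg Qq1 fq1 Qq2 gq2.
have [F [HF [p1 Pp1 Fp1] F1]] := sec q1 f Qq1 Hf fq1.
have [G' [HG [p2 Pp2 Gp2] G1]] := sec q2 g Qq2 Hg gq2.
have [p [Pp Fp Gp]] := irr_meet iP HF HG Pp1 Fp1 Pp2 Gp2.
have [r1 [Qr1 Gr1 fr1]] := F1 p Pp Fp; have [r2 [Qr2 Gr2 gr2]] := G1 p Pp Gp.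
exact: (fib p f g r1 r2).
Qed.

Lemma poly_eq0_eval {K : numFieldType} (p : {poly K}) :
  (forall x, p.[x] = 0) -> p = 0.
Proof.
move=> H; apply/eqP/negPn/negP => p0.
have := @max_poly_roots _ p [seq i%:R | i <- iota 0 (size p)] p0.
rewrite size_map size_iota ltnn => H'; apply: notF; apply: H'.
  by apply/allP => x _; apply/eqP/H.
by rewrite map_inj_uniq ?iota_uniq // => i j /eqP; rewrite eqr_nat => /eqP.
Qed.

(** Two polynomials whose product vanishes on an infinite field have a zero factor. Fibres are later
    shown irreducible by mapping this line to a curve through two of their points. *)
Lemma irr_line {K : numFieldType} : irr [set (@id K)] [set: K].
Proof.
have polyP f : regular [set (@id K)] f -> exists p : {poly K}, forall x, f x = p.[x].
  case=> N; elim=> {N f} [N c|N f ->|N f g _ [p pE] _ [q qE]|N M f g _ [p pE] _ [q qE]].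
  - by exists c%:P => x; rewrite hornerC.
  - by exists 'X => x; rewrite hornerX.
  - by exists (p + q) => x; rewrite hornerD pE qE.
  - by exists (p * q) => x; rewrite hornerM pE qE.
split; first by exists 0.
move=> f g /polyP[p pE] /polyP[q qE] fg0.
have : p * q = 0 by apply: poly_eq0_eval => x; rewrite hornerM -pE -qE fg0.
by move/eqP; rewrite mulf_eq0 => /orP[]/eqP e; [left|right] => x _;
  rewrite ?pE ?qE e horner0.
Qed.

Lemma leq_expn a b k : (a <= b -> a ^ k <= b ^ k)%N.
Proof. by case: k => // k le; rewrite leq_exp2r. Qed.

(** * Dimension through the growth of polynomial functions *)

Section Growth.
Context {K : numFieldType}.

Definition indep T (X : set (T -> K)) P N n := exists f : 'I_n -> T -> K,
  (forall i, pol X N (f i)) /\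
  forall c : 'I_n -> K, (forall p, P p -> \sum_i c i * f i p = 0) -> forall i, c i = 0.

(* The dimension of [P], as the growth of the Hilbert function of [P]. *)
Definition dim_le T (X : set (T -> K)) P r :=
  exists C, forall N n, indep X P N n -> (n <= C * N.+1 ^ r)%N.

(** The factor [e], like [C] in [dim_le], absorbs the bounded growth of degrees under a change of
    coordinates. *)
Definition dim_ge T (X : set (T -> K)) P r :=
  exists e, forall N, indep X P (e * N) (N ^ r).

Lemma indep_fin T (X : set (T -> K)) P N (I : finType) (f : I -> T -> K) :
  (forall i, pol X N (f i)) ->
  (forall c : I -> K, (forall p, P p -> \sum_i c i * f i p = 0) -> forall i, c i = 0) ->
  indep X P N #|I|.
Proof.
move=> Hf H; exists (fun i => f (enum_val i)); split => // c Hc i.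
rewrite -(enum_valK i).
apply: (H (fun x => c (enum_rank x))) => p Pp; rewrite -[RHS](Hc p Pp).
rewrite (reindex_onto (@enum_val I I) enum_rank) /=; last by move=> *; rewrite enum_rankK.
by apply: eq_big => j; rewrite ?enum_valK ?eqxx.
Qed.

Section Generic.
Context {T : Type} (X : set (T -> K)).
Implicit Types (P Q : set T).

Lemma indep_zcl P Q N n : P `<=` zcl X Q -> indep X P N n -> indep X Q N n.
Proof.
move=> PQ [f [Hf H]]; exists f; split => // c Hc; apply: H => p /PQ zp.
apply: (zp (fun p => \sum_i c i * f i p)) => //.
by exists N; apply: pol_sum => i; exact: pol_scale.
Qed.

Lemma dim_le_zcl P Q r : P `<=` zcl X Q -> dim_le X Q r -> dim_le X P r.
Proof. by move=> PQ [C H]; exists C => N n /(indep_zcl PQ); exact: H. Qed.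

Lemma dim_ge_zcl P Q r : P `<=` zcl X Q -> dim_ge X P r -> dim_ge X Q r.
Proof. by move=> PQ [e H]; exists e => N; exact: indep_zcl (H N). Qed.

Lemma dim_ge0 P : P !=set0 -> dim_ge X P 0.
Proof.
move=> [p Pp]; exists 0%N => N; rewrite expn0; exists (fun _ _ => 1); split => [i|c Hc i].
  exact: pol_cst.
by have := Hc p Pp; rewrite big_ord1 mulr1 (ord1 i).
Qed.

Lemma span_indep P N n (I : finType) (u : I -> T -> K) :
  (forall f, pol X N f -> exists c : I -> K, forall p, P p -> f p = \sum_i c i * u i p) ->
  indep X P N n -> (n <= #|I|)%N.
Proof.
move=> span [f [Hf H]].
have /choice[c Hc] i : exists c : I -> K,
    forall p, P p -> f i p = \sum_j c j * u j p by apply: span.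
pose C := \matrix_(i < n, j < #|I|) c i (enum_val j).
suff /eqP <- : row_free C by rewrite rank_leq_col.
rewrite -kermx_eq0; apply/eqP/row_matrixP => k; rewrite row0; apply/rowP => i.
rewrite [RHS]mxE; set x := row k _.
have xC : x *m C = 0 by apply/sub_kermxP; exact: row_sub.
apply: (H (fun i => x 0 i)) => p Pp.
under eq_bigr do rewrite Hc // mulr_sumr.
rewrite exchange_big /= big1 // => j _.
under eq_bigr do rewrite mulrA.
rewrite -mulr_suml; have /rowP/(_ (enum_rank j)) := xC; rewrite !mxE.
by under eq_bigr do rewrite [X in _ * X]mxE enum_rankK; move=> ->; rewrite mul0r.
Qed.

Lemma indep_span P N B : (forall n, indep X P N n -> (n <= B)%N) ->
  exists n (u : 'I_n -> T -> K), [/\ (n <= B)%N, (forall i, pol X N (u i)) &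
   forall f, pol X N f -> exists c : 'I_n -> K,
     forall p, P p -> f p = \sum_i c i * u i p].
Proof.
move=> bd.
have ex0 : exists n, `[< indep X P N n >].
  by exists 0%N; apply/asboolP; exists (fun _ _ => 0); split => [[]|c _ []].
have bd' n : `[< indep X P N n >] -> (n <= B)%N by move/asboolP; exact: bd.
case: (ex_maxnP ex0 bd') => n /asboolP H max; have le := bd n H.
case: H => u [Hu H]; exists n, u; split => // f Hf.
pose g (o : option 'I_n) := if o is Some i then u i else f.
have nin : ~ (forall c : option 'I_n -> K,
   (forall p, P p -> \sum_i c i * g i p = 0) -> forall i, c i = 0).
  move=> Hg; have /asboolP/max : indep X P N #|{: option 'I_n}|.
    by apply: (indep_fin (f := g)) => // -[].
  by rewrite card_option card_ord ltnn.
move/existsNP: nin => [c /not_implyP[Hc /existsNP[o co]]].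
have sumE p : P p -> c None * f p + \sum_i c (Some i) * u i p = 0.
  move=> Pp; rewrite -[RHS](Hc p Pp) (bigD1 None) //=; congr (_ + _).
  rewrite (reindex_omap Some id); last by case.
  by apply: eq_bigl => i /=; rewrite eqxx.
have cN : c None != 0.
  apply/eqP => cN; apply: co; case: o => // i.
  apply: (H (fun i => c (Some i))) => p Pp.
  by have := sumE p Pp; rewrite cN mul0r add0r.
exists (fun i => - (c None)^-1 * c (Some i)) => p Pp.
apply: (mulfI cN); have /eqP := sumE p Pp; rewrite addr_eq0 => /eqP ->.
rewrite mulr_sumr -sumrN; apply: eq_bigr => i _.
by rewrite !mulrA mulrN mulfV // mulN1r mulNr.
Qed.

(** If the [f i] are independent on [P], their products with the powers of [g] of exponent below N
    are independent on [Q]. This produces N times N^r functions of degree linear in N, too many for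
    dimension [r]. *)
Lemma dim_strict P Q g r q : irr X Q -> P `<=` Q -> regular X g ->
  (forall p, P p -> g p = 0) -> Q q -> g q != 0 ->
  dim_ge X P r -> dim_le X Q r -> False.
Proof.
move=> iQ PQ [m Hg] g0 Qq gq [e He] [C HC].
have key N M n (f : 'I_n -> T -> K) :
    (forall i, pol X M (f i)) ->
    (forall c : 'I_n -> K, (forall p, P p -> \sum_i c i * f i p = 0) -> forall i, c i = 0) ->
    forall c : nat -> 'I_n -> K,
    (forall p, Q p -> \sum_(a < N) g p ^+ a * \sum_i c a i * f i p = 0) ->
    forall (a : 'I_N) i, c a i = 0.
  (* On [P] only the term of exponent 0 survives; once its coefficients vanish, a factor [g] can be
     cancelled because [Q] is irreducible and [g] is not zero on it. *)
  move=> Hf H; elim: N => [|N IH] c Hc; first by case.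
  have c0 i : c 0%N i = 0.
    apply: (H (c 0%N)) => p Pp; rewrite -[RHS](Hc p (PQ p Pp)) big_ord_recl expr0 mul1r.
    rewrite [X in _ + X]big1 ?addr0 // => a _; by rewrite g0 // expr0n mul0r.
  have HcS p : Q p -> \sum_(a < N) g p ^+ a * \sum_i c a.+1 i * f i p = 0.
    move=> Qp; have [|||g00|] := iQ.2 g
      (fun p => \sum_(a < N) g p ^+ a * \sum_i c a.+1 i * f i p) _ _ _.
    - by exists m.
    - apply: regular_sum => a; apply: regularM; first by exists (a * m)%N; exact: pol_exp.
      by exists M; apply: pol_sum => i; exact: pol_scale.
    - move=> p' Qp'; rewrite -[RHS](Hc p' Qp') big_ord_recl expr0 mul1r.
      rewrite [X in X + _]big1 ?add0r; last by move=> i _; rewrite c0 mul0r.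
      by rewrite mulr_sumr; apply: eq_bigr => a _; rewrite mulrA -exprS.
    - by rewrite g00 ?eqxx in gq.
    - by apply.
  by case=> [[|a] lta] i //=; apply: (IH (fun a => c a.+1) HcS (Ordinal (_ : a < N)%N)).
have ind N : indep X Q ((m + e) * N) (N * N ^ r).
  have [f [Hf H]] := He N.
  have -> : (N * N ^ r)%N = #|{: 'I_N * 'I_(N ^ r)}| by rewrite card_prod !card_ord.
  apply: (indep_fin (f := fun (x : 'I_N * 'I_(N ^ r)) p => g p ^+ x.1 * f x.2 p)) => [[a i]|c Hc [a i]] /=.
    rewrite mulnDl; apply: pol_mul; last exact: Hf.
    by apply: pol_le (pol_exp a Hg); rewrite mulnC leq_mul2l (ltnW (ltn_ord a)) orbT.
  pose c' (a : nat) (i : 'I_(N ^ r)) := if insub a is Some b then c (b, i) else 0.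
  have -> : c (a, i) = c' a i by rewrite /c' valK.
  apply: (key N _ _ f Hf H) => p Qp; rewrite -[RHS](Hc p Qp).
  transitivity (\sum_a \sum_i c (a, i) * (g p ^+ a * f i p)).
    apply: eq_bigr => b _; rewrite mulr_sumr; apply: eq_bigr => j _.
    by rewrite /c' valK mulrCA.
  by rewrite pair_bigA /=; apply: eq_bigr => -[].
(* The degree (m + e) N plus one is at most (m + e + 1) N, so for this N the family is larger than
   the bound on [Q] allows. *)
pose N := (C * (m + e).+1 ^ r).+1.
have := HC _ _ (ind N); apply/negP; rewrite -ltnNge.
apply: (@leq_ltn_trans (C * ((m + e).+1 * N) ^ r)).
  by rewrite leq_mul2l leq_expn ?orbT // /N; nia.
rewrite expnMn mulnA ltn_pmul2r ?ltnSn //.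
by rewrite expn_gt0.
Qed.

End Generic.

Lemma pol_subst T T' (X : set (T -> K)) (X' : set (T' -> K)) P (s : T -> T') D m e :
  pol X' m D ->
  (forall f, X f -> exists2 F, pol X' (e * m.+1) F &
    forall p, P p -> F (s p) = f p * D (s p) ^+ e) ->
  forall N f, pol X N f -> exists2 F, pol X' (e * N * m.+1) F &
    forall p, P p -> F (s p) = f p * D (s p) ^+ (e * N).
Proof.
move=> HD HX N f; elim=> {N f} [N c|N f Xf|N f g _ [F HF FE] _ [G HG GE]|
    N M f g _ [F HF FE] _ [G HG GE]].
- exists (fun q => c * D q ^+ (e * N)) => //.
  by apply: pol_scale; apply: pol_le (pol_exp _ HD); rewrite leq_mul2l leqnSn orbT.
- have [F HF FE] := HX f Xf; exists (fun q => F q * D q ^+ (e * N)).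
    rewrite (mulnS e N) mulnDl; apply: pol_mul => //.
    by apply: pol_le (pol_exp _ HD); rewrite leq_mul2l leqnSn orbT.
  by move=> p Pp; rewrite FE // -mulrA -exprD mulnS.
- exists (fun q => F q + G q); first exact: pol_add.
  by move=> p Pp; rewrite FE // GE // mulrDl.
- exists (fun q => F q * G q); first by rewrite mulnDr mulnDl; exact: pol_mul.
  by move=> p Pp; rewrite FE // GE // mulnDr exprD mulrACA.
Qed.

(** The hypothesis runs against [s]: the coordinates of [p] are fractions in those of [s p], with
    one exponent for all. Clearing denominators multiplies every function of the family by the same
    power of [D], which preserves independence. *)
Lemma indep_subst T T' (X : set (T -> K)) (X' : set (T' -> K)) P P' (s : T -> T') D m e :
  pol X' m D ->
  (forall f, X f -> exists2 h, rat X' D m e h & forall p, P p -> h (s p) = f p) ->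
  (forall p, P p -> P' (s p) /\ D (s p) != 0) ->
  forall N n, indep X P N n -> indep X' P' (e * N * m.+1) n.
Proof.
move=> HD HX sP N n [f [Hf H]].
have HX' g : X g -> exists2 F, pol X' (e * m.+1) F &
    forall p, P p -> F (s p) = g p * D (s p) ^+ e.
  move=> /HX[h [F HF FE] hE]; exists F => // p Pp.
  by rewrite FE ?hE //; have [] := sP p Pp.
have /choice[F HF] i : exists F, pol X' (e * N * m.+1) F /\
    forall p, P p -> F (s p) = f i p * D (s p) ^+ (e * N).
  by have [F ? ?] := pol_subst HD HX' (Hf i); exists F.
exists F; split=> [i|c Hc]; first by have [] := HF i.
apply: H => p Pp; have [P's Ds] := sP p Pp.
apply: (mulIf (expf_neq0 (e * N) Ds)); rewrite mul0r mulr_suml -[RHS](Hc _ P's).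
by apply: eq_bigr => i _; rewrite (HF i).2 // mulrA.
Qed.

Lemma dim_le_subst T T' (X : set (T -> K)) (X' : set (T' -> K)) P P' (s : T -> T') D m e r :
  pol X' m D ->
  (forall f, X f -> exists2 h, rat X' D m e h & forall p, P p -> h (s p) = f p) ->
  (forall p, P p -> P' (s p) /\ D (s p) != 0) ->
  dim_le X' P' r -> dim_le X P r.
Proof.
move=> HD HX sP [C HC]; exists (C * (e * m.+1).+1 ^ r)%N => N n.
move=> /(indep_subst HD HX sP)/HC le; apply: leq_trans le _.
by rewrite -[leqRHS]mulnA -expnMn leq_mul2l leq_expn ?orbT //; nia.
Qed.

Lemma dim_ge_subst T T' (X : set (T -> K)) (X' : set (T' -> K)) P P' (s : T -> T') D m e r :
  pol X' m D ->
  (forall f, X f -> exists2 h, rat X' D m e h & forall p, P p -> h (s p) = f p) ->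
  (forall p, P p -> P' (s p) /\ D (s p) != 0) ->
  dim_ge X P r -> dim_ge X' P' r.
Proof.
move=> HD HX sP [d H]; exists (e * d * m.+1)%N => N.
have := indep_subst HD HX sP (H N); congr indep; nia.
Qed.

Section Product.
Context {T : Type} {J : eqType} (X : set (T -> K)).

(** Only the variables in [s] count as functions, so that variables can be added one at a time over
    the fixed set [prodP P]. *)
Definition prodX (s : seq J) : set (T * (J -> K) -> K) :=
  [set f | (exists2 g, X g & f = g \o fst) \/ exists2 j, j \in s & f = fun q => q.2 j].

Definition prodP (P : set T) : set (T * (J -> K)) := [set q | P q.1].

Lemma prodX_sub s t : {subset s <= t} -> prodX s `<=` prodX t.
Proof. by move=> st f [?|[j js fE]]; [left|right; exists j => //; exact: st]. Qed.

Lemma pol_sub (X1 X2 : set (T * (J -> K) -> K)) N f : X1 `<=` X2 -> pol X1 N f -> pol X2 N f.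
Proof.
move=> S; elim=> {N f} [N c|N f /S|N f g _ ? _ ?|N M f g _ ? _ ?].
- exact: pol_cst.
- exact: pol_gen.
- exact: pol_add.
- exact: pol_mul.
Qed.

Definition upd (z : J -> K) j x : J -> K := fun k => if k == j then x else z k.

Lemma pol_upd s N f j x : j \notin s -> pol (prodX s) N f ->
  forall q, f (q.1, upd q.2 j x) = f q.
Proof.
move=> js; elim=> {N f} [//|N f [[g _ ->] //|[k ks ->] q /=]|N f g _ Hf _ Hg q|
   N M f g _ Hf _ Hg q].
- by rewrite /upd; case: eqP => // e; rewrite e (negbTE js) in ks.
- by rewrite Hf Hg.
- by rewrite Hf Hg.
Qed.

Lemma pol_split j s N f : pol (prodX (j :: s)) N f ->
  exists F : nat -> T * (J -> K) -> K, (forall a, pol (prodX s) N (F a)) /\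
    forall q, f q = \sum_(a < N.+1) F a q * q.2 j ^+ a.
Proof.
move=> Hf; suff [P [P1 P2 P3]] : exists P : T * (J -> K) -> {poly K},
    [/\ (forall a, pol (prodX s) N (fun q => (P q)`_a)),
      forall q, (size (P q) <= N.+1)%N & forall q, f q = (P q).[q.2 j]].
  exists (fun a q => (P q)`_a); split=> // q.
  by rewrite P3 (horner_coef_wide _ (P2 q)).
elim: Hf => {N f} [N c|N f Xf|N f g _ [P [P1 P2 P3]] _ [Q [Q1 Q2 Q3]]|
    N M f g _ [P [P1 P2 P3]] _ [Q [Q1 Q2 Q3]]].
- exists (fun=> c%:P); split=> [a|q|q].
  + exact: pol_cst.
  + by rewrite (leq_trans (size_polyC_leq1 _)).
  + by rewrite hornerC.
- have [Hf|fE] : prodX s f \/ f = fun q => q.2 j.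
    case: Xf => [?|[k]]; first by left; left.
    by rewrite inE => /orP[/eqP -> ->|ks ->]; [right|left; right; exists k].
    exists (fun q => (f q)%:P); split=> [a|q|q].
    + apply: (pol_eq (f := fun q => f q * (a == 0%N)%:R)).
        by move=> q; rewrite coefC; case: (a == 0%N); rewrite ?mulr1 ?mulr0.
      by rewrite -[N.+1]addn0; apply: pol_mul; [exact: pol_gen|exact: pol_cst].
    + by rewrite (leq_trans (size_polyC_leq1 _)).
    + by rewrite hornerC.
  exists (fun=> 'X); split=> [a|q|q].
  + exact: pol_cst.
  + by rewrite size_polyX.
  + by rewrite hornerX fE.
- exists (fun q => P q + Q q); split=> [a|q|q].
  + apply: (pol_eq (f := fun q => (P q)`_a + (Q q)`_a)); last exact: pol_add.
    by move=> q; rewrite coefD.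
  + by rewrite (leq_trans (size_polyD _ _)) // geq_max P2 Q2.
  + by rewrite hornerD P3 Q3.
- exists (fun q => P q * Q q); split=> [a|q|q].
  + apply: (pol_eq (f := fun q => \sum_(i < a.+1) (P q)`_i * (Q q)`_(a - i))).
      by move=> q; rewrite coefM.
    by apply: pol_sum => i; apply: pol_mul.
  + rewrite (leq_trans (size_polyMleq _ _)) //.
    by have := leq_add (P2 q) (Q2 q); lia.
  + by rewrite hornerM P3 Q3.
Qed.

(** After expansion in powers of the new variable, a spanning family of the old functions times the
    N + 1 first powers spans. *)
Lemma dim_le_step P j s r :
  dim_le (prodX s) (prodP P) r -> dim_le (prodX (j :: s)) (prodP P) r.+1.
Proof.
move=> [C HC]; exists C => N n; have [M [u [leM Hu span]]] := indep_span (HC N).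
move=> H; suff : (n <= #|{: 'I_M * 'I_N.+1}|)%N.
  rewrite card_prod !card_ord => le; apply: leq_trans le _.
  by rewrite expnSr mulnA leq_mul2r leM orbT.
apply: (span_indep (u := fun (x : 'I_M * 'I_N.+1) q => u x.1 q * q.2 j ^+ x.2) _ H) => f /pol_split[F [HF fE]].
have /choice[c Hc] a : exists c : 'I_M -> K,
    forall q, prodP P q -> F a q = \sum_i c i * u i q by exact: span.
exists (fun x : 'I_M * 'I_N.+1 => c x.2 x.1) => q Pq; rewrite fE.
transitivity (\sum_(a < N.+1) \sum_i c a i * (u i q * q.2 j ^+ a)).
  by apply: eq_bigr => a _; rewrite Hc // mulr_suml; apply: eq_bigr => i _; rewrite mulrA.
by rewrite exchange_big pair_bigA /=; apply: eq_bigr => -[].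
Qed.

Lemma dim_ge_step P j s r : j \notin s ->
  dim_ge (prodX s) (prodP P) r -> dim_ge (prodX (j :: s)) (prodP P) r.+1.
Proof.
move=> js [e He]; exists e.+1 => N; have [f [Hf H]] := He N.
have -> : (N ^ r.+1)%N = #|{: 'I_(N ^ r) * 'I_N}| by rewrite card_prod !card_ord expnSr.
apply: (indep_fin (f := fun (x : 'I_(N ^ r) * 'I_N) q => f x.1 q * q.2 j ^+ x.2)).
  move=> [i a] /=; rewrite mulSn addnC; apply: pol_mul.
    by apply: pol_sub (Hf i); apply: prodX_sub => k ks; rewrite inE ks orbT.
  apply: (@pol_le _ _ _ (a * 1)); first by rewrite muln1 ltnW.
  by apply: pol_exp; apply: pol_gen; right; exists j; rewrite ?mem_head.
move=> c Hc [i a].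
apply: (H (fun i => c (i, a))) => q Pq {i}.
(* For fixed [q], letting the variable [j] vary turns the relation into a polynomial identity,
   because the [f i] do not depend on [j]. *)
pose p := \poly_(b < N) (if insub b is Some b' then \sum_i c (i, b') * f i q else 0).
have p0 : p = 0.
  apply: poly_eq0_eval => x.
  rewrite horner_poly -[RHS](Hc (q.1, upd q.2 j x) Pq).
  transitivity (\sum_(b < N) \sum_i c (i, b) * (f i q * x ^+ b)).
    apply: eq_bigr => b _; rewrite valK mulr_suml; apply: eq_bigr => i _.
    by rewrite mulrA.
  rewrite exchange_big pair_bigA /=; apply: eq_bigr => -[i b] _ /=.
  by rewrite (pol_upd x js (Hf i)) /upd eqxx.
by have := coef_poly N (fun b => if insub b is Some b' then \sum_i c (i, b') * f i q else 0) a;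
   rewrite -/p p0 coef0 ltn_ord valK.
Qed.

Lemma dim_prod0 P : P !=set0 ->
  (forall r, dim_le X P r -> dim_le (prodX [::]) (prodP P) r) /\
  (forall r, dim_ge X P r -> dim_ge (prodX [::]) (prodP P) r).
Proof.
move=> P0; split=> r.
  apply: (@dim_le_subst _ _ _ _ _ _ fst (fun=> 1) 0 1) => //.
  - exact: pol_cst.
  - move=> f [[g Xg ->]|[]//]; exists g => //; exists g; first exact: pol_gen.
    by move=> p _; rewrite mulr1.
  - by move=> q Pq; rewrite oner_eq0.
apply: (@dim_ge_subst _ _ _ _ _ _ (fun p => (p, fun=> 0)) (fun=> 1) 0 1) => //.
- exact: pol_cst.
- move=> f Xf; exists (f \o fst) => //; exists (f \o fst); last by move=> p _; rewrite mulr1.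
  by apply: pol_gen; left; exists f.
- by move=> q Pq; rewrite oner_eq0.
Qed.

End Product.

Lemma dim_prod T (J : finType) (X : set (T -> K)) P r : P !=set0 ->
  (dim_le X P r -> dim_le (prodX X (enum J)) (prodP P) (r + #|J|)) /\
  (dim_ge X P r -> dim_ge (prodX X (enum J)) (prodP P) (r + #|J|)).
Proof.
move=> P0; have [le0 ge0] := @dim_prod0 T J X P P0.
rewrite cardE; have := enum_uniq J; elim: (enum J) => [_|j s IH] /=.
  by rewrite addn0; split; [exact: le0|exact: ge0].
move=> /andP[js /IH[le ge]]; rewrite addnS; split=> H.
  exact/dim_le_step/le.
exact/dim_ge_step/ge.
Qed.

Lemma irr_prod T (J : finType) (X : set (T -> K)) P :
  irr X P -> irr (prodX X (enum J)) (prodP P).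
Proof.
move=> iP; have [[p0 Pp0] _] := iP.
apply: (irr_transfer (G := fun p q => q.1 = p) iP).
- by exists (p0, fun=> 0).
- move=> [p z] f Pp Hf fp; exists (fun p => f (p, z)); split.
  + case: Hf => N; elim=> {fp N f} [N c|N f [[g Xg ->]|[j _ ->]]|N f g _ ? _ ?|N M f g _ ? _ ?].
    * exact: regular_cst.
    * exact: regular_gen.
    * exact: regular_cst.
    * exact: regularD.
    * exact: regularM.
  + by exists p.
  + by move=> p' Pp' fp'; exists (p', z).
- move=> p f g [_ z1] [_ z2] Pp Hf Hg _ /= -> f1 _ -> g2.
  pose l x : J -> K := fun j => z1 j + x * (z2 j - z1 j).
  have l0 : l 0 = z1 by apply: funext => j; rewrite /l mul0r addr0.
  have l1 : l 1 = z2 by apply: funext => j; rewrite /l mul1r addrC subrK.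
  have lreg h : regular (prodX X (enum J)) h -> regular [set (@id K)] (fun x => h (p, l x)).
    case=> N; elim=> {N h} [N c|N h [[g' Xg ->]|[j _ ->]]|N h k _ ? _ ?|N M h k _ ? _ ?].
    * exact: regular_cst.
    * exact: (regular_cst _ (g' p)).
    * apply: regularD; first exact: regular_cst.
      by apply: regularM; [exact: regular_gen|exact: regular_cst].
    * exact: regularD.
    * exact: regularM.
  have [||x [_ fx gx]] :=
    irr_meet irr_line (lreg f Hf) (lreg g Hg) (I : setT (0 : K)) _ (I : setT (1 : K)) _.
  + by rewrite l0.
  + by rewrite l1.
  by exists (p, l x).
Qed.

End Growth.

(** * Representations around a vertex *)

Section Splitting.
Context {K : fieldType}.

(** A direct sum decomposition of K^N: [f] and [g] are the inclusions of the summands, [r] and [s]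
    the projections. *)
Definition splitting m N k (f : 'M[K]_(m, N)) (r : 'M[K]_(N, m))
    (g : 'M[K]_(k, N)) (s : 'M[K]_(N, k)) :=
  [/\ f *m r = 1%:M, f *m s = 0, g *m r = 0, g *m s = 1%:M & r *m f + s *m g = 1%:M].

Lemma splitting_exists m N (f : 'M[K]_(m, N)) : row_free f ->
  exists r (g : 'M[K]_(N - m, N)) s, splitting f r g s.
Proof.
move=> ff; have mN : (m <= N)%N by rewrite -(eqP ff) rank_leq_col.
(* The dimension of the complement is generalized before being identified with N - m, which avoids a
   cast. *)
have [k [kE [g Hg]]] : exists k, k = (N - m)%N /\
    exists g : 'M[K]_(k, N), row_free (col_mx f g) /\ row_full (col_mx f g).
  exists (\rank (f^C)%MS); split; first by rewrite mxrank_compl (eqP ff).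
  exists (row_base (f^C)%MS).
  have full : row_full (col_mx f (row_base (f^C)%MS)).
    rewrite /row_full -addsmxE (adds_eqmx (eqmx_refl f) (eq_row_base _)).
    exact: addsmx_compl_full.
  split=> //; rewrite /row_free (eqP full) mxrank_compl (eqP ff).
  by rewrite subnKC.
subst k; case: Hg => /row_freeP[R cR] /row_fullP[L Lc].
have LR : L = R by rewrite -[L]mulmx1 -cR mulmxA Lc mul1mx.
exists (lsubmx R), g, (rsubmx R).
move: cR; rewrite -{1}[R]hsubmxK mul_col_row.
rewrite -[1%:M]submxK => /eq_block_mx[e1 e2 e3 e4].
have := Lc; rewrite LR -{1}[R]hsubmxK mul_row_col => e5.
split=> //.
- by rewrite e1; apply/matrixP => a b; rewrite !mxE.
- rewrite e2; apply/matrixP => a b; rewrite !mxE.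
  by case: eqP => // e; have := ltn_ord a; move: (congr1 val e) => /=; lia.
- rewrite e3; apply/matrixP => a b; rewrite !mxE.
  by case: eqP => // e; have := ltn_ord b; move: (congr1 val e) => /=; lia.
- rewrite e4; apply/matrixP => a b; rewrite !mxE; congr (_%:R).
  by rewrite -!val_eqE /= eqn_add2l.
Qed.

Lemma mulmx_dim0 a m b (M : 'M[K]_(a, m)) (N : 'M[K]_(m, b)) : m = 0%N -> M *m N = 0.
Proof. by move=> e; subst m; rewrite thinmx0 mul0mx. Qed.

Lemma genmx_eq0 m N (M : 'M[K]_(m, N)) : (<<M>>%MS == 0) = (M == 0).
Proof. by rewrite -!mxrank_eq0 genmxE. Qed.

End Splitting.

Section Reps.
Context {K : numFieldType} {n : nat} {A : sym_gcm n} (Om : orientation A).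
Context {d : {ffun 'I_n -> nat}}.
Implicit Types v : {ffun 'I_n -> nat}.

Lemma dart_neq i j (k : dart A i j) : i != j.
Proof. by apply/eqP => e; subst j; case: k => x; rewrite /edge_mult eqxx. Qed.

Lemma dart_revK i j (k : dart A i j) : dart_rev (dart_rev k) = k.
Proof. exact: val_inj. Qed.

Lemma dart_rev_sign i j (k : dart A i j) : dart_sign (K := K) Om k != 0.
Proof. by rewrite /dart_sign; case: (Om _ _ _); rewrite ?oppr_eq0 oner_eq0. Qed.

Definition inj_at v (p : rep K A v d) j := forall u : 'rV[K]_(v j),
  (forall l (k : dart A j l), u *m rep_x p k = 0) -> u *m rep_t p j = 0 -> u = 0.

Lemma stable_inj v (p : rep K A v d) : stable p -> forall j, inj_at p j.
Proof.
move=> st j u ux ut.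
pose S := eqtype.dfwith (T := fun l => 'M[K]_(v l)) (fun l => 0) (i := j) <<u>>%MS.
have : S j = 0.
  apply: st => [i l k|i].
    have [ij|ij] := eqVneq j i; last by rewrite /S eqtype.dfwith_out // mul0mx sub0mx.
    subst i; rewrite /S eqtype.dfwith_in.
    rewrite (_ : _ *m _ = 0) ?sub0mx //; apply/sub_kermxP.
    by rewrite genmxE; apply/sub_kermxP.
  have [ij|ij] := eqVneq j i; last by rewrite /S eqtype.dfwith_out // mul0mx.
  subst i; rewrite /S eqtype.dfwith_in.
  by apply/sub_kermxP; rewrite genmxE; apply/sub_kermxP.
by rewrite /S eqtype.dfwith_in => /eqP; rewrite genmx_eq0 => /eqP.
Qed.

(** With [stable_inj], stability becomes a condition at each vertex. Paths of length N annihilate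
    [S]; if those of length m + 1 do, injectivity at the end of a path of length m shows that this
    path does too, down to the empty path. *)
Lemma nilpotent_inj_stable v (p : rep K A v d) :
  nilpotent p -> (forall j, inj_at p j) -> stable p.
Proof.
move=> [N _ HN] inj S Sx St j.
have H m : (m <= N)%N -> forall i l (M : 'M_(v i, v l)), x_path p (N - m)%N M ->
    S i *m M = 0.
  elim: m => [|m IH] le i l M pM.
    by rewrite subn0 in pM; rewrite (HN _ _ _ pM) mulmx0.
  have subS : (S i *m M <= S l)%MS.
    elim: pM => {i l M} [i|k i l l' M q _ IHM]; first by rewrite mulmx1.
    by rewrite mulmxA (submx_trans (submxMr _ IHM)) // Sx.
  apply/row_matrixP => a; rewrite row0; apply: (inj l).
    move=> l' k; rewrite -row_mul -mulmxA (IH (ltnW le)) ?row0 //.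
    by rewrite -subnSK //; exact: x_pathS.
  rewrite -row_mul; have /submxP[E ->] := subS.
  by rewrite -mulmxA St mulmx0 row0.
have := H N (leqnn N) j j 1%:M; rewrite subnn mulmx1; apply.
exact: x_path0.
Qed.

Lemma morphism_path v v' (q : rep K A v' d) (p : rep K A v d) phi N i j
    (M : 'M_(v' i, v' j)) : is_morphism q p phi -> x_path q N M ->
  exists2 M', x_path p N M' & M *m phi j = phi i *m M'.
Proof.
move=> [mx _]; elim=> {N i j M} [i|N i j l M k _ [M' pM' e]].
  by exists 1%:M; [exact: x_path0|rewrite mul1mx mulmx1].
exists (M' *m rep_x p k); first exact: x_pathS.
by rewrite -mulmxA mx !mulmxA e.
Qed.

Lemma subrep_lambda v v' (q : rep K A v' d) (p : rep K A v d) :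
  is_subrep q p -> lambda_st Om p -> lambda_st Om q.
Proof.
move=> [phi mphi fphi] [[N N0 nil] pre st]; have [mx mt] := mphi; split.
- exists N => // i j M /(morphism_path mphi)[M' /nil -> e].
  by apply: (row_free_inj (fphi j)); rewrite e mulmx0 mul0mx.
- move=> i; apply: (row_free_inj (fphi i)); rewrite mul0mx -[RHS](mulmx0 _ (phi i)).
  rewrite -[in RHS](pre i) mulmx_suml mulmx_sumr; apply: eq_bigr => j _.
  rewrite mulmx_suml mulmx_sumr; apply: eq_bigr => k _.
  by rewrite -scalemxAl -scalemxAr -mulmxA mx mulmxA mx mulmxA.
- move=> S Sx St i; have : <<S i *m phi i>>%MS = 0.
    apply: (st (fun i => <<S i *m phi i>>%MS)) => [i' j k|i'].
      rewrite (eqmxMr _ (genmxE _)) genmxE -mulmxA -mx mulmxA.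
      exact/submxMr/Sx.
    apply/sub_kermxP; rewrite genmxE; apply/sub_kermxP.
    by rewrite -mulmxA -mt St.
  move/eqP; rewrite genmx_eq0 => /eqP e.
  by apply: (row_free_inj (fphi i)); rewrite e mul0mx.
Qed.

Lemma is_subrep_trans v1 v2 v3 (p1 : rep K A v1 d) (p2 : rep K A v2 d)
    (p3 : rep K A v3 d) : is_subrep p1 p2 -> is_subrep p2 p3 -> is_subrep p1 p3.
Proof.
move=> [f [fx ft] ff] [g [gx gt] gf]; exists (fun i => f i *m g i); last first.
  by move=> i; rewrite /row_free mxrankMfree // -/(row_free _).
split=> [i j k|i]; first by rewrite mulmxA fx -!mulmxA gx.
by rewrite ft gt mulmxA.
Qed.

Lemma restriction_subrep v v' i (p : rep K A v d) (q : rep K A v' d) :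
  is_restriction i p q -> is_subrep q p.
Proof. by move=> [phi m fphi]; exists phi => // j; have [] := fphi j. Qed.

(* The index set of a basis of the sum of the V_in(h), out(h) = i, and of D_i *)
Definition hidx v i : finType :=
  ({b : 'I_n & (dart A i b * 'I_(v b))%type} + 'I_(d i))%type.

Definition hdim v i := #|hidx v i|.

Lemma hdimE v i : hdim v i = (d i + \sum_b edge_mult A i b * v b)%N.
Proof.
rewrite /hdim card_sum card_ord card_tagged addnC sumnE big_map big_enum /=.
by congr addn; apply: eq_bigr => b _; rewrite card_prod !card_ord.
Qed.

Section Flat.
Context (v : {ffun 'I_n -> nat}) (i : 'I_n) (m : nat).
Implicit Types (X : forall b, dart A i b -> 'M[K]_(m, v b)) (Z : 'M[K]_(m, d i)).

Definition flat X Z : 'M[K]_(m, hdim v i) := \matrix_(a, s)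
  match (enum_val s : hidx v i) with
  | inl x => X (tag x) (tagged x).1 a (tagged x).2
  | inr z => Z a z
  end.

Definition hleft b (k : dart A i b) (z : 'I_(v b)) : hidx v i :=
  inl (Tagged (fun b => (dart A i b * 'I_(v b))%type) (k, z)).

Definition unflatx (Y : 'M[K]_(m, hdim v i)) b (k : dart A i b) : 'M[K]_(m, v b) :=
  \matrix_(a, z) Y a (enum_rank (hleft k z)).

Definition unflatt (Y : 'M[K]_(m, hdim v i)) : 'M[K]_(m, d i) :=
  \matrix_(a, z) Y a (enum_rank (inr z : hidx v i)).

Lemma flatKx X Z b (k : dart A i b) : unflatx (flat X Z) k = X b k.
Proof. by apply/matrixP => a z; rewrite !mxE enum_rankK. Qed.

Lemma flatKt X Z : unflatt (flat X Z) = Z.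
Proof. by apply/matrixP => a z; rewrite !mxE enum_rankK. Qed.

Lemma unflatK Y : flat (unflatx Y) (unflatt Y) = Y.
Proof.
apply/matrixP => a s; rewrite !mxE; case e: (enum_val s) => [[b [k z]]|z];
  rewrite !mxE; congr (Y a _); apply: enum_val_inj; rewrite enum_rankK e //.
Qed.

Lemma flat_inj Y Y' : (forall b (k : dart A i b), unflatx Y k = unflatx Y' k) ->
  unflatt Y = unflatt Y' -> Y = Y'.
Proof.
move=> ex et; rewrite -[Y]unflatK -[Y']unflatK et; congr (flat _ _).
by apply: functional_extensionality_dep => b; apply: functional_extensionality_dep => k.
Qed.

Lemma unflatxD Y Y' b (k : dart A i b) :
  unflatx (Y + Y') k = unflatx Y k + unflatx Y' k.
Proof. by apply/matrixP => a z; rewrite !mxE. Qed.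

Lemma unflattD Y Y' : unflatt (Y + Y') = unflatt Y + unflatt Y'.
Proof. by apply/matrixP => a z; rewrite !mxE. Qed.

End Flat.

Lemma unflatx_mul v i m m' (L : 'M[K]_(m', m)) (Y : 'M[K]_(m, hdim v i)) b
  (k : dart A i b) : unflatx (L *m Y) k = L *m unflatx Y k.
Proof. by apply/matrixP => a z; rewrite !mxE; apply: eq_bigr => c _; rewrite !mxE. Qed.

Lemma unflatt_mul v i m m' (L : 'M[K]_(m', m)) (Y : 'M[K]_(m, hdim v i)) :
  unflatt (L *m Y) = L *m unflatt Y.
Proof. by apply/matrixP => a z; rewrite !mxE; apply: eq_bigr => c _; rewrite !mxE. Qed.

Lemma flat_mul v i m m' (L : 'M[K]_(m', m)) (X : forall b, dart A i b -> 'M[K]_(m, v b)) Z :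
  L *m flat X Z = flat (fun b k => L *m X b k) (L *m Z).
Proof. by apply: flat_inj => [b k|]; rewrite ?unflatx_mul ?unflatt_mul ?flatKx ?flatKt. Qed.

(* The map from that sum to V_i given by the signed incoming maps. *)
Definition bmat v i m (W : forall b, dart A b i -> 'M[K]_(v b, m)) :
    'M[K]_(hdim v i, m) := \matrix_(s, u)
  match (enum_val s : hidx v i) with
  | inl x => dart_sign Om (dart_rev (tagged x).1) * W (tag x) (dart_rev (tagged x).1) (tagged x).2 u
  | inr _ => 0
  end.

Lemma mul_bmat v i m m' (Y : 'M[K]_(m', hdim v i))
    (W : forall b, dart A b i -> 'M[K]_(v b, m)) :
  Y *m bmat W = \sum_b \sum_(k : dart A b i)
    dart_sign Om k *: (unflatx Y (dart_rev k) *m W b k).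
Proof.
apply/matrixP => a u; rewrite !mxE summxE.
rewrite (reindex (@enum_rank (hidx v i))) /=; last first.
  by exists enum_val => ? _; rewrite ?enum_rankK ?enum_valK.
rewrite big_sumType /= [X in _ + X]big1 ?addr0; last first.
  by move=> z _; rewrite mxE enum_rankK mulr0.
transitivity (\sum_b \sum_(k : dart A i b) \sum_z
  Y a (enum_rank (hleft k z)) * (dart_sign Om (dart_rev k) * W b (dart_rev k) z u)).
  under [RHS]eq_bigr do rewrite pair_bigA /=.
  rewrite sig_big_dep /=; apply: eq_bigr => -[b [k z]] _ /=.
  by rewrite mxE enum_rankK.
apply: eq_bigr => b _; rewrite summxE (reindex (@dart_rev n A b i)) /=; last first.
  by exists (@dart_rev n A i b) => k _; rewrite dart_revK.
apply: eq_bigr => k _; rewrite !mxE mulr_sumr; apply: eq_bigr => z _.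
by rewrite !mxE dart_revK mulrCA.
Qed.

Lemma bmat_mul v i m m' (W : forall b, dart A b i -> 'M[K]_(v b, m)) (M : 'M[K]_(m, m')) :
  bmat W *m M = bmat (fun b k => W b k *m M).
Proof.
apply/matrixP => s u; rewrite !mxE; case e: (enum_val s) => [[b [k z]]|z] /=.
  by rewrite mxE mulr_sumr; apply: eq_bigr => c _; rewrite !mxE e /= mulrA.
by rewrite big1 // => c _; rewrite mxE e mul0r.
Qed.

Lemma bmat_span v i m (W : forall b, dart A b i -> 'M[K]_(v b, m)) :
  (bmat W :=: \sum_b \sum_(k : dart A b i) <<W b k>>)%MS.
Proof.
apply/eqmxP/andP; split.
  apply/row_subP => s; case e: (enum_val s) => [[b [k z]]|z].
    rewrite (_ : row s _ = dart_sign Om (dart_rev k) *: row z (W b (dart_rev k))).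
      rewrite scalemx_sub // (sumsmx_sup b) // (sumsmx_sup (dart_rev k)) // genmxE.
      exact: row_sub.
    by apply/rowP => u; rewrite !mxE e.
  by rewrite (_ : row s _ = 0) ?sub0mx //; apply/rowP => u; rewrite !mxE e.
apply/sumsmx_subP => b _; apply/sumsmx_subP => k _; rewrite genmxE.
apply/row_subP => z.
rewrite (_ : row z _ = (dart_sign Om k)^-1 *: row (enum_rank (hleft (dart_rev k) z)) (bmat W)).
  by rewrite scalemx_sub // row_sub.
apply/rowP => u; rewrite !mxE enum_rankK /= dart_revK mulKf //.
exact: dart_rev_sign.
Qed.

(** [amat] and [bm] are the two maps of the complex at [i], from V_i to the sum of the V_in(h) and
    D_i and back to V_i. The preprojective relation makes their product zero, stability makes [amat]
    injective, and [eps] is the corank of [bm]. *)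
Definition amat v (p : rep K A v d) i : 'M[K]_(v i, hdim v i) :=
  flat (fun b (k : dart A i b) => rep_x p k) (rep_t p i).

Definition bm v (p : rep K A v d) i : 'M[K]_(hdim v i, v i) :=
  bmat (fun b (k : dart A b i) => rep_x p k).

Lemma bm_incoming v (p : rep K A v d) i : (bm p i :=: incoming p i)%MS.
Proof. exact: bmat_span. Qed.

Lemma eps_bm v (p : rep K A v d) i : eps i p = (v i - \rank (bm p i))%N.
Proof. by rewrite /eps (bm_incoming p i). Qed.

Lemma preprojectiveP v (p : rep K A v d) :
  preprojective Om p <-> forall i, amat p i *m bm p i = 0.
Proof.
have E i : amat p i *m bm p i = \sum_j \sum_(k : dart A j i)
    dart_sign Om k *: (rep_x p (dart_rev k) *m rep_x p k).
  by rewrite mul_bmat; apply: eq_bigr => b _; apply: eq_bigr => k _; rewrite flatKx.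
by split=> H i; have := H i; rewrite E.
Qed.

Lemma inj_atP v (p : rep K A v d) i : inj_at p i <-> row_free (amat p i).
Proof.
split=> [inj|free u ux ut].
  rewrite -kermx_eq0; apply/eqP/row_matrixP => a; rewrite row0.
  have e : row a (kermx (amat p i)) *m amat p i = 0 by apply/sub_kermxP; exact: row_sub.
  apply: inj => [l k|].
    by rewrite -(flatKx (fun b (k : dart A i b) => rep_x p k) (rep_t p i) k) -unflatx_mul
      e; apply/matrixP => x y; rewrite !mxE.
  rewrite -(flatKt (fun b (k : dart A i b) => rep_x p k) (rep_t p i)) -unflatt_mul e.
  by apply/matrixP => x y; rewrite !mxE.
apply: (row_free_inj free); rewrite mul0mx flat_mul.
by apply: flat_inj => [b k|]; rewrite ?flatKx ?flatKt ?ux ?ut; apply/matrixP => x y; rewrite !mxE.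
Qed.

Lemma lambdaP v (p : rep K A v d) : lambda_st Om p <->
  [/\ nilpotent p, forall i, amat p i *m bm p i = 0 & forall i, row_free (amat p i)].
Proof.
split=> [[nil /preprojectiveP pre st]|[nil pre fr]].
  by split=> // i; apply/inj_atP/stable_inj.
split=> //; first exact/preprojectiveP.
by apply: nilpotent_inj_stable => // j; apply/inj_atP.
Qed.

Lemma lambda_rank v (p : rep K A v d) i : lambda_st Om p ->
  (v i + \rank (bm p i) <= hdim v i)%N.
Proof.
move=> /lambdaP[_ pre fr]; have := mulmx0_rank_max (pre i).
by rewrite (eqP (fr i)).
Qed.

(** If the incoming maps are jointly surjective at every vertex, so are the paths of any given
    length: a linear form killed by all paths of length N is zero, whereas nilpotency makes all
    these paths vanish. *)
Lemma nilpotent_eps0 v (p : rep K A v d) :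
  nilpotent p -> (forall i, eps i p = 0%N) -> forall i, v i = 0%N.
Proof.
move=> [N _ HN] e0.
have full i : row_full (bm p i).
  rewrite /row_full; have := rank_leq_col (bm p i); have := e0 i; rewrite eps_bm.
  by move=> /eqP; rewrite subn_eq0 => le1 le2; rewrite eqn_leq le1 le2.
have H m j (c : 'cV[K]_(v j)) :
    (forall i (M : 'M_(v i, v j)), x_path p m M -> M *m c = 0) -> c = 0.
  elim: m j c => [|m IH] j c Hc; first by rewrite -[c]mul1mx; apply: Hc; exact: x_path0.
  apply: (row_full_inj (full j)); rewrite mulmx0 bmat_mul.
  apply/matrixP => s u; rewrite !mxE; case: (enum_val s) => // -[b [k z]] /=.
  rewrite (_ : rep_x p (dart_rev k) *m c = 0) ?mxE ?mulr0 //.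
  by apply: IH => i M pM; rewrite mulmxA; apply: Hc; exact: x_pathS.
move=> j; apply/eqP; rewrite -leqn0 leqNgt; apply/negP => vj.
have := H N j (const_mx 1) (fun i M pM => ltac:(by rewrite (HN _ _ _ pM) mul0mx)).
by move/colP/(_ (Ordinal vj)); rewrite !mxE => /eqP; rewrite oner_eq0.
Qed.

End Reps.

(** * Extensions at a vertex *)

Section Restrictions.
Context {K : numFieldType} {n : nat} {A : sym_gcm n} (Om : orientation A).
Context {d : {ffun 'I_n -> nat}}.
Implicit Types v : {ffun 'I_n -> nat}.

Lemma restriction_dims v v' i (p : rep K A v d) (q : rep K A v' d) :
  is_restriction i p q ->
  (forall j, j != i -> v' j = v j) /\ v' i = \rank (bm Om p i).
Proof.
move=> [f _ Hf]; split=> [j ji|].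
  have [/eqP e1 e] := Hf j; move: e; rewrite (negbTE ji) => e.
  by rewrite -e1 e mxrank1.
have [/eqP e1 e] := Hf i; move: e; rewrite eqxx => e.
by rewrite -e1 e (bm_incoming Om).
Qed.

Lemma restriction_le v v' i (p : rep K A v d) (q : rep K A v' d) :
  is_restriction i p q -> forall j, (v' j <= v j)%N.
Proof.
move=> R j; have [e ei] := restriction_dims R.
by have [->|/e -> //] := eqVneq j i; rewrite ei rank_leq_col.
Qed.

Lemma restriction_eps v v' i (p : rep K A v d) (q : rep K A v' d) :
  is_restriction i p q -> eps i p = (v i - v' i)%N.
Proof. by move=> /restriction_dims[_ ->]; rewrite (eps_bm Om). Qed.

(** No dart is a loop, so the sources of the incoming maps are untouched and the image of these maps
    is still the whole new space at [i]. *)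
Lemma restriction_eps0 v v' i (p : rep K A v d) (q : rep K A v' d) :
  is_restriction i p q -> eps i q = 0%N.
Proof.
move=> R; have [e ei] := restriction_dims R.
have [f [mx _] Hf] := R.
apply/eqP; rewrite (eps_bm Om) subn_eq0 [leqLHS]ei.
rewrite -(mxrankMfree (bm Om q i) (Hf i).1) bmat_mul; apply: mxrankS.
rewrite !bmat_span; apply/sumsmx_subP => b _; apply/sumsmx_subP => k _.
rewrite (sumsmx_sup b) // (sumsmx_sup k) // !genmxE mx.
have bi : b != i by exact: dart_neq k.
have [_] := Hf b; rewrite (negbTE bi) => fb.
by have := eqmxMr (rep_x p k) fb; rewrite mul1mx => e'; rewrite e'.
Qed.

Lemma restriction_lambda v v' i (p : rep K A v d) (q : rep K A v' d) :
  is_restriction i p q -> lambda_st Om p -> lambda_st Om q.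
Proof. by move=> /restriction_subrep; exact: subrep_lambda. Qed.

End Restrictions.

Section Extension.
Context {K : numFieldType} {n : nat} {A : sym_gcm n} (Om : orientation A).
Context {d : {ffun 'I_n -> nat}} (v' v : {ffun 'I_n -> nat}).
Local Notation kap j := (v j - v' j)%N.

(** On V' this is [q], and the complement is sent into V' by [Y]. Families over all vertices spare
    casts between equal dimensions: in the use at [i] the complement is zero at the other
    vertices. *)
Definition ext (f : forall j, 'M[K]_(v' j, v j)) (r : forall j, 'M[K]_(v j, v' j))
    (s : forall j, 'M[K]_(v j, kap j)) (q : rep K A v' d)
    (Y : forall j, 'M[K]_(kap j, @hdim n A d v' j)) : rep K A v d :=
  Rep (fun a b k => (r a *m rep_x q k + s a *m unflatx (Y a) k) *m f b)
      (fun a => r a *m rep_t q a + s a *m unflatt (Y a)).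

Definition coext (r : forall j, 'M[K]_(v j, v' j)) (g : forall j, 'M[K]_(kap j, v j))
    (p : rep K A v d) : forall j, 'M[K]_(kap j, @hdim n A d v' j) :=
  fun a => flat (fun b (k : dart A a b) => g a *m rep_x p k *m r b) (g a *m rep_t p a).

Context (f : forall j, 'M[K]_(v' j, v j)) (r : forall j, 'M[K]_(v j, v' j))
  (g : forall j, 'M[K]_(kap j, v j)) (s : forall j, 'M[K]_(v j, kap j)).
Hypothesis sp : forall j, splitting (f j) (r j) (g j) (s j).
Context (i : 'I_n) (offi : forall j, j != i -> v' j = v j).

Lemma kap0 j : j != i -> kap j = 0%N.
Proof. by move=> /offi ->; rewrite subnn. Qed.

Lemma split_off j : j != i -> r j *m f j = 1%:M.
Proof.
move=> ji; have [_ _ _ _] := sp j.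
by rewrite [s j *m _](mulmx_dim0 _ _ (kap0 ji)) addr0.
Qed.

Lemma ext_morphism q Y : is_morphism q (ext f r s q Y) f.
Proof.
split=> [a b k|a] /=; have [e1 e2 _ _ _] := sp a.
  by rewrite mulmxA mulmxDr !mulmxA e1 e2 mul1mx mul0mx addr0.
by rewrite mulmxDr !mulmxA e1 e2 mul1mx mul0mx addr0.
Qed.

Lemma ext_gx q Y a b (k : dart A a b) :
  g a *m rep_x (ext f r s q Y) k = unflatx (Y a) k *m f b.
Proof.
have [_ _ e1 e2 _] := sp a.
by rewrite /= mulmxA mulmxDr !mulmxA e1 e2 mul1mx mul0mx add0r.
Qed.

Lemma ext_gt q Y a : g a *m rep_t (ext f r s q Y) a = unflatt (Y a).
Proof.
have [_ _ e1 e2 _] := sp a.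
by rewrite /= mulmxDr !mulmxA e1 e2 mul1mx mul0mx add0r.
Qed.

(** Every arrow of the extension lands in V', so a path is a path of [q] after its first step, and
    the nilpotency bound grows by one. *)
Lemma ext_nilpotent q Y : nilpotent q -> nilpotent (ext f r s q Y).
Proof.
move=> [N _ HN]; exists N.+1 => // a b M pM.
have H m a' b' (M0 : 'M_(v a', v b')) : x_path (ext f r s q Y) m M0 -> (0 < m)%N ->
    exists c (X : 'M_(v a', v' c)),
      exists2 M' : 'M_(v' c, v' b'), x_path q m.-1 M' & M0 = X *m M' *m f b'.
  elim=> {m a' b' M0} [//|[|m] a' b' c M0 k pM0 IH _].
    exists c, (M0 *m (r b' *m rep_x q k + s b' *m unflatx (Y b') k)), 1%:M.
      exact: x_path0.
    by rewrite mulmx1 -mulmxA.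
  have [x [X [M' pM' ->]]] := IH isT; exists x, X, (M' *m rep_x q k); first exact: x_pathS.
  have [e _] := ext_morphism q Y.
  by rewrite -!mulmxA -e !mulmxA.
have [c [X [M' pM' ->]]] := H _ _ _ _ pM isT.
by rewrite (HN _ _ _ pM') mulmx0 mul0mx.
Qed.

Lemma ext_pre q Y : (forall j, amat q j *m bm Om q j = 0) -> Y i *m bm Om q i = 0 ->
  forall j, amat (ext f r s q Y) j *m bm Om (ext f r s q Y) j = 0.
Proof.
move=> pre Y0 j; have [e1 e2] := ext_morphism q Y.
set p := ext f r s q Y in e1 e2 *.
have pE a (M : 'M[K]_(a, v j)) : M *m (amat p j *m bm Om p j) =
    \sum_b \sum_(k : dart A b j) dart_sign Om k *:
      (M *m rep_x p (dart_rev k) *m rep_x p k).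
  rewrite mulmxA flat_mul mul_bmat; apply: eq_bigr => b _; apply: eq_bigr => k _.
  by rewrite flatKx.
have fp : f j *m (amat p j *m bm Om p j) = 0.
  rewrite pE -[RHS](mul0mx _ (f j)) -(pre j) mul_bmat mulmx_suml; apply: eq_bigr => b _.
  rewrite mulmx_suml; apply: eq_bigr => k _.
  by rewrite flatKx -scalemxAl -e1 -(mulmxA _ (f b)) -e1 mulmxA.
have [_ _ _ _ e] := sp j.
rewrite -[LHS]mul1mx -e mulmxDl -!mulmxA fp mulmx0 add0r.
have [ji|ji] := eqVneq j i; last by rewrite mulmx_dim0 // kap0.
subst j; rewrite (_ : g i *m _ = 0) ?mulmx0 // pE.
rewrite -[RHS](mul0mx _ (f i)) -Y0 mul_bmat mulmx_suml; apply: eq_bigr => b _.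
rewrite mulmx_suml; apply: eq_bigr => k _.
by rewrite ext_gx -scalemxAl -!mulmxA -e1.
Qed.

Lemma ext_inj_off q Y j : j != i -> inj_at q j -> inj_at (ext f r s q Y) j.
Proof.
move=> ji inj u ux ut.
have uE : u = u *m r j *m f j by rewrite -mulmxA split_off // mulmx1.
have [e1 e2] := ext_morphism q Y.
rewrite uE (inj (u *m r j)) ?mul0mx //.
  move=> l k; have [fr _ _ _ _] := sp l.
  rewrite -[LHS]mulmx1 -fr mulmxA -[_ *m rep_x q k *m _]mulmxA e1 mulmxA -uE ux.
  by rewrite mul0mx.
by rewrite e2 mulmxA -uE.
Qed.

Lemma ext_inj_at q Y : row_free (col_mx (amat q i) (Y i)) ->
  inj_at (ext f r s q Y) i.
Proof.
move=> free; have [] := ext_morphism q Y.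
have := @ext_gx q Y; have := @ext_gt q Y.
move: (ext f r s q Y) => p gt gx e1 e2 u ux ut.
have [_ _ _ _ e] := sp i.
have uE : u = (u *m r i) *m f i + (u *m s i) *m g i.
  by rewrite -!mulmxA -mulmxDr e mulmx1.
suff /eqP : row_mx (u *m r i) (u *m s i) *m col_mx (amat q i) (Y i) = 0.
  rewrite mulmx_free_eq0 // => /eqP; rewrite -row_mx0 => /eq_row_mx[e3 e4].
  by rewrite uE e3 e4 !mul0mx addr0.
rewrite mul_row_col; apply: flat_inj => [b k|].
  rewrite unflatxD !unflatx_mul flatKx.
  have [fr _ _ _ _] := sp b.
  rewrite -[LHS]mulmx1 -fr mulmxA mulmxDl -!mulmxA e1 -gx !mulmxA -!mulmxDl.
  by rewrite -uE ux mul0mx; apply/matrixP => x y; rewrite !mxE.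
rewrite unflattD !unflatt_mul flatKt e2 -gt !mulmxA -mulmxDl -uE ut.
by apply/matrixP => x y; rewrite !mxE.
Qed.

Lemma ext_lambda q Y : lambda_st Om q -> Y i *m bm Om q i = 0 ->
  row_free (amat (ext f r s q Y) i) -> lambda_st Om (ext f r s q Y).
Proof.
move=> /lambdaP[nil pre fr] Y0 free; apply/lambdaP; split.
- exact: ext_nilpotent.
- exact: ext_pre.
- move=> j; have [-> //|ji] := eqVneq j i.
  by apply/inj_atP/ext_inj_off => //; apply/inj_atP.
Qed.

Lemma ext_restriction q Y : eps i q = 0%N -> is_restriction i (ext f r s q Y) q.
Proof.
move=> e0; exists f; first exact: ext_morphism.
move=> j; have [e _ _ _ _] := sp j; split; first by apply/row_freeP; exists (r j).
case: eqP => [->|/eqP ji]; last first.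
  apply/eqmxP; rewrite submx1 /=; apply/submxP; exists (r j).
  by rewrite split_off.
set p := ext f r s q Y; apply/eqmxP/andP; split.
  have full : row_full (bm Om q i).
    by move: e0; rewrite (eps_bm Om) /row_full => /eqP;
      rewrite subn_eq0 eqn_leq rank_leq_col.
  have [L Lq] := row_fullP full.
  rewrite -[f i]mul1mx -Lq -mulmxA (submx_trans (submxMl _ _)) // bmat_mul bmat_span.
  apply/sumsmx_subP => b _; apply/sumsmx_subP => k _.
  rewrite (sumsmx_sup b) // (sumsmx_sup k) // !genmxE.
  by have [-> _] := ext_morphism q Y; exact: submxMl.
apply/sumsmx_subP => b _; apply/sumsmx_subP => k _; rewrite genmxE.
exact: submxMl.
Qed.

(** [Y] has to send the complement injectively into the kernel of [bm] modulo the image of [amat].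
    This quotient has dimension hdim - 2 v' i, and the last inequality says that it is at least the
    dimension v i - v' i of the complement. *)
Lemma ext_exists q : lambda_st Om q -> eps i q = 0%N -> (v' i <= v i)%N ->
  (v' i + v i <= hdim (d := d) (A := A) v' i)%N ->
  exists Y, lambda_st Om (ext f r s q Y) /\ is_restriction i (ext f r s q Y) q.
Proof.
move=> lq e0 le leH; have /lambdaP[_ pre free] := lq.
pose D := (kermx (bm Om q i) :\: amat q i)%MS.
have aK : (amat q i <= kermx (bm Om q i))%MS by apply/sub_kermxP.
have bq : \rank (bm Om q i) = v' i.
  by apply/eqP; move: e0; rewrite (eps_bm Om) => /eqP;
    rewrite subn_eq0 eqn_leq rank_leq_col.
have rD : \rank D = (hdim (d := d) (A := A) v' i - v' i - v' i)%N.
  have := mxrank_cap_compl (kermx (bm Om q i)) (amat q i); rewrite -/D.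
  rewrite mxrank_ker bq (capmx_idPr aK) (eqP (free i)) => <-.
  by rewrite addKn.
pose Yi : 'M_(kap i, _) := pid_mx (kap i) *m row_base D.
have kD : (kap i <= \rank D)%N by rewrite rD; lia.
have fY : \rank Yi = kap i.
  by rewrite mxrankMfree ?row_base_free // rank_pid_mx.
have YD : (Yi <= D)%MS by rewrite (submx_trans (submxMl _ _)) // eq_row_base.
pose Y := eqtype.dfwith (T := fun j => 'M[K]_(kap j, hdim v' j)) (fun=> 0) (i := i) Yi.
have YE : Y i = Yi by rewrite /Y eqtype.dfwith_in.
exists Y; split; last exact: ext_restriction.
apply: ext_lambda => //.
  rewrite YE; apply/sub_kermxP; apply: submx_trans YD _; exact: diffmxSl.
apply/inj_atP/ext_inj_at; rewrite YE /row_free -addsmxE.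
rewrite mxrank_disjoint_sum ?fY ?(eqP (free i)) //.
apply/eqP; rewrite -submx0; apply: submx_trans (capmxS (submx_refl _) YD) _.
by rewrite capmxC capmx_diff.
Qed.

(** All arrows into [i] land in the image of [f i], so composing them with the projection and the
    inclusion of V' loses nothing. *)
Lemma restriction_ext p q : is_morphism q p f ->
  (f i :=: incoming p i)%MS -> p = ext f r s q (coext r g p).
Proof.
move=> [e1 e2] fi.
have absorb a b (k : dart A a b) : rep_x p k *m r b *m f b = rep_x p k.
  have [bi|bi] := eqVneq b i; last by rewrite -mulmxA split_off // mulmx1.
  subst b; have /submxP[X ->] : (rep_x p k <= f i)%MS.
    by rewrite fi (sumsmx_sup a) // (sumsmx_sup k) // genmxE.
  by have [e _ _ _ _] := sp i; rewrite -!mulmxA (mulmxA (f i)) e mul1mx.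
apply: eq_rep => [a b k|a] /=; have [_ _ _ _ e] := sp a.
  rewrite flatKx mulmxDl -!mulmxA e1 (mulmxA (rep_x p k) (r b)) absorb.
  by rewrite !mulmxA -mulmxDl e mul1mx.
by rewrite flatKt e2 !mulmxA -mulmxDl e mul1mx.
Qed.

Lemma coext_ker p q : lambda_st Om p -> is_morphism q p f ->
  coext r g p i *m bm Om q i = 0.
Proof.
move=> /lambdaP[_ pre _] [e1 _]; have [fr _ _ _ _] := sp i.
have free : row_free (f i) by apply/row_freeP; exists (r i).
apply: (row_free_inj free); rewrite mul0mx -[RHS](mulmx0 _ (g i)) -(pre i).
rewrite mulmxA flat_mul !mul_bmat mulmx_suml; apply: eq_bigr => b _.
rewrite mulmx_suml; apply: eq_bigr => k _; rewrite !flatKx -scalemxAl -!mulmxA e1.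
by rewrite (mulmxA (r b)) split_off ?mul1mx // (dart_neq k).
Qed.

Lemma coext_ext q Y : coext r g (ext f r s q Y) = Y.
Proof.
apply: functional_extensionality_dep => a; apply: flat_inj => [b k|].
  by rewrite flatKx ext_gx -mulmxA; have [-> _ _ _ _] := sp b; rewrite mulmx1.
by rewrite flatKt ext_gt.
Qed.

End Extension.

(** * Coordinates *)

Section Coordinates.
Context {K : numFieldType} {n : nat} {A : sym_gcm n} (Om : orientation A).
Context {d : {ffun 'I_n -> nat}}.
Implicit Types v : {ffun 'I_n -> nat}.

Definition coords v : set (rep K A v d -> K) :=
  [set f | (exists i j (k : dart A i j) a b, f = fun p => rep_x p k a b) \/
           (exists i a b, f = fun p => rep_t p i a b)].

Lemma polyfunP v f : polyfun f <-> regular (@coords v) f.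
Proof.
split=> [|[N]].
  elim=> {f} [c|i j k a b|i a b|f g _ ? _ ?|f g _ ? _ ?].
  - exact: regular_cst.
  - by apply: regular_gen; left; exists i, j, k, a, b.
  - by apply: regular_gen; right; exists i, a, b.
  - exact: regularD.
  - exact: regularM.
elim=> {f N} [N c|N f [[i [j [k [a [b ->]]]]]|[i [a [b ->]]]]|N f g _ ? _ ?|N M f g _ ? _ ?].
- exact: polyfun_cst.
- exact: polyfun_x.
- exact: polyfun_t.
- exact: polyfun_add.
- exact: polyfun_mul.
Qed.

Section Ratn.
Context {T : Type} (X : set (T -> K)) (D : T -> K) (m : nat) (Dm : pol X m D).

Local Notation ratnx := (ratn_mx X D m).

Definition ratn_rep v (q : T -> rep K A v d) :=
  (forall i j (k : dart A i j), ratnx (fun p => rep_x (q p) k)) /\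
  (forall i, ratnx (fun p => rep_t (q p) i)).

Lemma ratn_flat v i a (W : T -> forall b, dart A i b -> 'M[K]_(a, v b)) Z :
  (forall b (k : dart A i b), ratnx (fun p => W p b k)) -> ratnx Z ->
  ratnx (fun p => flat (W p) (Z p : 'M[K]_(a, d i))).
Proof.
move=> HW HZ x y; case e: (enum_val y : hidx v i) => [[b [k z]]|z].
  by apply: (ratn_eq _ (HW b k x z)) => p _; rewrite mxE e.
by apply: (ratn_eq _ (HZ x z)) => p _; rewrite mxE e.
Qed.

Lemma ratn_unflatx v i a (Y : T -> 'M[K]_(a, hdim (d := d) v i)) b (k : dart A i b) :
  ratnx Y -> ratnx (fun p => unflatx (Y p) k).
Proof. by move=> HY x y; apply: (ratn_eq _ (HY x _)) => p _; rewrite mxE. Qed.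

Lemma ratn_unflatt v i a (Y : T -> 'M[K]_(a, hdim (A := A) (d := d) v i)) :
  ratnx Y -> ratnx (fun p => unflatt (Y p)).
Proof. by move=> HY x y; apply: (ratn_eq _ (HY x _)) => p _; rewrite mxE. Qed.

Lemma ratn_bmat v i a (W : T -> forall b, dart A b i -> 'M[K]_(v b, a)) :
  (forall b (k : dart A b i), ratnx (fun p => W p b k)) ->
  ratnx (fun p => bmat Om (W p) : 'M_(hdim (d := d) v i, a)).
Proof.
move=> HW x y; case e: (enum_val x : hidx v i) => [[b [k z]]|z].
  apply: (ratn_eq (h := fun p => dart_sign Om (dart_rev k) * W p b (dart_rev k) z y)).
    by move=> p _; rewrite mxE e.
  by apply: ratn_mul => //; [apply: ratn_regular => //; exact: regular_cst|exact: HW].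
apply: (ratn_eq (h := fun=> 0)); first by move=> p _; rewrite mxE e.
by apply: ratn_regular => //; exact: regular_cst.
Qed.

Lemma ratn_amat v (q : T -> rep K A v d) i : ratn_rep q -> ratnx (fun p => amat (q p) i).
Proof. by move=> [qx qt]; apply: ratn_flat => // b k; exact: qx. Qed.

Lemma ratn_bm v (q : T -> rep K A v d) i : ratn_rep q -> ratnx (fun p => bm Om (q p) i).
Proof. by move=> [qx qt]; apply: ratn_bmat => b k; exact: qx. Qed.

Lemma ratn_ext v v' (f : T -> forall j, 'M[K]_(v' j, v j))
    (r : T -> forall j, 'M[K]_(v j, v' j)) (s : T -> forall j, 'M[K]_(v j, v j - v' j))
    (q : T -> rep K A v' d) (Y : T -> forall j, 'M[K]_(v j - v' j, @hdim n A d v' j)) :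
  (forall j, ratnx (fun p => f p j)) -> (forall j, ratnx (fun p => r p j)) ->
  (forall j, ratnx (fun p => s p j)) -> ratn_rep q -> (forall j, ratnx (fun p => Y p j)) ->
  ratn_rep (fun p => ext (f p) (r p) (s p) (q p) (Y p)).
Proof.
move=> Hf Hr Hs [qx qt] HY; split=> [i j k|i] /=.
  apply: ratn_mulmx => //; apply: ratn_addmx => //; apply: ratn_mulmx => //.
  exact: ratn_unflatx.
by apply: ratn_addmx => //; apply: ratn_mulmx => //; exact: ratn_unflatt.
Qed.

Lemma ratn_rep_comp v (q : T -> rep K A v d) f :
  ratn_rep q -> regular (@coords v) f -> ratn X D m (f \o q).
Proof.
move=> [qx qt]; apply: (ratn_comp Dm) => _ [[i [j [k [a [b ->]]]]]|[i [a [b ->]]]].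
  exact: qx.
exact: qt.
Qed.

Lemma ratn_rep_unif v (q : T -> rep K A v d) : ratn_rep q ->
  exists e, forall f, coords f -> rat X D m e (f \o q).
Proof.
move=> [qx qt].
have mono e e' h : (e <= e')%N -> rat X D m e h -> rat X D m e' h by exact: rat_le.
have [e1 H1] : exists e, forall i j (k : dart A i j) a b,
    rat X D m e (fun p => rep_x (q p) k a b).
  do 5![apply: fin_unif; [by move=> ? ? ? le H *; apply: mono le _; exact: H|move=> ?]].
  exact: qx.
have [e2 H2] : exists e, forall i a b, rat X D m e (fun p => rep_t (q p) i a b).
  do 3![apply: fin_unif; [by move=> ? ? ? le H *; apply: mono le _; exact: H|move=> ?]].
  exact: qt.
exists (maxn e1 e2) => _ [[i [j [k [a [b ->]]]]]|[i [a [b ->]]]].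
  by apply: mono (H1 i j k a b); exact: leq_maxl.
by apply: mono (H2 i a b); exact: leq_maxr.
Qed.

End Ratn.

Lemma ratn_rep_id v D m : pol (@coords v) m D -> ratn_rep (@coords v) D m id.
Proof.
move=> Dm; split=> [i j k|i] a b; apply: ratn_regular => //; apply: regular_gen.
  by left; exists i, j, k, a, b.
by right; exists i, a, b.
Qed.

Lemma regular_rep_mx v a b (M : rep K A v d -> 'M[K]_(a, b)) :
  (ratn_rep (@coords v) (fun=> 1) 0 id -> ratn_mx (@coords v) (fun=> 1) 0 M) ->
  regular_mx (@coords v) M.
Proof.
move=> H i j; apply: ratn1; apply: H; apply: ratn_rep_id; exact: pol_cst.
Qed.

Lemma regular_amat v i : regular_mx (@coords v) (fun p => amat p i).
Proof. by apply: regular_rep_mx => H; exact: ratn_amat. Qed.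

Lemma regular_bm v i : regular_mx (@coords v) (fun p => bm Om p i).
Proof. by apply: regular_rep_mx => H; apply: ratn_bm => //; exact: pol_cst. Qed.

(** The common form of the fibre arguments: [gam] is a rational curve through two points, defined
    where [D0] does not vanish. *)
Lemma line_meet v (gam : K -> rep K A v d) D0 m f g :
  pol [set (@id K)] m D0 -> ratn_rep [set (@id K)] D0 m gam ->
  regular (@coords v) f -> regular (@coords v) g ->
  D0 0 != 0 -> f (gam 0) != 0 -> D0 1 != 0 -> g (gam 1) != 0 ->
  exists x, [/\ D0 x != 0, f (gam x) != 0 & g (gam x) != 0].
Proof.
move=> Dm rg Hf Hg d0 f0 d1 g1.
have [F HF FE] := ratn_neq0 Dm (ratn_rep_comp Dm rg Hf).
have [G HG GE] := ratn_neq0 Dm (ratn_rep_comp Dm rg Hg).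
have [||x [_ Fx Gx]] := irr_meet irr_line HF HG (I : setT (0 : K)) _ (I : setT (1 : K)) _.
- by rewrite FE d0.
- by rewrite GE d1.
move: Fx Gx; rewrite FE GE => /andP[dx fx] /andP[_ gx].
by exists x.
Qed.

Definition line a b (M N : 'M[K]_(a, b)) (x : K) := M + x *: (N - M).

Lemma line0 a b (M N : 'M[K]_(a, b)) : line M N 0 = M.
Proof. by rewrite /line scale0r addr0. Qed.

Lemma line1 a b (M N : 'M[K]_(a, b)) : line M N 1 = N.
Proof. by rewrite /line scale1r addrC subrK. Qed.

Lemma regular_line a b (M N : 'M[K]_(a, b)) : regular_mx [set (@id K)] (line M N).
Proof.
move=> i j; apply: (regular_eq (f := fun x => M i j + x * (N - M) i j)).
  by move=> x; rewrite !mxE.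
apply: regularD; first exact: regular_cst.
by apply: regularM; [exact: regular_gen|exact: regular_cst].
Qed.

(* The common denominator is the product of the determinants. *)
Lemma ratn_inv_family T (X : set (T -> K)) (w : 'I_n -> nat) (G : T -> forall j, 'M[K]_(w j)) m :
  (forall j, regular_mx X (fun x => G x j)) ->
  pol X m (fun x => \prod_j \det (G x j)) ->
  forall j, ratn_mx X (fun x => \prod_j \det (G x j)) m (fun x => invmx (G x j)).
Proof.
move=> HG Dm j; apply: (ratn_invmx Dm (HG j) (E := fun x => \prod_(l | l != j) \det (G x l))).
  by apply: regular_prod => l; exact: regular_det.
by move=> p; rewrite (bigD1 j).
Qed.

(** Orbits are irreducible because the line through two invertible matrices consists of invertible
    matrices outside the zeros of a nonzero polynomial. *)
Lemma orbit_meet v (q : rep K A v d) (g1 g2 : forall j, 'M[K]_(v j)) f f' :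
  regular (@coords v) f -> regular (@coords v) f' ->
  (forall j, g1 j \in unitmx) -> (forall j, g2 j \in unitmx) ->
  f (gv_act g1 q) != 0 -> f' (gv_act g2 q) != 0 ->
  exists g : forall j, 'M[K]_(v j), [/\ forall j, g j \in unitmx,
    f (gv_act g q) != 0 & f' (gv_act g q) != 0].
Proof.
move=> Hf Hf' u1 u2 f1 f2; pose G x j := line (g1 j) (g2 j) x.
have HG j : regular_mx [set (@id K)] (fun x => G x j) by exact: regular_line.
have [m Dm] : regular [set (@id K)] (fun x => \prod_j \det (G x j)).
  by apply: regular_prod => j; exact: regular_det.
have G0 : G 0 = g1 by apply: functional_extensionality_dep => j; exact: line0.
have G1 : G 1 = g2 by apply: functional_extensionality_dep => j; exact: line1.
have D0 (g : forall j, 'M[K]_(v j)) : (\prod_j \det (g j) != 0) <-> forall j, g j \in unitmx.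
  split=> [/prodf_neq0 H j|H]; first by rewrite unitmxE unitfE H.
  by apply/prodf_neq0 => j _; have := H j; rewrite unitmxE unitfE.
have [|||||x [dx fx gx]] := line_meet (gam := fun x => gv_act (G x) q) Dm _ Hf Hf'.
- have cst a b (M : 'M[K]_(a, b)) : ratn_mx [set (@id K)] (fun x => \prod_j \det (G x j)) m (fun=> M).
    exact: ratn_mx_cst.
  split=> [i j k|i] /=; repeat apply: ratn_mulmx => //.
  + exact: ratn_inv_family.
  + exact: ratn_mx_regular.
  + exact: ratn_inv_family.
- by rewrite G0; apply/D0.
- by rewrite G0.
- by rewrite G1; apply/D0.
- by rewrite G1.
by exists (G x); split => //; apply/D0.
Qed.

End Coordinates.

(** * Charts around a restriction *)

Lemma mx_dim0 (K : fieldType) a b (M N : 'M[K]_(a, b)) : a = 0%N -> M = N.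
Proof. by move=> e; subst a; rewrite [M]flatmx0 [N]flatmx0. Qed.

Lemma mx_dim0r (K : fieldType) a b (M N : 'M[K]_(a, b)) : b = 0%N -> M = N.
Proof. by move=> e; subst b; rewrite [M]thinmx0 [N]thinmx0. Qed.

Section Chart.
Context {K : numFieldType} {n : nat} {A : sym_gcm n} (Om : orientation A).
Context {d : {ffun 'I_n -> nat}} (v' v : {ffun 'I_n -> nat}).
Local Notation kap j := (v j - v' j)%N.
Local Notation hd := (@hdim n A d v').
Context (f : forall j, 'M[K]_(v' j, v j)) (r : forall j, 'M[K]_(v j, v' j))
  (g : forall j, 'M[K]_(kap j, v j)) (s : forall j, 'M[K]_(v j, kap j)).
Hypothesis sp : forall j, splitting (f j) (r j) (g j) (s j).
Context (i : 'I_n) (offi : forall j, j != i -> v' j = v j).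
Context (c : forall j, 'M[K]_(v' j, hd j)).
Implicit Types (p : rep K A v d) (q : rep K A v' d).

(* The splitting for which V' is embedded as the graph of [Z] *)
Definition fZ (Z : forall j, 'M[K]_(v' j, kap j)) j := f j + Z j *m g j.
Definition sZ (Z : forall j, 'M[K]_(v' j, kap j)) j := s j - r j *m Z j.

Lemma splittingZ Z j : splitting (fZ Z j) (r j) (g j) (sZ Z j).
Proof.
have [e1 e2 e3 e4 e5] := sp j; split=> //; rewrite /fZ /sZ.
- by rewrite mulmxDl e1 -mulmxA e3 mulmx0 addr0.
- rewrite mulmxDl !mulmxBr e2 !mulmxA e1 mul1mx -(mulmxA _ (g j) (s j)) e4 mulmx1.
  by rewrite -(mulmxA _ (g j)) e3 mulmx0 mul0mx subr0 add0r addNr.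
- by rewrite mulmxBr e4 mulmxA e3 mul0mx subr0.
- by rewrite mulmxDr mulmxBl mulmxA addrACA subrr addr0 e5.
Qed.

Lemma fZ_off Z j : j != i -> fZ Z j = f j.
Proof. by move=> ji; rewrite /fZ mulmx_dim0 ?addr0 // (kap0 offi). Qed.

Definition bp p j : 'M[K]_(hd j, v j) := bmat Om (fun b (k : dart A b j) => f b *m rep_x p k).
(** At [i], [c] selects v' i combinations of the incoming vectors, and [Bp] is their component in
    V'. Where it is invertible they span the graph of [Zp], so [Zp] is the only possible parameter
    of an embedding of the restriction. *)
Definition Bp p j : 'M[K]_(v' j) := c j *m bp p j *m r j.
Definition Zp p j : 'M[K]_(v' j, kap j) := invmx (Bp p j) *m c j *m bp p j *m s j.

Definition res p (Z : forall j, 'M[K]_(v' j, kap j)) : rep K A v' d :=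
  Rep (fun a b k => fZ Z a *m rep_x p k *m r b) (fun a => fZ Z a *m rep_t p a).

Lemma bp_incoming p : (bp p i :=: incoming p i)%MS.
Proof.
have E b (k : dart A b i) : (<<f b *m rep_x p k>> :=: <<rep_x p k>>)%MS.
  have bi : b != i by exact: dart_neq k.
  apply: eqmx_trans (genmxE _) (eqmx_trans _ (eqmx_sym (genmxE _))).
  apply: eqmxMfull; apply/row_fullP; exists (r b).
  by rewrite (split_off sp offi).
apply: eqmx_trans (bmat_span _ _) _.
by apply/eqmxP; apply/andP; split; apply/sumsmx_subP => b _; apply/sumsmx_subP => k _;
  rewrite (sumsmx_sup b) // (sumsmx_sup k) // E.
Qed.

Lemma res_morphism p q Z : is_morphism q p (fZ Z) -> res p Z = q.
Proof.
move=> [e1 e2]; apply: eq_rep => [a b k|a] /=; last by rewrite e2.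
by rewrite -e1 -mulmxA; have [-> _ _ _ _] := splittingZ Z b; rewrite mulmx1.
Qed.

Lemma chart_bp p q Z : is_morphism q p (fZ Z) -> bp p i = bm Om q i *m fZ Z i.
Proof.
move=> [e1 _]; rewrite bmat_mul; congr bmat.
apply: functional_extensionality_dep => b; apply: functional_extensionality_dep => k.
by rewrite e1 fZ_off // (dart_neq k).
Qed.

Lemma chart_Bp p q Z : is_morphism q p (fZ Z) -> Bp p i = c i *m bm Om q i.
Proof.
move=> /chart_bp e; rewrite /Bp e -!mulmxA.
by have [-> _ _ _ _] := splittingZ Z i; rewrite mulmx1.
Qed.

Lemma chart_Zp p q Z : is_morphism q p (fZ Z) -> Bp p i \in unitmx -> Zp p = Z.
Proof.
move=> m u; apply: functional_extensionality_dep => j.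
have [->|ji] := eqVneq j i; last by apply: mx_dim0r; rewrite (kap0 offi).
rewrite /Zp (chart_bp m) -!mulmxA (mulmxA (c i)) -(chart_Bp m).
have [_ e2 _ e4 _] := sp i.
by rewrite mulKmx // /fZ mulmxDl e2 add0r -mulmxA e4 mulmx1.
Qed.

(** The graph of [Zp p] is spanned by incoming vectors, and the bound on the rank leaves no room for
    more. *)
Lemma chart_restriction p : Bp p i \in unitmx -> (\rank (bm Om p i) <= v' i)%N ->
  is_morphism (res p (Zp p)) p (fZ (Zp p)) /\ (fZ (Zp p) i :=: incoming p i)%MS.
Proof.
move=> u rk.
have cb : c i *m bp p i = Bp p i *m fZ (Zp p) i.
  have [_ _ _ _ e] := sp i.
  rewrite -[LHS]mulmx1 -e mulmxDr !mulmxA -/(Bp p i) /fZ mulmxDr; congr (_ + _).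
  by rewrite mulmxA /Zp !mulmxA mulmxV // mul1mx.
have sub : (fZ (Zp p) i <= bp p i)%MS.
  by rewrite -[fZ _ _](mulKmx u) -cb mulmxA submxMl.
have frf : row_free (fZ (Zp p) i).
  by apply/row_freeP; exists (r i); have [] := splittingZ (Zp p) i.
have eqm : (fZ (Zp p) i :=: incoming p i)%MS.
  suff e : (fZ (Zp p) i :=: bp p i)%MS by exact: (eqmx_trans e (bp_incoming p)).
  apply/eqmxP; rewrite sub /=.
  by rewrite -(geq_leqif (mxrank_leqif_sup sub)) (eqP frf) bp_incoming -(bm_incoming Om).
split=> //; split=> [a b k|//] /=.
have [bi|bi] := eqVneq b i; last first.
  by rewrite -!mulmxA (fZ_off _ bi) (split_off sp offi) // mulmx1.
subst b; have /submxP[X ->] : (rep_x p k <= fZ (Zp p) i)%MS.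
  by rewrite eqm (sumsmx_sup a) // (sumsmx_sup k) // genmxE.
have [e _ _ _ _] := splittingZ (Zp p) i.
by rewrite -!mulmxA (mulmxA (fZ (Zp p) i)) e mul1mx.
Qed.

Lemma chart_is_restriction p : Bp p i \in unitmx -> (\rank (bm Om p i) <= v' i)%N ->
  is_restriction i p (res p (Zp p)).
Proof.
move=> u /(chart_restriction u)[m e]; exists (fZ (Zp p)) => // j.
split; first by apply/row_freeP; exists (r j); have [] := splittingZ (Zp p) j.
case: eqP => [->//|/eqP ji]; rewrite fZ_off //; apply/eqmxP; rewrite submx1 /=.
by apply/submxP; exists (r j); rewrite (split_off sp offi).
Qed.

Definition chart_den p := \det (Bp p i).

Section Regular.
Context {T : Type} (X : set (T -> K)) (D : T -> K) (m : nat) (Dm : pol X m D).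
Context (p : T -> rep K A v d) (rp : ratn_rep X D m p).

Lemma ratn_bp j : ratn_mx X D m (fun x => bp (p x) j).
Proof.
apply: ratn_bmat => // b k; apply: ratn_mulmx => //; first exact: ratn_mx_cst.
exact: rp.1.
Qed.

Lemma ratn_Bp j : ratn_mx X D m (fun x => Bp (p x) j).
Proof.
apply: ratn_mulmx => //; last exact: ratn_mx_cst.
by apply: ratn_mulmx => //; [exact: ratn_mx_cst|exact: ratn_bp].
Qed.

End Regular.

Lemma regular_Bp j : regular_mx (@coords K n A d v) (fun p => Bp p j).
Proof. by apply: regular_rep_mx => H; apply: ratn_Bp => //; exact: pol_cst. Qed.

Lemma regular_chart_den : regular (@coords K n A d v) chart_den.
Proof. exact/regular_det/regular_Bp. Qed.

Section Fractions.
Context m (Dm : pol (@coords K n A d v) m chart_den).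
Local Notation ratnx := (ratn_mx (@coords K n A d v) chart_den m).

Lemma ratn_Zp j : ratnx (fun p => Zp p j).
Proof.
have id := ratn_rep_id Dm.
have [->|ji] := eqVneq j i; last first.
  by move=> a b; have := ltn_ord b; rewrite [X in (_ < X)%N](kap0 offi).
apply: ratn_mulmx => //; last exact: ratn_mx_cst.
apply: ratn_mulmx => //; last exact: ratn_bp.
apply: ratn_mulmx => //; last exact: ratn_mx_cst.
apply: (@ratn_invmx _ _ _ _ _ Dm _ (fun p => Bp p i) (fun=> 1)).
- exact: regular_Bp.
- exact: regular_cst.
- by move=> p; rewrite mulr1.
Qed.

Lemma ratn_fZ j : ratnx (fun p => fZ (Zp p) j).
Proof.
apply: ratn_addmx => //; first exact: ratn_mx_cst.
by apply: ratn_mulmx => //; [exact: ratn_Zp|exact: ratn_mx_cst].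
Qed.

Lemma ratn_res : ratn_rep (@coords K n A d v) chart_den m (fun p => res p (Zp p)).
Proof.
have [ix it] := ratn_rep_id Dm.
split=> [a b k|a] /=; last by apply: ratn_mulmx => //; exact: ratn_fZ.
apply: ratn_mulmx => //; last exact: ratn_mx_cst.
by apply: ratn_mulmx => //; exact: ratn_fZ.
Qed.

End Fractions.

(* [W] is projected to the kernel of [bm q] along the image of [c]. *)
Definition kproj q (W : forall j, 'M[K]_(kap j, hd j)) j :=
  W j - W j *m bm Om q j *m invmx (c j *m bm Om q j) *m c j.

Lemma kproj_ker q W : c i *m bm Om q i \in unitmx -> kproj q W i *m bm Om q i = 0.
Proof.
move=> u; rewrite /kproj mulmxBl -!mulmxA.
by rewrite mulVmx // mulmx1 subrr.
Qed.

Lemma kproj_id q W : W i *m bm Om q i = 0 -> kproj q W = W.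
Proof.
move=> e; apply: functional_extensionality_dep => j.
have [->|ji] := eqVneq j i; last by apply: mx_dim0; rewrite (kap0 offi).
by rewrite /kproj e !mul0mx subr0.
Qed.

Definition den' q := \det (c i *m bm Om q i).

Lemma regular_den' : regular (@coords K n A d v') den'.
Proof.
apply: regular_det; apply: regular_mulmx; first exact: regular_mx_cst.
exact: regular_bm.
Qed.

Lemma ratn_kproj T (X : set (T -> K)) (q : T -> rep K A v' d) W m :
  pol X m (den' \o q) -> ratn_rep X (den' \o q) m q ->
  regular_mx X (fun x => c i *m bm Om (q x) i) ->
  (forall j, ratn_mx X (den' \o q) m (fun x => W x j)) ->
  forall j, ratn_mx X (den' \o q) m (fun x => kproj (q x) (W x) j).
Proof.
move=> Dm rq rc rW j; have [->|ji] := eqVneq j i; last first.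
  by move=> a b; have := ltn_ord a; rewrite [X in (_ < X)%N](kap0 offi).
apply: ratn_addmx => //; apply: ratn_oppmx => //.
apply: ratn_mulmx => //; last exact: ratn_mx_cst.
apply: ratn_mulmx => //; first by apply: ratn_mulmx => //; exact: ratn_bm.
apply: (@ratn_invmx _ _ _ _ _ Dm _ (fun x => c i *m bm Om (q x) i) (fun=> 1)) => //.
- exact: regular_cst.
- by move=> p; rewrite mulr1.
Qed.

End Chart.

(** * Irreducibility and dimension of families of extensions *)

Section Families.
Context {K : numFieldType} {n : nat} {A : sym_gcm n} (Om : orientation A).
Context {d : {ffun 'I_n -> nat}} (i : 'I_n).
Implicit Types v : {ffun 'I_n -> nat}.
Local Notation coord v := (@coords K n A d v).
Local Notation Lam v := (@lambda_st K n A Om v d).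

Definition Red v (P : set (rep K A v d)) v' : set (rep K A v' d) :=
  [set q | exists2 p, P p & is_restriction i p q].

Definition Ext v' (Q : set (rep K A v' d)) v : set (rep K A v d) :=
  [set p | lambda_st Om p /\ exists2 q, Q q & is_restriction i p q].

Arguments Red {v} P v' _ : rename.
Arguments Ext {v'} Q v _ : rename.

(** A minor of maximal size, in the form of the determinant of L M R with L M(p0) R = 1, is nonzero
    on an open set. *)
Lemma rank_open T (X : set (T -> K)) a b (M : T -> 'M[K]_(a, b)) p0 : regular_mx X M ->
  exists F, [/\ regular X F, F p0 != 0 & forall p, F p != 0 ->
    (\rank (M p0) <= \rank (M p))%N].
Proof.
move=> HM; have /row_fullP[L HL] := col_base_full (M p0).
have /row_freeP[R HR] := row_base_free (M p0).
exists (fun p => \det (L *m M p *m R)); split.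
- apply: regular_det; apply: regular_mulmx; last exact: regular_mx_cst.
  by apply: regular_mulmx => //; exact: regular_mx_cst.
- suff E N : N = M p0 -> L *m N *m R = 1%:M by rewrite E // det1 oner_eq0.
  move=> ->; have -> : L *m M p0 = row_base (M p0) by
    apply: etrans (congr1 (mulmx L) (esym (mulmx_base (M p0)))) _; rewrite mulmxA HL mul1mx.
  exact: HR.
- move=> p Fp; have u : L *m M p *m R \in unitmx by rewrite unitmxE unitfE.
  rewrite -{1}(mxrank_unit u); apply: leq_trans (mxrankM_maxl _ _) _.
  exact: mxrankM_maxr.
Qed.

Lemma eps_open v (p0 : rep K A v d) j : exists F,
  [/\ regular (coord v) F, F p0 != 0 & forall p, F p != 0 -> (eps j p <= eps j p0)%N].
Proof.
have [F [HF F0 FE]] := rank_open p0 (@regular_bm _ _ _ Om d v j).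
exists F; split => // p /FE le; rewrite !(eps_bm Om); lia.
Qed.

Lemma splitting_family v v' (f : forall j, 'M[K]_(v' j, v j)) :
  (forall j, row_free (f j)) -> exists r (g : forall j, 'M[K]_(v j - v' j, v j)) s,
  forall j, splitting (f j) (r j) (g j) (s j).
Proof.
move=> ff; pose H j := cid (splitting_exists (ff j)).
pose H2 j := cid (projT2 (H j)); pose H3 j := cid (projT2 (H2 j)).
by exists (fun j => projT1 (H j)), (fun j => projT1 (H2 j)), (fun j => projT1 (H3 j)) => j;
  exact: projT2 (H3 j).
Qed.

Lemma bm_section v (q : rep K A v d) : eps i q = 0%N ->
  exists c : forall j, 'M[K]_(v j, hdim v j), c i *m bm Om q i = 1%:M.
Proof.
rewrite (eps_bm Om) => /eqP; rewrite subn_eq0 => le.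
have /row_fullP[L HL] : row_full (bm Om q i) by rewrite /row_full eqn_leq rank_leq_col.
exists (eqtype.dfwith (T := fun j => 'M[K]_(v j, hdim v j)) (fun=> 0) (i := i) L).
by rewrite eqtype.dfwith_in.
Qed.

Lemma restriction_chart v v' (p : rep K A v d) (q : rep K A v' d) : is_restriction i p q ->
  exists f (r : forall j, 'M_(v j, v' j)) (g : forall j, 'M_(v j - v' j, v j)) s
     (c : forall j, 'M[K]_(v' j, hdim v' j)),
  [/\ forall j, splitting (f j) (r j) (g j) (s j), is_morphism q p f,
      (f i :=: incoming p i)%MS & c i *m bm Om q i = 1%:M].
Proof.
move=> R; have [f m Hf] := R.
have [r [g [s sp]]] := splitting_family (fun j => (Hf j).1).
have [c ce] := bm_section (restriction_eps0 Om R).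
exists f, r, g, s, c; split=> //.
by have [_] := Hf i; rewrite eqxx.
Qed.

Lemma is_morphism_fZ v v' (q : rep K A v' d) (p : rep K A v d) f
  (g : forall j, 'M_(v j - v' j, v j)) :
  is_morphism q p f -> is_morphism q p (fZ f g (fun=> 0)).
Proof.
have -> : fZ f g (fun=> 0) = f; last by [].
by apply: functional_extensionality_dep => j; rewrite /fZ mul0mx addr0.
Qed.

Lemma restriction_unique v v' (p : rep K A v d) (q1 q2 : rep K A v' d) :
  is_restriction i p q1 -> is_restriction i p q2 ->
  exists2 h : forall j, 'M[K]_(v' j), (forall j, h j \in unitmx) & q2 = gv_act h q1.
Proof.
move=> [f1 [x1 t1] H1] [f2 [x2 t2] H2].
have e j : (f1 j :=: f2 j)%MS.
  exact: (eqmx_trans (H1 j).2 (eqmx_sym (H2 j).2)).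
have exh j : exists h : 'M[K]_(v' j), h \in unitmx /\ f1 j = h *m f2 j.
  have /submxP[h hE] : (f1 j <= f2 j)%MS by rewrite e.
  exists h; split=> //; rewrite -row_free_unit /row_free.
  by rewrite -(mxrankMfree h (H2 j).1) -hE; exact: (H1 j).1.
pose h j := projT1 (cid (exh j)).
have hu j : h j \in unitmx := (projT2 (cid (exh j))).1.
have hE j : f1 j = h j *m f2 j := (projT2 (cid (exh j))).2.
exists h => //; apply: eq_rep => [a b k|a] /=; last first.
  by rewrite t1 hE -mulmxA mulKmx // t2.
apply: (row_free_inj (H2 b).1); rewrite x2 -!mulmxA -hE x1 hE -mulmxA mulKmx //.
Qed.

Lemma restriction_orbit v v' (p : rep K A v d) (q : rep K A v' d)
    (h : forall j, 'M[K]_(v' j)) : (forall j, h j \in unitmx) ->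
  is_restriction i p q -> is_restriction i p (gv_act h q).
Proof.
move=> hu [f [x1 t1] H]; exists (fun j => invmx (h j) *m f j).
  split=> [a b k|a] /=; last by rewrite t1 mulmxA.
  by rewrite -!mulmxA (mulmxA (h b)) mulmxV // mul1mx x1.
move=> j; have [fr e] := H j; split.
  by rewrite /row_free mxrankMfree // mxrank_unit // unitmx_inv.
apply: (eqmx_trans _ e); apply: eqmxMfull.
by rewrite row_full_unit unitmx_inv.
Qed.

Lemma eps_rank_le v v' (p : rep K A v d) : (v i - v' i <= eps i p)%N -> (v' i <= v i)%N ->
  (\rank (bm Om p i) <= v' i)%N.
Proof. by rewrite (eps_bm Om); have := rank_leq_col (bm Om p i); lia. Qed.

(** In a chart around one point the restriction is a rational function of [p], and the lower bound
    on [eps] makes the chart compute a true restriction wherever its denominator is nonzero. The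
    restrictions of a single [p] form an orbit. *)
Lemma red_irr v v' (P : set (rep K A v d)) : irr (coord v) P ->
  (forall p, P p -> (v i - v' i <= eps i p)%N) ->
  Red P v' !=set0 -> irr (coord v') (Red P v').
Proof.
move=> iP epsP Q0.
apply: (irr_transfer (G := fun p q => is_restriction i p q) iP Q0).
- move=> q F [p Pp R] HF Fq.
  have [offi _] := restriction_dims Om R; have vi := restriction_le Om R i.
  have [f [r [g [s [c [sp m fi ce]]]]]] := restriction_chart R.
  have [N Dm] := regular_chart_den Om f r i c.
  have [F' HF' F'E] := ratn_neq0 Dm (ratn_rep_comp Dm (ratn_res g s offi Dm) HF).
  have m0 := is_morphism_fZ g m.
  have Bp1 : Bp Om f r c p i = 1%:M by rewrite (chart_Bp Om sp offi c m0).
  exists F'; split=> //.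
    exists p => //; rewrite F'E /chart_den Bp1 det1 oner_eq0 /=.
    by rewrite (chart_Zp sp offi m0) ?Bp1 ?unitmx1 // (res_morphism sp m0).
  move=> p' Pp'; rewrite F'E => /andP[Dp' Fp'].
  have R' : is_restriction i p' (res f r g p' (Zp Om f r s c p')).
    apply: chart_is_restriction => //; first by rewrite unitmxE unitfE.
    by apply: eps_rank_le => //; exact: epsP.
  by eexists; split; [exists p'; [exact: Pp'|exact: R']|exact: R'|exact: Fp'].
- move=> p F F' q1 q2 Pp HF HF' _ R1 f1 _ R2 f2.
  have [h hu qE] := restriction_unique R1 R2.
  have g1 : gv_act (fun j => 1%:M) q1 = q1.
    by apply: eq_rep => *; rewrite /= invmx1 mul1mx ?mulmx1.
  have [|||g [gu fg f'g]] := orbit_meet (q := q1) (g1 := fun=> 1%:M) (g2 := h) HF HF' _ hu.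
  + by move=> j; exact: unitmx1.
  + by rewrite g1.
  + by rewrite -qE.
  exists (gv_act g q1); split=> //; exists p => //.
  exact: restriction_orbit.
Qed.

(** An extension of [q] spreads out to the points near [q]: its map [Y] is projected into the moving
    kernel of [bm]. Inside one fibre, two extensions differ by a change of splitting and of [Y]; the
    splittings are joined by a line of matrices, the maps [Y] by a line in the fixed kernel. *)
Lemma ext_irr v v' (Q : set (rep K A v' d)) : irr (coord v') Q ->
  Q `<=` Lam v' -> Ext Q v !=set0 -> irr (coord v) (Ext Q v).
Proof.
move=> iQ lQ P0.
apply: (irr_transfer (G := fun q p => is_restriction i p q) iQ P0).
- move=> p F [lp [q Qq R]] HF Fp.
  have [offi _] := restriction_dims Om R; have vi := restriction_le Om R i.
  have [f [r [g [s [c [sp m fi ce]]]]]] := restriction_chart R.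
  have [N Dm] := regular_den' Om i c.
  pose E q' := ext f r s q' (kproj Om c q' (coext r g p)).
  have rid := ratn_rep_id Dm.
  have rE : ratn_rep (coord v') (den' Om i c) N E.
    apply: ratn_ext => //; try by move=> j; exact: ratn_mx_cst.
    apply: (ratn_kproj (q := id) offi Dm) => //.
      apply: regular_mulmx; first exact: regular_mx_cst.
      exact: regular_bm.
    by move=> j; exact: ratn_mx_cst.
  have /lambdaP[_ _ /(_ i)/row_freeP[R0 R0E]] := lp.
  (* The second factor keeps [amat] injective, the open condition that makes the nearby extensions
     stable. *)
  pose F2 p' := F p' * \det (amat p' i *m R0).
  have HF2 : regular (coord v) F2.
    apply: regularM => //; apply: regular_det; apply: regular_mulmx.
      exact: regular_amat.
    exact: regular_mx_cst.
  have [F' HF' F'E] := ratn_neq0 Dm (ratn_rep_comp Dm rE HF2).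
  have Ep : E q = p.
    rewrite /E (kproj_id offi); first by rewrite -(restriction_ext sp offi m fi).
    exact: (coext_ker sp offi lp m).
  exists F'; split=> //.
    exists q => //; rewrite F'E /den' ce det1 oner_eq0 /= Ep /F2 R0E det1 mulr1 //.
  move=> q' Qq'; rewrite F'E => /andP[Dq' /=].
  rewrite /F2 mulf_eq0 negb_or => /andP[FE dE].
  have e0 : eps i q' = 0%N.
    rewrite (eps_bm Om); apply/eqP; rewrite subn_eq0.
    have u : c i *m bm Om q' i \in unitmx by rewrite unitmxE unitfE.
    by rewrite -{1}(mxrank_unit u) mxrankM_maxr.
  have R' : is_restriction i (E q') q' by exact: ext_restriction.
  exists (E q'); split=> //; split; last by exists q'.
  apply: (ext_lambda sp offi); first exact: lQ.
    by apply: kproj_ker; rewrite unitmxE unitfE.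
  apply/row_freeP; exists (R0 *m invmx (amat (E q') i *m R0)).
  by rewrite mulmxA mulmxV // unitmxE unitfE.
- move=> q F F' p1 p2 Qq HF HF' [l1 _] R1 F1 [l2 _] R2 F2.
  have [offi _] := restriction_dims Om R1.
  have e0 := restriction_eps0 Om R1.
  have [f1 [r1 [g1 [s1 [_ [sp1 m1 fi1 _]]]]]] := restriction_chart R1.
  have [f2 [r2 [g2 [s2 [_ [sp2 m2 fi2 _]]]]]] := restriction_chart R2.
  (* The change of basis carrying the first splitting to the second. *)
  pose G j := r1 j *m f2 j + s1 j *m g2 j.
  have f1G j : f1 j *m G j = f2 j.
    have [e1 e2 _ _ _] := sp1 j.
    by rewrite mulmxDr !mulmxA e1 e2 mul1mx mul0mx addr0.
  have g1G j : g1 j *m G j = g2 j.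
    have [_ _ e1 e2 _] := sp1 j.
    by rewrite mulmxDr !mulmxA e1 e2 mul1mx mul0mx add0r.
  have Gr2 j : G j *m r2 j = r1 j.
    have [e1 _ e2 _ _] := sp2 j.
    by rewrite mulmxDl -!mulmxA e1 e2 mulmx1 mulmx0 addr0.
  have Gs2 j : G j *m s2 j = s1 j.
    have [_ e1 _ e2 _] := sp2 j.
    by rewrite mulmxDl -!mulmxA e1 e2 mulmx1 mulmx0 add0r.
  have Gu j : G j \in unitmx.
    have : G j *m (r2 j *m f1 j + s2 j *m g1 j) = 1%:M.
      by rewrite mulmxDr !mulmxA Gr2 Gs2; have [] := sp1 j.
    by case/mulmx1_unit.
  pose Gx x j := line 1%:M (G j) x.
  pose Y1 := coext r1 g1 p1; pose Y2 := coext r2 g2 p2.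
  pose Yx x j := line (Y1 j) (Y2 j) x.
  pose gam x := ext (fun j => f1 j *m Gx x j) (fun j => invmx (Gx x j) *m r1 j)
    (fun j => invmx (Gx x j) *m s1 j) q (Yx x).
  have Gx0 j : Gx 0 j = 1%:M by exact: line0.
  have Gx1 j : Gx 1 j = G j by exact: line1.
  have gam0 : gam 0 = p1.
    rewrite (restriction_ext sp1 offi m1 fi1) -/Y1 /gam.
    congr ext; apply: functional_extensionality_dep => j;
      rewrite ?Gx0 ?invmx1 ?mul1mx ?mulmx1 //; exact: line0.
  have gam1 : gam 1 = p2.
    rewrite (restriction_ext sp2 offi m2 fi2) -/Y2 /gam.
    congr ext; apply: functional_extensionality_dep => j.
    - by rewrite Gx1 f1G.
    - by rewrite Gx1 -Gr2 (mulKmx (Gu j)).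
    - by rewrite Gx1 -Gs2 (mulKmx (Gu j)).
    - exact: line1.
  have HG j : regular_mx [set (@id K)] (fun x => Gx x j) by exact: regular_line.
  have [N Dm] : regular [set (@id K)] (fun x => \prod_j \det (Gx x j)).
    by apply: regular_prod => j; exact: regular_det.
  have rgam : ratn_rep [set (@id K)] (fun x => \prod_j \det (Gx x j)) N gam.
    apply: ratn_ext => //.
    + move=> j; apply: ratn_mulmx => //; first exact: ratn_mx_cst.
      exact: ratn_mx_regular.
    + move=> j; apply: ratn_mulmx => //; last exact: ratn_mx_cst.
      exact: ratn_inv_family.
    + move=> j; apply: ratn_mulmx => //; last exact: ratn_mx_cst.
      exact: ratn_inv_family.
    + by split=> *; exact: ratn_mx_cst.
    + by move=> j; apply: ratn_mx_regular => //; exact: regular_line.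
  have amatF p H : lambda_st Om p -> regular (coord v) H -> exists H',
     [/\ regular (coord v) H', H p != 0 -> H' p != 0 & forall p', H' p' != 0 ->
        H p' != 0 /\ row_free (amat p' i)].
    move=> /lambdaP[_ _ /(_ i)/row_freeP[R0 R0E]] HH.
    exists (fun p' => H p' * \det (amat p' i *m R0)); split.
    + apply: regularM => //; apply: regular_det; apply: regular_mulmx.
        exact: regular_amat.
      exact: regular_mx_cst.
    + by rewrite R0E det1 mulr1.
    + move=> p'; rewrite mulf_eq0 negb_or => /andP[-> dp']; split=> //.
      apply/row_freeP; exists (R0 *m invmx (amat p' i *m R0)).
      by rewrite mulmxA mulmxV // unitmxE unitfE.
  have [H1 [rH1 H1p H1E]] := amatF p1 F l1 HF.
  have [H2 [rH2 H2p H2E]] := amatF p2 F' l2 HF'.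
  have D0 x : (\prod_j \det (Gx x j) != 0) <-> forall j, Gx x j \in unitmx.
    split=> [/prodf_neq0 H j|H]; first by rewrite unitmxE unitfE H.
    by apply/prodf_neq0 => j _; have := H j; rewrite unitmxE unitfE.
  have [||||x [/D0 Gxu H1x H2x]] := line_meet Dm rgam rH1 rH2.
  + by apply/D0 => j; rewrite Gx0 unitmx1.
  + by rewrite gam0; exact: H1p.
  + by apply/D0 => j; rewrite Gx1.
  + by rewrite gam1; exact: H2p.
  have [Fx ax] := H1E _ H1x; have [F'x _] := H2E _ H2x.
  have spx j : splitting (f1 j *m Gx x j) (invmx (Gx x j) *m r1 j)
      (g1 j *m Gx x j) (invmx (Gx x j) *m s1 j).
    have [e1 e2 e3 e4 e5] := sp1 j.
    split; try by rewrite mulmxA (mulmxK (Gxu j)).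
    rewrite -!mulmxA -mulmxDr (mulmxA (r1 j)) (mulmxA (s1 j)) -mulmxDl e5 mul1mx.
    exact: (mulVmx (Gxu j)).
  have Rx : is_restriction i (gam x) q by exact: (ext_restriction Om spx offi).
  exists (gam x); split=> //; split; last by exists q.
  apply: (ext_lambda spx offi) => //; first exact: lQ.
  rewrite mulmxDl -scalemxAl mulmxBl (coext_ker sp1 offi l1 m1) (coext_ker sp2 offi l2 m2).
  by rewrite subr0 scaler0 addr0.
Qed.

End Families.

Arguments Red {K n A d} i {v} P v' _ : rename.
Arguments Ext {K n A} Om {d} i {v'} Q v _ : rename.

(** * Dimension of a family of extensions *)

Lemma card_sigma n (F : 'I_n -> finType) : #|{: {j : 'I_n & F j}}| = (\sum_j #|F j|)%N.
Proof. by rewrite card_tagged sumnE big_map big_enum. Qed.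

Lemma ratn_rep_fst (K : numFieldType) n (A : sym_gcm n) d v (J : eqType) (s : seq J)
    (D : rep K A v d * (J -> K) -> K) m :
  pol (prodX (@coords K n A d v) s) m D ->
  ratn_rep (prodX (@coords K n A d v) s) D m fst.
Proof.
move=> Dm; split=> [a b k|a] x y; apply: ratn_regular => //; apply: regular_gen; left.
  by exists (fun q => rep_x q k x y) => //; left; exists a, b, k, x, y.
by exists (fun q => rep_t q a x y) => //; right; exists a, x, y.
Qed.

Section DimensionChart.
Context {K : numFieldType} {n : nat} {A : sym_gcm n} (Om : orientation A).
Context {d : {ffun 'I_n -> nat}} (v' v : {ffun 'I_n -> nat}).
Local Notation kap j := (v j - v' j)%N.
Local Notation hd := (@hdim n A d v').
Local Notation coord v := (@coords K n A d v).
Context (f : forall j, 'M[K]_(v' j, v j)) (r : forall j, 'M[K]_(v j, v' j))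
  (g : forall j, 'M[K]_(kap j, v j)) (s : forall j, 'M[K]_(v j, kap j)).
Hypothesis sp : forall j, splitting (f j) (r j) (g j) (s j).
Context (i : 'I_n) (offi : forall j, j != i -> v' j = v j).
Context (c : forall j, 'M[K]_(v' j, hd j)) (cr : 'M[K]_(hd i, v' i))
  (c' : forall j, 'M[K]_(hd j - v' j, hd j)) (e : forall j, 'M[K]_(hd j, hd j - v' j)).
Hypothesis cs : splitting (c i) cr (c' i) (e i).
Implicit Types (p : rep K A v d) (q : rep K A v' d).

(* The parameters, besides the restriction, of an extension in the chart. *)
Definition params : finType :=
  ({j : 'I_n & ('I_(v' j) * 'I_(kap j))%type} +
   {j : 'I_n & ('I_(kap j) * 'I_(hd j - v' j))%type})%type.

(** The embedding of V' contributes v' i times kap i parameters; the rest is, for each basis vector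
    of the complement, a point of the kernel of [bm], of dimension hd i - v' i. *)
Lemma card_params : (v' i <= hd i)%N -> #|params| = (kap i * hd i)%N.
Proof.
move=> le; rewrite card_sum !card_sigma.
rewrite (bigD1 i) //= [X in (_ + X)%N](bigD1 i) //= !big1 ?addn0; last 2 first.
- by move=> j ji; rewrite card_prod !card_ord (kap0 offi).
- by move=> j ji; rewrite card_prod !card_ord (kap0 offi) // muln0.
by rewrite !card_prod !card_ord [(v' i * _)%N]mulnC -mulnDr subnKC.
Qed.

Implicit Types z : params -> K.

Definition zZ z j : 'M[K]_(v' j, kap j) :=
  \matrix_(a, b) z (inl (Tagged (fun j => ('I_(v' j) * 'I_(kap j))%type) (a, b))).
Definition zY z j : 'M[K]_(kap j, hd j - v' j) :=
  \matrix_(a, b) z (inr (Tagged (fun j => ('I_(kap j) * 'I_(hd j - v' j))%type) (a, b))).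

Definition chart_ext (x : rep K A v' d * (params -> K)) : rep K A v d :=
  ext (fZ f g (zZ x.2)) r (sZ r s (zZ x.2)) x.1
    (kproj Om c x.1 (fun j => zY x.2 j *m c' j)).

Definition chart_z p : params -> K := fun x =>
  match x with
  | inl t => Zp Om f r s c p (tag t) (tagged t).1 (tagged t).2
  | inr t => (coext r g p (tag t) *m e (tag t)) (tagged t).1 (tagged t).2
  end.

Definition chart_fun p := (res f r g p (Zp Om f r s c p), chart_z p).

(** The incoming image of [p] determines the embedding. An element of the kernel of [bm] is
    determined by its component along [c'], because the product of [c i] and [bm] is invertible, and
    [kproj] recovers it from that component. *)
Lemma chart_extK p : lambda_st Om p -> Bp Om f r c p i \in unitmx ->
  (\rank (bm Om p i) <= v' i)%N -> chart_ext (chart_fun p) = p.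
Proof.
move=> lp u rk; have [m fi] := chart_restriction sp offi u rk.
rewrite /chart_ext /=.
have -> : zZ (chart_z p) = Zp Om f r s c p.
  by apply: functional_extensionality_dep => j; apply/matrixP => a b; rewrite mxE.
set q := res _ _ _ _ _ in m *.
have spZ := splittingZ sp (Zp Om f r s c p).
have u' : c i *m bm Om q i \in unitmx by rewrite -(chart_Bp Om sp offi c m).
suff -> : kproj Om c q (fun j => zY (chart_z p) j *m c' j) = coext r g p.
  by rewrite -(restriction_ext spZ offi m fi).
have Yk := coext_ker spZ offi lp m.
apply: functional_extensionality_dep => j.
have [->|ji] := eqVneq j i; last by apply: mx_dim0; rewrite (kap0 offi).
have [_ _ _ _ e5] := cs.
have W : zY (chart_z p) i *m c' i = coext r g p i - coext r g p i *m cr *m c i.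
  have -> : zY (chart_z p) i = coext r g p i *m e i by apply/matrixP => a b; rewrite mxE.
  apply: (addIr (coext r g p i *m cr *m c i)).
  by rewrite subrK -!mulmxA -mulmxDr addrC e5 mulmx1.
rewrite /kproj W mulmxBl Yk sub0r !mulNmx opprK -(mulmxA _ (c i) (bm Om q i)).
by rewrite mulmxK // subrK.
Qed.

Lemma chart_ext_morphism x : is_morphism x.1 (chart_ext x) (fZ f g (zZ x.2)).
Proof. exact: ext_morphism (splittingZ sp _) _ _. Qed.

Lemma chart_ext_den x : chart_den Om f r i c (chart_ext x) = den' Om i c x.1.
Proof. by rewrite /chart_den (chart_Bp Om sp offi c (chart_ext_morphism x)). Qed.

Lemma chart_funK x : den' Om i c x.1 != 0 -> chart_fun (chart_ext x) = x.
Proof.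
case: x => q z Dx; have m := chart_ext_morphism (q, z).
have u : Bp Om f r c (chart_ext (q, z)) i \in unitmx.
  by rewrite unitmxE unitfE -/(chart_den Om f r i c _) chart_ext_den.
rewrite /chart_fun (chart_Zp sp offi m u) (res_morphism sp m); congr pair.
apply: funext => -[[j [a b]]|[j [a b]]] /=.
  by rewrite (chart_Zp sp offi m u) mxE.
rewrite /chart_ext (coext_ext (splittingZ sp _)) /=.
have ji : j = i.
  by apply: contrapT => /eqP ji; have := ltn_ord a; rewrite [X in (_ < X)%N](kap0 offi).
subst j; have [_ e2 _ e4 _] := cs.
by rewrite /kproj mulmxBl -!mulmxA e2 e4 !mulmx0 mulmx1 subr0 mxE.
Qed.

Lemma ratn_chart_ext m :
  pol (prodX (coord v') (enum params)) m (fun x => den' Om i c x.1) ->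
  ratn_rep (prodX (coord v') (enum params)) (fun x => den' Om i c x.1) m chart_ext.
Proof.
move=> Dm; have rfst := ratn_rep_fst Dm.
have rz t : regular (prodX (coord v') (enum params)) (fun x => x.2 t).
  by apply: regular_gen; right; exists t; rewrite ?mem_enum.
have rZ j : ratn_mx (prodX (coord v') (enum params)) (fun x => den' Om i c x.1) m
    (fun x => zZ x.2 j).
  by apply: ratn_mx_regular => // a b; apply: regular_eq (rz _) => x; rewrite mxE.
have rY j : ratn_mx (prodX (coord v') (enum params)) (fun x => den' Om i c x.1) m
    (fun x => zY x.2 j).
  by apply: ratn_mx_regular => // a b; apply: regular_eq (rz _) => x; rewrite mxE.
apply: ratn_ext => //.
- move=> j; apply: ratn_addmx => //; first exact: ratn_mx_cst.
  by apply: ratn_mulmx => //; exact: ratn_mx_cst.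
- by move=> j; exact: ratn_mx_cst.
- move=> j; apply: ratn_addmx => //; first exact: ratn_mx_cst.
  by apply: ratn_oppmx => //; apply: ratn_mulmx => //; exact: ratn_mx_cst.
- apply: (ratn_kproj (q := fst) offi Dm rfst).
    move=> a b; apply: (@ratn1 _ _ _ 0); move: a b; apply: ratn_mulmx; first exact: pol_cst.
      by apply: ratn_mx_cst; exact: pol_cst.
    apply: ratn_bm; first exact: pol_cst.
    by apply: ratn_rep_fst; exact: pol_cst.
  by move=> j; apply: ratn_mulmx => //; exact: ratn_mx_cst.
Qed.

Lemma regular_den_fst : regular (prodX (coord v') (enum params)) (fun x => den' Om i c x.1).
Proof.
have [N H] := regular_den' Om i c; exists N.
elim: H => {N} [N x|N h Xh|N h h' _ ? _ ?|N M h h' _ ? _ ?].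
- exact: pol_cst.
- by apply: (pol_gen N); left; exists h.
- exact: pol_add.
- exact: pol_mul.
Qed.

Lemma ratn_chart_z m : pol (coord v) m (chart_den Om f r i c) ->
  forall t, ratn (coord v) (chart_den Om f r i c) m (fun p => chart_z p t).
Proof.
move=> Dm; have [ix it] := ratn_rep_id Dm.
case=> [[j [a b]]|[j [a b]]] /=; first exact: ratn_Zp.
apply: (ratn_mulmx Dm (M := fun p => coext r g p j) (N := fun=> e j)); last exact: ratn_mx_cst.
apply: ratn_flat => [b' k|]; last by apply: ratn_mulmx => //; exact: ratn_mx_cst.
by apply: ratn_mulmx => //; [apply: ratn_mulmx => //|]; exact: ratn_mx_cst.
Qed.

Lemma dim_le_chart (P : set (rep K A v d)) (Q : set (rep K A v' d)) x :
  (forall p, P p -> chart_den Om f r i c p != 0) ->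
  (forall p, P p -> lambda_st Om p /\ (\rank (bm Om p i) <= v' i)%N) ->
  (forall p, P p -> Q (res f r g p (Zp Om f r s c p))) ->
  P !=set0 -> dim_le (coord v') Q x -> dim_le (coord v) P (x + #|params|).
Proof.
move=> HD HP HQ [p0 Pp0] leQ.
have Q0 : Q !=set0 by eexists; apply: HQ Pp0.
have [N Dm] := regular_den_fst.
have [y Hy] := ratn_rep_unif Dm (ratn_chart_ext Dm).
apply: (dim_le_subst (s := chart_fun) Dm (e := y) _ _ ((dim_prod params _ _ Q0).1 leQ)).
  move=> h Hh; exists (h \o chart_ext); first exact: Hy.
  move=> p Pp /=; have [lp rk] := HP p Pp.
  by rewrite chart_extK // unitmxE unitfE; exact: HD.
move=> p Pp; split; first exact: HQ.
have [lp rk] := HP p Pp.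
by rewrite -chart_ext_den chart_extK ?HD // unitmxE unitfE; exact: HD.
Qed.

(** [chart_ext] is known to be stable only where [amat] stays injective. The product of [Q] with the
    parameters is irreducible and this open part contains the parameters of [p0], so it is dense and
    has the same dimension. *)
Lemma dim_ge_chart (Q : set (rep K A v' d)) x p0 q0 : irr (coord v') Q ->
  Q `<=` [set q | lambda_st Om q] -> Q q0 -> lambda_st Om p0 ->
  is_morphism q0 p0 f -> (f i :=: incoming p0 i)%MS -> den' Om i c q0 != 0 ->
  dim_ge (coord v') Q x -> dim_ge (coord v) (Ext Om i Q v) (x + #|params|).
Proof.
move=> iQ lQ Qq0 lp0 m0 fi0 D0 geQ.
have mZ := is_morphism_fZ g m0.
have u0 : Bp Om f r c p0 i \in unitmx.
  by rewrite (chart_Bp Om sp offi c mZ) unitmxE unitfE.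
have rk0 : (\rank (bm Om p0 i) <= v' i)%N.
  by rewrite (bm_incoming Om) -fi0 rank_leq_row.
have K0 := chart_extK lp0 u0 rk0.
have q0E : (chart_fun p0).1 = q0.
  by rewrite /= (chart_Zp sp offi mZ u0) (res_morphism sp mZ).
have [N Dm] := regular_den_fst.
have /lambdaP[_ _ /(_ i)/row_freeP[R0 R0E]] := lp0.
have Ha : regular (coord v) (fun p => \det (amat p i *m R0)).
  by apply: regular_det; apply: regular_mulmx; [exact: regular_amat|exact: regular_mx_cst].
have [F HF FE] := ratn_neq0 Dm (ratn_rep_comp Dm (ratn_chart_ext Dm) Ha).
pose W := [set y | prodP Q y /\ F y != 0].
have iW := irr_prod params iQ.
have [_ PW] : irr (prodX (coord v') (enum params)) W /\
    prodP Q `<=` zcl (prodX (coord v') (enum params)) W.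
  apply: (irr_open iW (D := F) (p := chart_fun p0)) => //.
  - by move=> y [].
  - by change (Q (chart_fun p0).1); rewrite q0E.
  - by rewrite FE q0E D0 /= K0 R0E det1 oner_eq0.
have geP := dim_ge_zcl PW ((dim_prod params _ _ (ex_intro _ q0 Qq0)).2 geQ).
have [M DM] := regular_chart_den Om f r i c.
have rres := ratn_res g s offi DM; have rz := ratn_chart_z DM.
have [y1 Hy1] := ratn_rep_unif DM rres.
have [y2 Hy2] : exists y, forall t, rat (coord v) (chart_den Om f r i c) M y (chart_z^~ t).
  by apply: fin_unif => // t y y' le; exact: rat_le.
apply: (dim_ge_subst (s := chart_ext) DM (e := maxn y1 y2) _ _ geP).
  move=> h [[h' Hh' ->]|[t _ ->]].
    exists (h' \o (fun p => res f r g p (Zp Om f r s c p))).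
      by apply: (rat_le DM _ (Hy1 _ Hh')); exact: leq_maxl.
    move=> y [_]; rewrite FE => /andP[Dy _] /=.
    by have := chart_funK Dy => /(congr1 fst) /= ->.
  exists (chart_z^~ t); first by apply: (rat_le DM _ (Hy2 t)); exact: leq_maxr.
  move=> y [_]; rewrite FE => /andP[Dy _] /=.
  by have := chart_funK Dy => /(congr1 snd) /= ->.
move=> y [Qy]; rewrite FE => /andP[Dy /= ay]; split; last by rewrite chart_ext_den.
have uy : c i *m bm Om y.1 i \in unitmx by rewrite unitmxE unitfE.
have e0 : eps i y.1 = 0%N.
  rewrite (eps_bm Om); apply/eqP; rewrite subn_eq0.
  by rewrite -{1}(mxrank_unit uy) mxrankM_maxr.
have spZ := splittingZ sp (zZ y.2).
split; last by exists y.1 => //; exact: (ext_restriction Om spZ offi).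
apply: (ext_lambda spZ offi); first exact: lQ.
  exact: kproj_ker.
apply/row_freeP; exists (R0 *m invmx (amat (chart_ext y) i *m R0)).
by rewrite mulmxA mulmxV // unitmxE unitfE.
Qed.

End DimensionChart.

(** * Components of the nilpotent variety *)

Section Components.
Context {K : numFieldType} {n : nat} {A : sym_gcm n} (Om : orientation A).
Context {d : {ffun 'I_n -> nat}}.
Implicit Types v : {ffun 'I_n -> nat}.
Local Notation coord v := (@coords K n A d v).
Local Notation Lam v := (@lambda_st K n A Om v d).
Local Notation hd v := (@hdim n A d v).

Lemma hdim_off v v' i : (forall j, j != i -> v' j = v j) -> hd v' i = hd v i.
Proof.
move=> off; rewrite !hdimE; congr addn; apply: eq_bigr => j _.
have [->|ji] := eqVneq j i; first by rewrite /edge_mult eqxx !mul0n.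
by rewrite off.
Qed.

(* Half the dimension of the space of representations of the framed double
   quiver, with maps both to and from D *)
Definition half_dim v :=
  (\sum_j (v j * d j).*2 + \sum_j \sum_k edge_mult A j k * (v j * v k))%N./2.

(** In the sum before halving, the terms with the coordinate at [i] add up to twice its product with
    [hdim], each edge at [i] being counted from both ends and no edge being a loop. The increment is
    thus the number given by [card_params]. *)
Lemma half_dim_off v v' i : (forall j, j != i -> v' j = v j) -> (v' i <= v i)%N ->
  half_dim v = (half_dim v' + (v i - v' i) * hd v' i)%N.
Proof.
move=> off le.
have E (u : {ffun 'I_n -> nat}) : (\sum_j (u j * d j).*2 + \sum_j \sum_k edge_mult A j k * (u j * u k))%N =
  ((u i * hd u i).*2 + (\sum_(j | j != i) (u j * d j).*2 +
    \sum_(j | j != i) \sum_(k | k != i) edge_mult A j k * (u j * u k)))%N.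
  have eii : edge_mult A i i = 0%N by rewrite /edge_mult eqxx.
  pose a := (\sum_(k | k != i) edge_mult A i k * u k)%N.
  have hE : hd u i = (d i + a)%N by rewrite hdimE (bigD1 i) //= eii.
  have rowE : (\sum_k edge_mult A i k * (u i * u k) = u i * a)%N.
    rewrite (bigD1 i) //= eii mul0n add0n big_distrr /=.
    by apply: eq_bigr => k _; rewrite mulnCA.
  have colE : (\sum_(j | j != i) \sum_k edge_mult A j k * (u j * u k) =
    u i * a + \sum_(j | j != i) \sum_(k | k != i) edge_mult A j k * (u j * u k))%N.
    rewrite big_distrr -big_split /=; apply: eq_bigr => j ji.
    by rewrite (bigD1 i) //= edge_multC [(u j * u i)%N]mulnC mulnCA.
  rewrite (bigD1 i) //= [X in (_ + X)%N = _](bigD1 i) //= rowE colE hE mulnDr.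
  rewrite -!addnn.
  have H (x y s1 s2 : nat) : (x + x + s1 + (y + (y + s2)) = x + y + (x + y) + (s1 + s2))%N.
    by lia.
  exact: H.
rewrite /half_dim !E (hdim_off off) -(subnKC le) mulnDl doubleD.
have -> : (\sum_(j | j != i) (v' j * d j).*2 = \sum_(j | j != i) (v j * d j).*2)%N.
  by apply: eq_bigr => j ji; rewrite off.
have -> : (\sum_(j | j != i) \sum_(k | k != i) edge_mult A j k * (v' j * v' k) =
  \sum_(j | j != i) \sum_(k | k != i) edge_mult A j k * (v j * v k))%N.
  by apply: eq_bigr => j ji; apply: eq_bigr => k ki; rewrite !off.
rewrite subnKC // [((v' i * _).*2 + _)%N]addnC -addnA halfD odd_double doubleK /=.
by rewrite add0n addnC.
Qed.

Lemma complement_family (w w' : 'I_n -> nat) i (c : forall j, 'M[K]_(w' j, w j)) B :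
  c i *m B = 1%:M -> exists cr (c' : forall j, 'M[K]_(w j - w' j, w j))
    (e : forall j, 'M[K]_(w j, w j - w' j)), splitting (c i) cr (c' i) (e i).
Proof.
move=> cB; have free : row_free (c i) by apply/row_freeP; exists B.
have [cr [c' [e cs]]] := splitting_exists free; exists cr.
exists (eqtype.dfwith (T := fun j => 'M[K]_(w j - w' j, w j)) (fun=> 0) (i := i) c').
exists (eqtype.dfwith (T := fun j => 'M[K]_(w j, w j - w' j)) (fun=> 0) (i := i) e).
by rewrite !eqtype.dfwith_in.
Qed.

Lemma span_base m N (S : 'M[K]_N) : \rank S = m ->
  exists2 f : 'M[K]_(m, N), row_free f & (f :=: S)%MS.
Proof.
move=> e; subst m; exists (row_base S); first exact: row_base_free.
exact: eq_row_base.
Qed.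

Lemma restriction_exists v v' i (p : rep K A v d) :
  (forall j, j != i -> v' j = v j) -> v' i = (v i - eps i p)%N ->
  exists q : rep K A v' d, is_restriction i p q.
Proof.
move=> off vi.
have H j : exists f : 'M[K]_(v' j, v j), row_free f /\
    (f :=: if j == i then incoming p j else 1%:M)%MS.
  case: eqP => [->|/eqP ji].
    have [|f ff fe] := @span_base (v' i) (v i) (incoming p i); last by exists f.
    by rewrite vi -(bm_incoming Om) (eps_bm Om) subKn // rank_leq_col.
  have [|f ff fe] := @span_base (v' j) (v j) 1%:M; last by exists f.
  by rewrite mxrank1 off.
pose f j := projT1 (cid (H j)).
have Hf j : row_free (f j) /\ (f j :=: if j == i then incoming p j else 1%:M)%MS.
  exact: projT2 (cid (H j)).
exists (Rep (fun a b k => f a *m rep_x p k *m pinvmx (f b)) (fun a => f a *m rep_t p a)).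
exists f => //; split=> // a b k /=; apply: mulmxKpV.
have [_ ->] := Hf b; case: eqP => [e|_]; last exact: submx1.
apply: submx_trans (submxMl _ _) _.
by rewrite (sumsmx_sup a) // (sumsmx_sup k) // genmxE.
Qed.

Lemma extension_exists v v' i (q : rep K A v' d) : lambda_st Om q -> eps i q = 0%N ->
  (forall j, j != i -> v' j = v j) -> (v' i <= v i)%N -> (v' i + v i <= hd v' i)%N ->
  exists2 p : rep K A v d, lambda_st Om p & is_restriction i p q.
Proof.
move=> lq e0 off le leH.
have [|r [g [s sp]]] := @splitting_family K n v v' (fun j => pid_mx (v' j)).
  move=> j; rewrite /row_free rank_pid_mx //.
  by have [->|/off ->] := eqVneq j i.
have [Y [lp R]] := ext_exists sp off lq e0 le leH.
by exists (ext (fun j => pid_mx (v' j)) r s q Y).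
Qed.

Definition generic_eps v (P : set (rep K A v d)) i c :=
  (exists2 p, P p & eps i p = c) /\ forall p, P p -> (c <= eps i p)%N.

Lemma generic_eps_exists v (P : set (rep K A v d)) i :
  P !=set0 -> exists c, generic_eps P i c.
Proof.
move=> [p Pp].
have ex : exists c, `[< exists2 p, P p & eps i p = c >].
  by exists (eps i p); apply/asboolP; exists p.
exists (ex_minn ex); case: ex_minnP => c /asboolP[p0 Pp0 e] min.
by split=> [|p' Pp']; [exists p0|apply: min; apply/asboolP; exists p'].
Qed.

Lemma generic_dense v (P : set (rep K A v d)) i c : irr (coord v) P -> generic_eps P i c ->
  irr (coord v) [set p | P p /\ eps i p = c] /\
  P `<=` zcl (coord v) [set p | P p /\ eps i p = c].
Proof.
move=> iP [[p0 Pp0 e0] gen]; have [F [HF F0 FE]] := eps_open Om p0 i.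
apply: (irr_open iP (D := F) (p := p0)) => // [p [] //|p Pp Fp]; split=> //.
by apply/eqP; rewrite eqn_leq gen // andbT -e0 FE.
Qed.

(** If the generic value were 0 at all vertices, these finitely many open conditions would hold at a
    common point, and [nilpotent_eps0] would make V zero. *)
Lemma generic_pos v (P : set (rep K A v d)) : irr (coord v) P -> P `<=` Lam v ->
  ~ (forall j, v j = 0%N) -> exists i c, generic_eps P i c /\ (0 < c)%N.
Proof.
move=> iP lP nv; apply: contrapT => H; apply: nv.
have e0 i : exists2 p, P p & eps i p = 0%N.
  have [c gc] := generic_eps_exists i iP.1.
  case: c gc => [[//]|c gc]; exfalso; apply: H; by exists i, c.+1.
have /choice[p0 Hp0] i : exists p, P p /\ eps i p = 0%N.
  by have [p ? ?] := e0 i; exists p.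
have /choice[F HF] i := eps_open Om (p0 i) i.
have [|p Pp Fp] := irr_inter (r := enum 'I_n) (F := F) iP.
  by move=> i _; have [H1 H2 _] := HF i; split=> //; exists (p0 i) => //; have [] := Hp0 i.
have [nil _ _] := lP p Pp.
apply: (nilpotent_eps0 Om nil) => i; have [_ _ /(_ p)] := HF i.
rewrite Fp ?mem_enum // => /(_ isT); rewrite (Hp0 i).2; lia.
Qed.

Definition lower v i c : {ffun 'I_n -> nat} := [ffun j => v j - c * (j == i)]%N.

Lemma lower_off v i c j : j != i -> lower v i c j = v j.
Proof. by move=> /negbTE ji; rewrite ffunE ji muln0 subn0. Qed.

Lemma lower_at v i c : lower v i c i = (v i - c)%N.
Proof. by rewrite ffunE eqxx muln1. Qed.

Lemma sum_lower v i c : (c <= v i)%N -> (\sum_j lower v i c j + c = \sum_j v j)%N.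
Proof.
move=> le; rewrite (bigD1 i) //= [in RHS](bigD1 i) //= lower_at addnAC subnK //.
by congr addn; apply: eq_bigr => j /lower_off ->.
Qed.

Lemma eps_le v i (p : rep K A v d) : (eps i p <= v i)%N.
Proof. exact: leq_subr. Qed.

Lemma generic_le v (P : set (rep K A v d)) i c : generic_eps P i c -> (c <= v i)%N.
Proof. by move=> [[p _ <-] _]; exact: eps_le. Qed.

Lemma generic_red v (P : set (rep K A v d)) i c : irr (coord v) P -> P `<=` Lam v ->
  generic_eps P i c ->
  irr (coord (lower v i c)) (Red i P (lower v i c)) /\
  Red i P (lower v i c) `<=` Lam (lower v i c).
Proof.
move=> iP lP gc; have le := generic_le gc; have [[p0 Pp0 e0] gen] := gc; split.
  apply: (red_irr Om iP) => [p Pp|]; first by rewrite lower_at subKn // gen.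
  have [q R] : exists q : rep K A (lower v i c) d, is_restriction i p0 q.
    by apply: restriction_exists; [exact: lower_off|rewrite lower_at e0].
  by exists q, p0.
move=> q [p Pp R]; exact: restriction_lambda R (lP p Pp).
Qed.

(** Induction on the total dimension: restriction at a vertex with positive generic cokernel lowers
    it, and the chart adds exactly the parameters that [half_dim] gains. *)
Lemma dim_le_lambda v (P : set (rep K A v d)) :
  irr (coord v) P -> P `<=` Lam v -> dim_le (coord v) P (half_dim v).
Proof.
have [m] := ubnP (\sum_j v j); elim: m v P => // m IH v P ltm iP lP.
case: (pselect (forall j, v j = 0%N)) => [v0|nv].
  have allE (p q : rep K A v d) : p = q.
    by apply: eq_rep => [a b k|a]; apply: mx_dim0.
  exists 1%N => N k H; rewrite mul1n; apply: (@leq_trans 1); last by rewrite expn_gt0.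
  rewrite -card_unit; apply: (span_indep (u := fun _ _ => 1) _ H) => f _.
  have [[p0 _] _] := iP.
  by exists (fun=> f p0) => p _; rewrite big_const card_unit /= addr0 mulr1 (allE p p0).
have [i [c [gc c0]]] := generic_pos iP lP nv.
have le := generic_le gc.
have [iR lR] := generic_red iP lP gc.
have sz : (\sum_j lower v i c j < m)%N by have := sum_lower le; lia.
have leR := IH _ _ sz iR lR; move: gc => [[p0 Pp0 e0] gen].
have [q0 R0] : exists q : rep K A (lower v i c) d, is_restriction i p0 q.
  by apply: restriction_exists; [exact: lower_off|rewrite lower_at e0].
set v' := lower v i c in iR lR leR R0 *.
have off : forall j, j != i -> v' j = v j := @lower_off v i c.
have vi : v' i = (v i - c)%N := lower_at v i c.
have [f [r [g [s [cc [sp mo fi ce]]]]]] := restriction_chart Om R0.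
have [cr [C [E CS]]] := complement_family ce.
have leH : (v' i <= hd v' i)%N.
  have := lambda_rank i (lR q0 (ex_intro2 _ _ p0 Pp0 R0)); lia.
pose P0 := [set p | P p /\ chart_den Om f r i cc p != 0].
have D0 : chart_den Om f r i cc p0 != 0.
  by rewrite /chart_den (chart_Bp Om sp off cc (is_morphism_fZ g mo)) ce det1 oner_eq0.
have [_ PP0] : irr (coord v) P0 /\ P `<=` zcl (coord v) P0.
  apply: (irr_open iP _ (regular_chart_den Om f r i cc) Pp0 D0) => // p [] //.
apply: dim_le_zcl PP0 _.
have rk p : P0 p -> (\rank (bm Om p i) <= v' i)%N.
  by move=> [Pp _]; apply: eps_rank_le; rewrite vi ?subKn ?leq_subr // gen.
have leV : (v' i <= v i)%N by rewrite vi leq_subr.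
rewrite (half_dim_off off leV) -(card_params off leH).
apply: (dim_le_chart (Om := Om) (c := cc) sp off CS _ _ _ _ leR) => [p []//|p P0p|p P0p|].
- by split; [apply: lP; case: P0p|exact: rk].
- exists p; first by case: P0p.
  apply: (chart_is_restriction sp off); last exact: rk.
  by rewrite unitmxE unitfE; case: P0p.
- by exists p0.
Qed.

Definition component v (P : set (rep K A v d)) := [/\ irr (coord v) P, P `<=` Lam v &
  forall Y, irr (coord v) Y -> Y `<=` Lam v -> P `<=` Y -> Y `<=` P].

Definition lcl v (P : set (rep K A v d)) := zcl (coord v) P `&` Lam v.

Lemma sub_lcl v (P : set (rep K A v d)) : P `<=` Lam v -> P `<=` lcl P.
Proof. by move=> lP p Pp; split; [exact: sub_zcl|exact: lP]. Qed.

Lemma lcl_irr v (P : set (rep K A v d)) : P `<=` Lam v -> irr (coord v) P ->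
  irr (coord v) (lcl P).
Proof. by move=> lP iP; apply: (irr_between iP); [exact: sub_lcl|move=> p []]. Qed.

Lemma component_sub v (P Y : set (rep K A v d)) : component P -> irr (coord v) Y ->
  Y `<=` Lam v -> P `<=` zcl (coord v) Y -> lcl Y = P.
Proof.
move=> [iP lP max] iY lY PY; have PlY : P `<=` lcl Y by move=> p Pp; split; [exact: PY|exact: lP].
apply/seteqP; split => //; apply: max => //; first exact: lcl_irr.
by move=> p [].
Qed.

Section Generic.
Context v (P : set (rep K A v d)) i c (cP : component P) (gc : generic_eps P i c).
Local Notation v' := (lower v i c).

Let off : forall j, j != i -> v' j = v j := @lower_off v i c.
Let vi : v' i = (v i - c)%N := lower_at v i c.
Let le : (c <= v i)%N := generic_le gc.

Lemma component_hdim : (v' i + v i <= hd v' i)%N.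
Proof.
have [_ lP _] := cP; have [[p0 /lP lp0 e0] _] := gc.
have := lambda_rank i lp0; rewrite (hdim_off off) vi.
by have := eps_bm Om p0 i; rewrite e0; have := rank_leq_col (bm Om p0 i); lia.
Qed.

Lemma generic_restriction p : P p -> eps i p = c ->
  exists2 q : rep K A v' d, Red i P v' q & is_restriction i p q.
Proof.
move=> Pp e; have [|q R] := restriction_exists (p := p) off; first by rewrite vi e.
by exists q => //; exists p.
Qed.

(** The generic part of [P] consists of extensions of points of [Q], and all such extensions form an
    irreducible set; maximality of [P] does the rest. *)
Lemma component_sub_ext (Q : set (rep K A v' d)) : irr (coord v') Q -> Q `<=` Lam v' ->
  Red i P v' `<=` Q -> lcl (Ext Om i Q v) = P.
Proof.
move=> iQ lQ RQ; have [iP lP _] := cP.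
have [_ dense] := generic_dense iP gc.
have PE : [set p | P p /\ eps i p = c] `<=` Ext Om i Q v.
  move=> p [Pp e]; split; first exact: lP.
  by have [q /RQ Qq R] := generic_restriction Pp e; exists q.
apply: component_sub => //.
- apply: (ext_irr iQ lQ); have [[p0 Pp0 e0] _] := gc.
  by exists p0; apply: PE.
- by move=> p [].
- by move=> p /dense; apply: zcl_sub => q /PE; exact: sub_zcl.
Qed.

(** A point of [Q] with zero cokernel at [i] has some extension, which lies in [P] because the
    extensions of all of [Q] do. *)
Lemma component_red_eps (Q : set (rep K A v' d)) q : irr (coord v') Q -> Q `<=` Lam v' ->
  Red i P v' `<=` Q -> Q q -> eps i q = 0%N -> Red i P v' q.
Proof.
move=> iQ lQ RQ Qq e0.
have [|p lp R] := extension_exists (lQ q Qq) e0 off _ component_hdim.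
  by rewrite vi leq_subr.
exists p => //; rewrite -(component_sub_ext iQ lQ RQ).
by apply: sub_lcl => [x []//|]; split => //; exists q.
Qed.

Lemma red_eps0 q : Red i P v' q -> eps i q = 0%N.
Proof. by move=> [p _ /(restriction_eps0 Om)]. Qed.

Lemma red_nonempty : Red i P v' !=set0.
Proof.
have [[p0 Pp0 e0] _] := gc.
by have [q Rq _] := generic_restriction Pp0 e0; exists q.
Qed.

(** A larger irreducible [Y] has the same generic value 0, and [component_red_eps] puts its generic
    points among the restrictions of [P]. *)
Lemma component_red : component (lcl (Red i P v')) /\
  generic_eps (lcl (Red i P v')) i 0.
Proof.
have [iP lP _] := cP; have [iR lR] := generic_red iP lP gc.
have [q0 Rq0] := red_nonempty; split; last first.
  by split => //; exists q0; [exact: sub_lcl|exact: red_eps0].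
split; first exact: lcl_irr; first by move=> q [].
move=> Y iY lY RY q Yq; split; last exact: lY.
have gY : generic_eps Y i 0.
  by split => //; exists q0; [apply: RY; exact: sub_lcl|exact: red_eps0].
have [_ /(_ q Yq)] := generic_dense iY gY; apply: zcl_sub => y [Yy ey].
apply: sub_zcl; apply: (component_red_eps iY lY) => // x Rx.
by apply: RY; exact: sub_lcl.
Qed.

End Generic.

Lemma dim_ge_ext v v' i (Q : set (rep K A v' d)) x : irr (coord v') Q -> Q `<=` Lam v' ->
  (forall q, Q q -> eps i q = 0%N) -> (forall j, j != i -> v' j = v j) ->
  (v' i <= v i)%N -> (v' i + v i <= hd v' i)%N -> dim_ge (coord v') Q x ->
  dim_ge (coord v) (Ext Om i Q v) (x + (v i - v' i) * hd v' i).
Proof.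
move=> iQ lQ eQ off le leH geQ; have [[q0 Qq0] _] := iQ.
have [p0 lp0 R0] := extension_exists (lQ _ Qq0) (eQ _ Qq0) off le leH.
have [f [r [g [s [c [sp m fi ce]]]]]] := restriction_chart Om R0.
have [cr [c' [e cs]]] := complement_family ce.
rewrite -(card_params off); last by lia.
apply: (dim_ge_chart sp off cs iQ lQ Qq0 lp0 m fi) => //.
by rewrite /den' ce det1 oner_eq0.
Qed.

(** The restriction of a component has a component as closure, of smaller total dimension, and its
    extensions are dense in [P]. *)
Lemma component_dim_ge v (P : set (rep K A v d)) :
  component P -> dim_ge (coord v) P (half_dim v).
Proof.
have [m] := ubnP (\sum_j v j); elim: m v P => // m IH v P ltm cP.
have [iP lP max] := cP.
case: (pselect (forall j, v j = 0%N)) => [v0|nv].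
  suff -> : half_dim v = 0%N by apply: dim_ge0; case: iP.
  rewrite /half_dim !big1 // => j _; first by rewrite big1 // => k _; rewrite v0 muln0.
  by rewrite v0.
have [i [c [gc c0]]] := generic_pos iP lP nv.
have le := generic_le gc.
have sz : (\sum_j lower v i c j < m)%N by have := sum_lower le; lia.
have [cR gR] := component_red cP gc.
have [iR lR] := generic_red iP lP gc.
have geR : dim_ge (coord _) (Red i P (lower v i c)) (half_dim (lower v i c)).
  by apply: dim_ge_zcl (IH _ _ sz cR) => q [].
have leV : (lower v i c i <= v i)%N by rewrite lower_at leq_subr.
have := dim_ge_ext (v := v) iR lR (@red_eps0 v P i c) (@lower_off v i c) leV
  (component_hdim cP gc) geR.
rewrite -(half_dim_off (@lower_off v i c) leV); apply: dim_ge_zcl.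
rewrite -[X in _ `<=` zcl _ X](component_sub_ext cP gc iR lR) //.
by move=> p Ep; apply/sub_zcl/sub_lcl => // x [].
Qed.

(* [P] and an irreducible set containing it have the same dimension, hence the
   same closure. *)
Lemma component_of_dim v (P : set (rep K A v d)) : irr (coord v) P -> P `<=` Lam v ->
  dim_ge (coord v) P (half_dim v) -> component (lcl P).
Proof.
move=> iP lP geP; split; first exact: lcl_irr; first by move=> p [].
move=> Y iY lY PY y Yy; split; last exact: lY.
move=> f Hf f0; apply: contrapT => /eqP fy.
have PY' : P `<=` Y by move=> p Pp; apply/PY/sub_lcl.
exact: (dim_strict iY PY' Hf f0 Yy fy geP (dim_le_lambda iY lY)).
Qed.

(** The extensions form an irreducible set whose dimension reaches [half_dim] by the count of
    parameters, and [component_of_dim] turns this into maximality. *)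
Lemma component_ext v v' i (Q : set (rep K A v' d)) : component Q ->
  generic_eps Q i 0 -> (forall j, j != i -> v' j = v j) ->
  (v' i <= v i)%N -> (v' i + v i <= hd v' i)%N ->
  let P := lcl (Ext Om i [set q | Q q /\ eps i q = 0%N] v) in
  [/\ component P, generic_eps P i (v i - v' i) & lcl (Red i P v') = Q].
Proof.
move=> cQ gQ off le leH P; have [iQ lQ max] := cQ.
have [iQ0 dense] := generic_dense iQ gQ.
set Q0 := [set q | _] in iQ0 dense *.
have lQ0 : Q0 `<=` Lam v' by move=> q [/lQ].
have eQ0 q : Q0 q -> eps i q = 0%N by case.
have [[q0 Qq0] _] := iQ0.
have [p0 lp0 R0] := extension_exists (lQ0 _ Qq0) (eQ0 _ Qq0) off le leH.
have Ep0 : Ext Om i Q0 v p0 by split => //; exists q0.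
have iE : irr (coord v) (Ext Om i Q0 v) by apply: (ext_irr iQ0 lQ0); exists p0.
have lE : Ext Om i Q0 v `<=` Lam v by move=> p [].
have cP : component P.
  apply: component_of_dim => //; rewrite (half_dim_off off le).
  apply: dim_ge_ext => //; apply: dim_ge_zcl dense _; exact: component_dim_ge.
(* [eps] can only go up on the closure: any open set around [p] contains extensions, whose value is
   v i - v' i. *)
have gP : generic_eps P i (v i - v' i).
  split; first by exists p0; [exact: sub_lcl|exact: (restriction_eps Om R0)].
  move=> p [cp _]; have [F [HF Fp FE]] := eps_open Om p i.
  have [q [_ [q' _ R]] Fq] := zcl_meet cp HF Fp.
  by rewrite -(restriction_eps Om R); exact: FE.
split => //.
have vE : v' = lower v i (v i - v' i).
  apply/ffunP => j; have [->|ji] := eqVneq j i; first by rewrite lower_at subKn.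
  by rewrite lower_off // off.
have [cR _] := component_red cP gP; move: cR; rewrite -vE => cR.
have QR : Q `<=` lcl (Red i P v').
  move=> q Qq; split; last exact: lQ.
  apply: (zcl_sub _ (dense q Qq)) => x Qx; apply: sub_zcl.
  have [p lp R] := extension_exists (lQ0 _ Qx) (eQ0 _ Qx) off le leH.
  by exists p => //; apply: sub_lcl => //; split => //; exists x.
apply/seteqP; split => //; apply: max => //; by have [] := cR.
Qed.

(** A component is the closure of the extensions of its closed restriction, so the latter determines
    it. *)
Lemma component_red_inj v v' i (P P' : set (rep K A v d)) c :
  component P -> component P' -> generic_eps P i c -> generic_eps P' i c ->
  v' = lower v i c -> lcl (Red i P v') = lcl (Red i P' v') -> P = P'.
Proof.
move=> cP cP' gP gP' -> e.
have [cR gR] := component_red cP gP; have [iR lR _] := cR.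
have [iP0 lP0 _] := cP; have [iP0' lP0' _] := cP'.
have [_ l1] := generic_red iP0 lP0 gP; have [_ l2] := generic_red iP0' lP0' gP'.
rewrite -(component_sub_ext cP gP iR lR (sub_lcl l1)).
by rewrite -(component_sub_ext cP' gP' iR lR) // e; exact: sub_lcl.
Qed.

End Components.

(** * The quiver variety and the crystal *)

Section Bridge.
Local Open Scope quotient_scope.
Context {K : numFieldType} {n : nat} {A : sym_gcm n} (Om : orientation A).
Context {d : {ffun 'I_n -> nat}}.
Implicit Types v : {ffun 'I_n -> nat}.
Local Notation coord v := (@coords K n A d v).
Local Notation Lam v := (@lambda_st K n A Om v d).
Local Notation QV v := (quiver_variety K Om v d).

Definition lift v (S : set (QV v)) : set (rep K A v d) :=
  [set p | exists2 y : stable_rep Om v d, set_val y = p & S (pt y)].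

Definition unlift v (P : set (rep K A v d)) : set (QV v) :=
  [set x | exists2 y : stable_rep Om v d, P (set_val y) & pt y = x].

Lemma gv_act_subrep v (g : forall j, 'M[K]_(v j)) (p : rep K A v d) :
  (forall j, g j \in unitmx) -> is_subrep (gv_act g p) p.
Proof.
move=> gu; exists (fun j => invmx (g j)).
  by split=> [a b k|a] //=; rewrite -!mulmxA mulmxV // mulmx1.
by move=> j; rewrite row_free_unit unitmx_inv.
Qed.

Lemma gv_act_lambda v (g : forall j, 'M[K]_(v j)) (p : rep K A v d) :
  (forall j, g j \in unitmx) -> lambda_st Om p -> lambda_st Om (gv_act g p).
Proof. by move=> gu; exact/subrep_lambda/gv_act_subrep. Qed.

Lemma gv_act_eps v (g : forall j, 'M[K]_(v j)) (p : rep K A v d) i :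
  (forall j, g j \in unitmx) -> eps i (gv_act g p) = eps i p.
Proof.
move=> gu; rewrite !(eps_bm Om); congr subn.
have -> : bm Om (gv_act g p) i =
    bmat Om (fun b (k : dart A b i) => invmx (g b) *m rep_x p k) *m g i.
  by rewrite bmat_mul.
rewrite mxrankMfree ?row_free_unit // !bmat_span.
have E b (k : dart A b i) : (<<invmx (g b) *m rep_x p k>> :=: <<rep_x p k>>)%MS.
  apply: (eqmx_trans (genmxE _) (eqmx_trans _ (eqmx_sym (genmxE _)))).
  by apply: eqmxMfull; rewrite row_full_unit unitmx_inv.
apply/eqP; rewrite eqn_leq; apply/andP; split; apply: mxrankS;
  by apply/sumsmx_subP => b _; apply/sumsmx_subP => k _;
    rewrite (sumsmx_sup b) // (sumsmx_sup k) // E.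
Qed.

Lemma gv_actM v (g h : forall j, 'M[K]_(v j)) (p : rep K A v d) :
  (forall j, g j \in unitmx) -> (forall j, h j \in unitmx) ->
  gv_act h (gv_act g p) = gv_act (fun j => g j *m h j) p.
Proof.
move=> gu hu.
have invM j : invmx (g j *m h j) = invmx (h j) *m invmx (g j).
  have u : g j *m h j \in unitmx by rewrite unitmx_mul gu hu.
  apply: (can_inj (mulKmx u)).
  by rewrite mulmxV // mulmxA mulmxK // mulmxV.
by apply: eq_rep => *; rewrite /= invM !mulmxA.
Qed.

Lemma stable_rep_val v (p : rep K A v d) : lambda_st Om p ->
  exists y : stable_rep Om v d, set_val y = p.
Proof. by move=> lp; exists (exist _ p (mem_set lp)). Qed.

Lemma stable_rep_lambda v (y : stable_rep Om v d) : Lam v (set_val y).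
Proof. exact: set_valP. Qed.

Lemma pt_eqP v (y y' : stable_rep Om v d) : pt y = pt y' <->
  exists2 g : forall j, 'M[K]_(v j), forall j, g j \in unitmx & set_val y' = gv_act g (set_val y).
Proof.
by split=> [/eqmodP/asboolP //|H]; apply/eqmodP/asboolP.
Qed.

Lemma pt_surj v (x : QV v) : exists y, pt y = x.
Proof. by exists (repr (x : {eq_quot @orbit_equiv K n A Om v d})); exact: reprK. Qed.

Lemma eps_ptE v i (y : stable_rep Om v d) : eps_pt i (pt y) = eps i (set_val y : rep K A v d).
Proof.
have /pt_eqP[g gu ->] : pt (repr (pt y : {eq_quot @orbit_equiv K n A Om v d})) = pt y.
  exact: reprK.
by rewrite gv_act_eps.
Qed.

Lemma lift_lambda v (S : set (QV v)) : lift S `<=` Lam v.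
Proof. by move=> _ [y <- _]; exact: stable_rep_lambda. Qed.

Lemma liftP v (S : set (QV v)) y : lift S (set_val y) <-> S (pt y).
Proof.
split=> [[y' e Sy']|Sy]; last by exists y.
suff -> : pt y = pt y' by [].
apply/pt_eqP; exists (fun=> 1%:M) => [j|]; first exact: unitmx1.
by rewrite e; apply: eq_rep => *; rewrite /= invmx1 mul1mx ?mulmx1.
Qed.

Lemma lift_sub v (S S' : set (QV v)) : lift S `<=` lift S' -> S `<=` S'.
Proof. by move=> SS x; have [y <-] := pt_surj x => /liftP/SS/liftP. Qed.

Lemma lift_inj v (S S' : set (QV v)) : lift S = lift S' -> S = S'.
Proof. by move=> e; apply/seteqP; split; apply: lift_sub; rewrite e. Qed.

Lemma lift_mono v (S S' : set (QV v)) : S `<=` S' -> lift S `<=` lift S'.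
Proof. by move=> SS p [y e /SS Sy]; exists y. Qed.

Definition gstable v (P : set (rep K A v d)) := forall p (g : forall j, 'M[K]_(v j)),
  (forall j, g j \in unitmx) -> P p -> P (gv_act g p).

Lemma lift_gstable v (S : set (QV v)) : gstable (lift S).
Proof.
move=> _ g gu [y <- Sy].
have [y' e] := stable_rep_val (gv_act_lambda gu (stable_rep_lambda y)).
exists y' => //; suff -> : pt y' = pt y by [].
by apply/esym/pt_eqP; exists g.
Qed.

Lemma sub_lift_unlift v (P : set (rep K A v d)) : P `<=` Lam v -> P `<=` lift (unlift P).
Proof.
move=> lP p Pp; have [y e] := stable_rep_val (lP p Pp).
by exists y => //; exists y; rewrite ?e.
Qed.

Lemma lift_unlift v (P : set (rep K A v d)) : P `<=` Lam v -> gstable P ->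
  lift (unlift P) = P.
Proof.
move=> lP gP; apply/seteqP; split; last exact: sub_lift_unlift.
by move=> _ [y <- [y' Py' /pt_eqP[g gu ->]]]; exact: gP.
Qed.

Lemma unlift_lift v (S : set (QV v)) : unlift (lift S) = S.
Proof. by apply: lift_inj; apply: lift_unlift; [exact: lift_lambda|exact: lift_gstable]. Qed.

Lemma closedP v (F : set (QV v)) : closed F <->
  exists2 Z : set (rep K A v d -> K), Z `<=` regular (coord v) &
    forall y, F (pt y) <-> forall f, Z f -> f (set_val y) = 0.
Proof.
split=> [|[Z rZ HZ]].
  rewrite -openC => -[B [Z pZ BZ] eB]; exists Z; first by move=> f /pZ/polyfunP.
  move=> y; have e : B (set_val y) <-> ~ F (pt y) by have := congr1 (@^~ y) eB => /= ->.
  have e' : (~ B (set_val y)) <-> forall f, Z f -> f (set_val y) = 0.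
    by have := congr1 (@^~ (set_val y)) BZ => /= ->.
  rewrite -e'; split=> [Fy /e //|nB]; apply: contrapT => nF; exact/nB/e.
rewrite -openC; exists (~` [set p | forall f, Z f -> f p = 0]).
  by exists Z; [move=> f /rZ/polyfunP|rewrite setCK].
apply/seteqP; split=> y /=; first by move=> H Fy; apply: H; exact/HZ.
by move=> nF H; apply: nF; exact/HZ.
Qed.

Lemma regular_gv_act v (g : forall j, 'M[K]_(v j)) f :
  regular (coord v) f -> regular (coord v) (f \o gv_act g).
Proof.
move=> Hf; have P0 : pol (coord v) 0 (fun=> 1) by exact: pol_cst.
have [ix it] := ratn_rep_id P0.
apply: (@ratn1 _ _ _ 0); apply: ratn_rep_comp => //; split=> [a b k|a] /=.
  apply: ratn_mulmx => //; last exact: ratn_mx_cst.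
  by apply: ratn_mulmx => //; exact: ratn_mx_cst.
by apply: ratn_mulmx => //; exact: ratn_mx_cst.
Qed.

Lemma irreducible_unlift v (P : set (rep K A v d)) :
  irr (coord v) P -> P `<=` Lam v -> irreducible (unlift P).
Proof.
move=> iP lP; have [[p0 Pp0] _] := iP; split.
  by have [y e] := stable_rep_val (lP p0 Pp0); exists (pt y), y; rewrite ?e.
move=> F G /closedP[Z rZ HZ] /closedP[Z' rZ' HZ'] sub.
apply: contrapT => /not_orP[nF nG].
have wit (F0 : set (QV v)) (Z0 : set (rep K A v d -> K)) :
    (forall y, F0 (pt y) <-> forall f, Z0 f -> f (set_val y) = 0) ->
    ~ unlift P `<=` F0 -> exists f p, [/\ Z0 f, P p & f p != 0].
  move=> H0; rewrite -existsNP => -[x /not_implyP[[y Py <-]]].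
  rewrite H0 => /existsNP[f /not_implyP[Zf /eqP fy]].
  by exists f, (set_val y).
have [f [p [Zf Pp fp]]] := wit _ _ HZ nF.
have [g [q [Zg Pq gq]]] := wit _ _ HZ' nG.
have [r [Pr fr gr]] := irr_meet iP (rZ _ Zf) (rZ' _ Zg) Pp fp Pq gq.
have [y e] := stable_rep_val (lP r Pr).
have [|/HZ/(_ f Zf)|/HZ'/(_ g Zg)] := sub (pt y); first by exists y; rewrite ?e.
  by rewrite e => /eqP; rewrite (negbTE fr).
by rewrite e => /eqP; rewrite (negbTE gr).
Qed.

(** If [f] and [g] are each nonzero somewhere on an orbit, [orbit_meet] gives a point of that orbit
    where both are nonzero; irreducibility in the quotient provides such an orbit. *)
Lemma irr_lift v (S : set (QV v)) : irreducible S -> irr (coord v) (lift S).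
Proof.
move=> [[x0 Sx0] irS]; have [y0 e0] := pt_surj x0.
apply: irrI; first by exists (set_val y0); apply/liftP; rewrite e0.
(* The zero set of [f] need not be invariant; its largest invariant part is, and defines a closed
   set of the quotient. *)
pose V (f : rep K A v d -> K) : set (QV v) := [set x | forall y, pt y = x ->
  forall g : forall j, 'M[K]_(v j), (forall j, g j \in unitmx) -> f (gv_act g (set_val y)) = 0].
have cV f : regular (coord v) f -> closed (V f).
  move=> Hf; apply/closedP.
  exists [set h | exists2 g : forall j, 'M[K]_(v j), (forall j, g j \in unitmx) &
                   h = f \o gv_act g].
    by move=> _ [g _ ->]; exact: regular_gv_act.
  move=> y; split=> [Vy _ [g gu ->] /=|H y' /esym/pt_eqP[g gu ->] h hu].
    exact: Vy.
  rewrite gv_actM //; apply: (H (f \o gv_act (fun j => g j *m h j))).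
  by exists (fun j => g j *m h j) => // j; rewrite unitmx_mul gu hu.
have act1 (p : rep K A v d) : gv_act (fun=> 1%:M) p = p.
  by apply: eq_rep => *; rewrite /= invmx1 mul1mx ?mulmx1.
have nV f p : lift S p -> f p != 0 -> ~ S `<=` V f.
  move=> [y <- Sy] fp /(_ _ Sy) /(_ y erefl (fun=> 1%:M) (fun j => unitmx1 _ _)).
  by rewrite act1 => /eqP; rewrite (negbTE fp).
move=> f g p q Hf Hg /nV H1 fp /nV H2 gq.
have [x Sx nx] : exists2 x, S x & ~ (V f x \/ V g x).
  apply: contrapT => H; have [x Sx|/(H1 _ fp)//|/(H2 _ gq)//] := irS _ _ (cV f Hf) (cV g Hg).
  by apply: contrapT => nx; apply: H; exists x.
move/not_orP: nx => [/existsNP[y /not_implyP[yx]] /existsNP[a /not_implyP[au /eqP fa]]].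
move=> /existsNP[y' /not_implyP[y'x]] /existsNP[b /not_implyP[bu /eqP gb]].
have /pt_eqP[h hu y'E] : pt y = pt y' by rewrite yx.
rewrite y'E gv_actM // in gb.
have hbu j : h j *m b j \in unitmx by rewrite unitmx_mul hu bu.
have [g' [g'u fg gg]] := orbit_meet Hf Hg au hbu fa gb.
exists (gv_act g' (set_val y)); split => //; apply: lift_gstable => //.
by apply/liftP; rewrite yx.
Qed.

Lemma irreducible_component_lift v (S : set (QV v)) :
  irreducible_component S <-> component Om (lift S).
Proof.
split=> [[iS maxS]|[iS lS maxS]].
  split; [exact: irr_lift|exact: lift_lambda|move=> Y iY lY SY].
  have SU : S `<=` unlift Y.
    move=> x Sx; have [y yx] := pt_surj x; exists y => //.
    by apply: SY; apply/liftP; rewrite yx.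
  rewrite -(maxS _ (irreducible_unlift iY lY) SU); exact: sub_lift_unlift.
split; first by rewrite -[S]unlift_lift; exact: irreducible_unlift.
move=> Y iY SY; apply/seteqP; split=> //; apply: lift_sub; apply: maxS.
- exact: irr_lift.
- exact: lift_lambda.
- exact: lift_mono.
Qed.

(** The saturation of [P] under G_V is irreducible and contains [P], so it adds nothing. *)
Lemma component_gstable v (P : set (rep K A v d)) : component Om P -> lift (unlift P) = P.
Proof.
move=> [iP lP max]; apply/seteqP; split; last exact: sub_lift_unlift.
apply: max; [exact/irr_lift/irreducible_unlift|exact: lift_lambda|].
exact: sub_lift_unlift.
Qed.

(** The closure of an invariant set is invariant, hence the preimage of a closed set of the
    quotient. *)
Lemma lift_closure v (Q : set (rep K A v d)) : Q `<=` Lam v -> gstable Q ->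
  lift (closure (unlift Q)) = lcl Om Q.
Proof.
move=> lQ gQ; apply/seteqP; split=> [_ [y <- cy]|p [cp lp]].
  split; last exact: stable_rep_lambda.
  pose F : set (QV v) := unlift (lcl Om Q).
  have FE : lift F = lcl Om Q.
    apply: lift_unlift => [p []//|p g gu [cp lp]]; split; last exact: gv_act_lambda.
    move=> f Hf f0; apply: (cp (f \o gv_act g)); first exact: regular_gv_act.
    by move=> q Qq /=; apply: f0; exact: gQ.
  have cF : closed F.
    apply/closedP; exists [set f | regular (coord v) f /\ forall q, Q q -> f q = 0].
      by move=> f [].
    move=> z; rewrite -liftP FE; split=> [[cz _] f [Hf f0]|H]; first exact: cz.
    by split; [move=> f Hf f0; exact: H|exact: stable_rep_lambda].
  have QF : unlift Q `<=` F.
    by move=> x [z Qz <-]; exists z => //; exact: sub_lcl.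
  have /liftP : F (pt y) by have := closure_id F; move=> [/(_ cF) -> _]; exact: (closureS QF).
  by rewrite FE => -[].
have [y e] := stable_rep_val lp; exists y => //.
rewrite closureE => F [/closedP[Z rZ HZ] QF]; apply/HZ => f Zf; rewrite e.
apply: cp; first exact: rZ.
move=> q Qq; have [z ez] := stable_rep_val (lQ q Qq).
have /HZ/(_ f Zf) : F (pt z) by apply: QF; exists z; rewrite ?ez.
by rewrite ez.
Qed.

Definition gr v (P : set (rep K A v d)) : graded_subset Om d :=
  Tagged (fun v => set (QV v)) (unlift P).

Lemma gr_inj v (P P' : set (rep K A v d)) : component Om P -> component Om P' ->
  gr P = gr P' -> P = P'.
Proof.
move=> cP cP' /eqP; rewrite -(component_gstable cP) -(component_gstable cP').
move=> /eqP e; congr lift; move: e; rewrite /gr !unlift_lift => e.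
by have := eq_from_Tagged e.
Qed.

Lemma crystalP (X : graded_subset Om d) :
  crystal X <-> exists v (P : set (rep K A v d)), component Om P /\ X = gr P.
Proof.
split=> [|[v [P [cP ->]]]].
  case: X => v S /irreducible_component_lift cS; exists v, (lift S); split => //.
  by rewrite /gr unlift_lift.
by apply/irreducible_component_lift; rewrite component_gstable.
Qed.

Lemma eps_compP v (P : set (rep K A v d)) i c : component Om P ->
  eps_comp i (gr P) = c <-> generic_eps P i c.
Proof.
move=> cP; pose E := [set c | (exists2 y, unlift P y & eps_pt i y = c) /\
               forall y, unlift P y -> (c <= eps_pt i y)%N].
have EE c' : E c' <-> generic_eps P i c'.
  have UP y : unlift P (pt y) <-> P (set_val y) by rewrite -liftP component_gstable.
  split=> -[[x Px e] min]; split.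
  - have [y yx] := pt_surj x; exists (set_val y); first by apply/UP; rewrite yx.
    by rewrite -eps_ptE yx.
  - move=> p Pp; have [_ lP _] := cP; have [y ey] := stable_rep_val (lP p Pp).
    by rewrite -ey -eps_ptE; apply: min; apply/UP; rewrite ey.
  - have [_ lP _] := cP; have [y ey] := stable_rep_val (lP x Px).
    by exists (pt y); [apply/UP; rewrite ey|rewrite eps_ptE ey].
  - by move=> z [y Py <-]; rewrite eps_ptE; exact: min.
have uniq c1 c2 : generic_eps P i c1 -> generic_eps P i c2 -> c1 = c2.
  move=> [[p1 P1 e1] m1] [[p2 P2 e2] m2]; apply/eqP; rewrite eqn_leq.
  by rewrite -{1}e2 m1 // -e1 m2.
have [iP _ _] := cP; have [c0 gc0] := generic_eps_exists i iP.1.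
have gE : generic_eps P i (eps_comp i (gr P)).
  by apply/EE; apply: getPex; exists c0; exact/EE.
by split=> [<- //|]; exact: uniq.
Qed.

Lemma red_gstable v v' (P : set (rep K A v d)) i : gstable (Red i P v').
Proof. by move=> q g gu [p Pp R]; exists p => //; exact: restriction_orbit. Qed.

Lemma etilde_gr v (P : set (rep K A v d)) i c : component Om P -> generic_eps P i c ->
  etilde_max i (gr P) = gr (lcl Om (Red i P (lower v i c))).
Proof.
move=> cP gc; rewrite /etilde_max; rewrite ((eps_compP i c cP).2 gc).
have [iP lP _] := cP; have [_ lR] := generic_red iP lP gc.
congr existT; apply: lift_inj; rewrite -/(lower v i c).
have [cR _] := component_red cP gc.
rewrite (component_gstable cR) -(lift_closure lR (@red_gstable _ _ _ _)).
congr (lift (closure _)); apply/seteqP; split=> [_ [q [p [Pp e R]] <-]|_ [q [p Pp R] <-]].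
  by exists q => //; exists (set_val p) => //; rewrite -(component_gstable cP); apply/liftP.
have [y ey] := stable_rep_val (lP p Pp); exists q => //; exists y; split.
- by apply/liftP; rewrite ey component_gstable.
- by rewrite ey (restriction_eps Om R) lower_at subKn // (generic_le gc).
- by rewrite ey.
Qed.

End Bridge.

(** * Subrepresentations of a fixed point *)

Section Subrepresentations.
Context {K : numFieldType} {n : nat} {A : sym_gcm n} (Om : orientation A).
Context {d : {ffun 'I_n -> nat}}.
Implicit Types v w : {ffun 'I_n -> nat}.
Local Notation coord v := (@coords K n A d v).

(** The kernel of a morphism is a subspace excluded by stability, so for stable [p] being a
    subrepresentation amounts to the existence of a morphism. *)
Lemma stable_morphism_inj v w (p : rep K A v d) (M : rep K A w d) phi :
  stable p -> is_morphism p M phi -> forall j, row_free (phi j).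
Proof.
move=> st [ex et] j; rewrite -kermx_eq0; apply/eqP.
apply: (st (fun j => kermx (phi j))) => [a b k|a].
  by apply/sub_kermxP; rewrite -mulmxA ex mulmxA mulmx_ker mul0mx.
by rewrite et mulmxA mulmx_ker mul0mx.
Qed.

Lemma linear_delta m (L : 'rV[K]_m -> K) :
  (forall a x y, L (a *: x + y) = a * L x + L y) ->
  forall x, L x = \sum_s x 0 s * L (delta_mx 0 s).
Proof.
move=> lin x.
have L0 : L 0 = 0.
  by have := lin (-1) 0 0; rewrite scaler0 addr0 mulN1r addNr.
rewrite {1}[x]row_sum_delta; elim: (index_enum _) => [|s r IH].
  by rewrite !big_nil.
by rewrite !big_cons lin IH.
Qed.

Section LinearSystem.
Context v w (M : rep K A w d).

Definition unknowns : finType := {j : 'I_n & ('I_(v j) * 'I_(w j))%type}.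
Definition equations : finType :=
  ({ab : 'I_n * 'I_n & (dart A ab.1 ab.2 * 'I_(v ab.1) * 'I_(w ab.2))%type} +
   {a : 'I_n & ('I_(v a) * 'I_(d a))%type})%type.

Definition eqn_x a b (k : dart A a b) (s : 'I_(v a)) (t : 'I_(w b)) : equations :=
  inl (existT (fun ab : 'I_n * 'I_n =>
    (dart A ab.1 ab.2 * 'I_(v ab.1) * 'I_(w ab.2))%type : Type) (a, b) (k, s, t)).

Definition eqn_t a (s : 'I_(v a)) (t : 'I_(d a)) : equations :=
  inr (existT (fun a => ('I_(v a) * 'I_(d a))%type : Type) a (s, t)).

Definition sys_phi (x : 'rV[K]_#|unknowns|) j : 'M[K]_(v j, w j) :=
  \matrix_(a, b) x 0 (enum_rank
    (Tagged (fun j => ('I_(v j) * 'I_(w j))%type) (a, b) : unknowns)).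

Definition sys_lhs (p : rep K A v d) x (e : equations) : K :=
  match e with
  | inl t => let: (k, a, b) := tagged t in
      (rep_x p k *m sys_phi x (tag t).2 - sys_phi x (tag t).1 *m rep_x M k) a b
  | inr t => (sys_phi x (tag t) *m rep_t M (tag t)) (tagged t).1 (tagged t).2
  end.

Definition sys_rhs (p : rep K A v d) (e : equations) : K :=
  match e with
  | inl _ => 0
  | inr t => rep_t p (tag t) (tagged t).1 (tagged t).2
  end.

(** The conditions on a morphism to [M] are affine in its entries, with coefficients polynomial in
    [p]; rows correspond to unknowns and columns to equations. *)
Definition sys_mx p : 'M[K]_(#|unknowns|, #|equations|) :=
  \matrix_(s, e) sys_lhs p (delta_mx 0 s) (enum_val e).

Definition sys_row p : 'rV[K]_#|equations| := \row_e sys_rhs p (enum_val e).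

Lemma sys_phi_lin a x y j : sys_phi (a *: x + y) j = a *: sys_phi x j + sys_phi y j.
Proof. by apply/matrixP => s t; rewrite !mxE. Qed.

Lemma sys_mul p x e : (x *m sys_mx p) 0 e = sys_lhs p x (enum_val e).
Proof.
rewrite mxE (linear_delta (L := fun x => sys_lhs p x (enum_val e))).
  by apply: eq_bigr => s _; rewrite !mxE.
move=> c y z; case: (enum_val e) => [[[a b] [[k s] t]]|[a [s t]]] /=.
  rewrite !sys_phi_lin mulmxDr mulmxDl -scalemxAl -scalemxAr opprD addrACA -scalerBr.
  by rewrite !mxE.
by rewrite sys_phi_lin mulmxDl -scalemxAl !mxE.
Qed.

Lemma sys_morphism p x : is_morphism p M (sys_phi x) <-> x *m sys_mx p = sys_row p.
Proof.
split=> [[ex et]|H].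
  apply/rowP => e; rewrite sys_mul [RHS]mxE.
  case: (enum_val e) => [[[a b] [[k s] t]]|[a [s t]]] /=; last by rewrite -et.
  by rewrite ex subrr mxE.
have E e : sys_lhs p x e = sys_rhs p e.
  by have /rowP/(_ (enum_rank e)) := H; rewrite sys_mul [in RHS]mxE enum_rankK.
split=> [a b k|a]; apply/matrixP => s t.
  have /= := E (eqn_x k s t).
  by rewrite [LHS]mxE [X in _ + X]mxE => /eqP; rewrite subr_eq0 => /eqP.
by have /= := E (eqn_t s t).
Qed.

Lemma sys_onto phi : exists x, sys_phi x = phi.
Proof.
exists (\row_s let: existT j ab := enum_val s in phi j ab.1 ab.2).
by apply: functional_extensionality_dep => j; apply/matrixP => a b; rewrite !mxE enum_rankK.
Qed.

(** The image of a solution of the homogeneous system is a stable subspace of [M] killed by t, hence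
    zero. *)
Lemma sys_free p : stable M -> row_free (sys_mx p).
Proof.
move=> st; rewrite -kermx_eq0; apply/eqP/row_matrixP => k; rewrite row0.
set x := row k _.
have x0 : x *m sys_mx p = 0 by apply/sub_kermxP; exact: row_sub.
have E e : sys_lhs p x e = 0.
  by have /rowP/(_ (enum_rank e)) := x0; rewrite sys_mul [in RHS]mxE enum_rankK.
have phi0 j : <<sys_phi x j>>%MS = 0.
  apply: (st (fun j => <<sys_phi x j>>%MS)) => [a b l|a].
    rewrite (eqmxMr _ (genmxE _)) genmxE.
    suff -> : sys_phi x a *m rep_x M l = rep_x p l *m sys_phi x b by exact: submxMl.
    apply/esym/matrixP => s t.
    have /= := E (eqn_x l s t).
    by rewrite [LHS]mxE [X in _ + X]mxE => /eqP; rewrite subr_eq0 => /eqP.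
  apply/sub_kermxP; rewrite genmxE; apply/sub_kermxP; apply/matrixP => s t.
  have /= -> := E (eqn_t s t).
  by rewrite mxE.
apply/rowP => s; rewrite [RHS]mxE -(enum_valK s).
case: (enum_val s) => j [a b].
have /eqP := phi0 j; rewrite genmx_eq0 => /eqP/matrixP/(_ a b).
by rewrite mxE [RHS]mxE.
Qed.

Lemma regular_sys_mx : regular_mx (coord v) sys_mx.
Proof.
apply: regular_rep_mx => -[ix it] s e.
have P0 : pol (coord v) 0 (fun=> 1) by exact: pol_cst.
apply: (ratn_eq (h := fun p => sys_lhs p (delta_mx 0 s) (enum_val e))).
  by move=> p _; rewrite mxE.
case: (enum_val e) => [[[a b] [[k y] z]]|[a [y z]]] /=.
  apply: (ratn_addmx P0 (M := fun p => rep_x p k *m sys_phi (delta_mx 0 s) b)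
     (N := fun p => - (sys_phi (delta_mx 0 s) a *m rep_x M k))).
    by apply: ratn_mulmx => //; exact: ratn_mx_cst.
  exact: ratn_mx_cst.
by apply: ratn_regular => //; exact: regular_cst.
Qed.

Lemma regular_sys_row : regular_mx (coord v) sys_row.
Proof.
apply: regular_rep_mx => -[ix it] s e.
have P0 : pol (coord v) 0 (fun=> 1) by exact: pol_cst.
apply: (ratn_eq (h := fun p => sys_rhs p (enum_val e))); first by move=> p _; rewrite mxE.
case: (enum_val e) => [t|[a [y z]]] /=; last exact: it.
by apply: ratn_regular => //; exact: regular_cst.
Qed.

End LinearSystem.

(* By stability a morphism to [M] is unique if it exists, so that its existence
   is a rank condition on a linear system with columns of constant rank. *)
Lemma subrep_zcl v w (M : rep K A w d) (P : set (rep K A v d)) :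
  stable M -> (forall p, P p -> is_subrep p M) ->
  forall p, zcl (coord v) P p -> stable p -> is_subrep p M.
Proof.
move=> st HP p cp stp.
suff /submxP[x xE] : (sys_row w p <= sys_mx (v := v) M p)%MS.
  have m : is_morphism p M (sys_phi x) by apply/sys_morphism.
  by exists (sys_phi x) => //; exact: stable_morphism_inj m.
apply: contrapT => /negP nsub.
(* Without a solution at [p], the rows remain independent once the right-hand side is added. This is
   an open condition, so it holds at some point of [P], where the existing solution is a relation
   between these rows. *)
have free : row_free (col_mx (sys_mx M p) (sys_row w p)).
  have fr := sys_free p st.
  have lt : (\rank (sys_mx M p) < \rank (sys_mx M p + sys_row w p)%MS)%N.
    by rewrite ltn_neqAle (mxrank_leqif_sup (addsmxSl _ _)) addsmx_sub submx_refl
      nsub mxrankS // addsmxSl.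
  rewrite /row_free -addsmxE eqn_leq; apply/andP; split.
    by rewrite addsmxE rank_leq_row.
  by rewrite addn1 -[X in (X < _)%N](eqP fr).
have /row_freeP[R RE] := free.
pose F p := \det (col_mx (sys_mx (v := v) M p) (sys_row w p) *m R).
have HF : regular (coord v) F.
  apply: regular_det; apply: regular_mulmx; last exact: regular_mx_cst.
  move=> s t; case: (split_ordP s) => s' ->.
    apply: regular_eq (regular_sys_mx M s' t) => q; by rewrite col_mxEu.
  apply: regular_eq (@regular_sys_row _ w s' t) => q; by rewrite col_mxEd.
have Fp : F p != 0 by rewrite /F RE det1 oner_eq0.
have [q Pq Fq] := zcl_meet cp HF Fp.
have [phi mq _] := HP q Pq; have [x xE] := sys_onto phi.
have E : row_mx x (- 1%:M) *m col_mx (sys_mx M q) (sys_row w q) = 0.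
  rewrite mul_row_col mulNmx mul1mx; have /sys_morphism -> : is_morphism q M (sys_phi x) by rewrite xE.
  by rewrite subrr.
have u : col_mx (sys_mx M q) (sys_row w q) *m R \in unitmx by rewrite unitmxE unitfE.
have : row_mx x (- 1%:M) = 0 by rewrite -[LHS](mulmxK u) mulmxA E !mul0mx.
rewrite -[0]row_mx0 => /eq_row_mx[_ /matrixP/(_ 0 0)]; rewrite !mxE eqxx.
by move/eqP; rewrite oppr_eq0 oner_eq0.
Qed.

(** A morphism carries the incoming image at [i] into the incoming image at [i], hence restricts. *)
Lemma restriction_sub_subrep v v' w w' i (p : rep K A v d) (q : rep K A v' d)
    (M : rep K A w d) (M' : rep K A w' d) :
  is_restriction i p q -> is_subrep p M -> is_restriction i M M' -> is_subrep q M'.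
Proof.
move=> [f [fx ft] Hf] [phi [px pt'] Hphi] [f' [f'x f't] Hf'].
have sub j : (f j *m phi j <= f' j)%MS.
  have [_ ->] := Hf' j; have [_ e] := Hf j; move: e.
  case: eqP => [-> e|_ _]; last exact: submx1.
  rewrite (eqmxMr _ e) (eqmxMr _ (eqmx_sym (bm_incoming Om p i))) bmat_mul bmat_span.
  apply/sumsmx_subP => b _; apply/sumsmx_subP => k _; rewrite genmxE px.
  by rewrite (sumsmx_sup b) // (sumsmx_sup k) // genmxE submxMl.
pose chi j := f j *m phi j *m pinvmx (f' j).
have chiE j : chi j *m f' j = f j *m phi j by apply: mulmxKpV.
exists chi.
  split=> [a b k|a]; last by rewrite f't mulmxA chiE ft pt' mulmxA.
  apply: (row_free_inj (Hf' b).1).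
  rewrite -(mulmxA (chi a)) f'x -(mulmxA (rep_x q k)) chiE !mulmxA chiE fx.
  by rewrite -!mulmxA px.
move=> j; rewrite /row_free eqn_leq rank_leq_row /=.
have e : \rank (f j *m phi j) = v' j by rewrite mxrankMfree //; exact/eqP/(Hf j).1.
by rewrite -{1}e -chiE mxrankM_maxl.
Qed.

(* [M] is the largest extension of [M'] at [i], so it absorbs any extension of a
   subrepresentation of [M']. *)
Lemma extension_subrep v v' w w' i (p : rep K A v d) (q : rep K A v' d)
    (M : rep K A w d) (M' : rep K A w' d) :
  lambda_st Om p -> lambda_st Om M -> is_restriction i p q -> is_subrep q M' ->
  is_restriction i M M' -> (w i + w' i = hdim (d := d) (A := A) w i)%N ->
  is_subrep p M.
Proof.
move=> lp lM R [phi0 [p0x p0t] _] R' wi.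
have [f [r [g [s [_ [sp [fx ft] fi _]]]]]] := restriction_chart Om R.
have [off _] := restriction_dims Om R.
have [f' [f'x f't] Hf'] := R'; have [_ w'i] := restriction_dims Om R'.
have [_ pre fr] := (lambdaP Om M).1 lM.
have [_ prep _] := (lambdaP Om p).1 lp.
pose psi j := r j *m phi0 j *m f' j.
have fpsi j : f j *m psi j = phi0 j *m f' j.
  by have [e _ _ _ _] := sp j; rewrite !mulmxA e mul1mx.
have xE a b (k : dart A a b) : a != i -> rep_x p k = r a *m rep_x q k *m f b.
  by move=> ai; rewrite -mulmxA fx mulmxA (split_off sp off) // mul1mx.
have psiM a b (k : dart A a b) : psi a *m rep_x M k = r a *m rep_x q k *m phi0 b *m f' b.
  by rewrite -!mulmxA -f'x !mulmxA -[_ *m phi0 a *m _]mulmxA -p0x !mulmxA.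
have xpsi a b (k : dart A a b) : a != i -> rep_x p k *m psi b = psi a *m rep_x M k.
  by move=> ai; rewrite xE // psiM -mulmxA fpsi !mulmxA.
have tpsi a : a != i -> rep_t p a = psi a *m rep_t M a.
  move=> ai; rewrite -[LHS]mul1mx -(split_off sp off ai) -mulmxA -ft p0t f't.
  by rewrite !mulmxA.
clearbody psi.
(* [W] collects what the maps out of [i] must be: the component [phii] at [i] has to satisfy W =
   phii amat. *)
pose W := flat (fun b (k : dart A i b) => rep_x p k *m psi b) (rep_t p i).
have W0 : W *m bm Om M i = 0.
  rewrite mul_bmat -[RHS](mul0mx _ (psi i)) -(prep i) mul_bmat mulmx_suml.
  apply: eq_bigr => b _; rewrite mulmx_suml; apply: eq_bigr => k _.
  rewrite !flatKx -scalemxAl -!mulmxA -xpsi //; exact: dart_neq k.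
(* The equation for [w i] says that the complex of [M] at [i] is exact in the middle, so the kernel
   of [bm] is the image of [amat]. *)
have /submxP[phii phiiE] : (W <= amat M i)%MS.
  have aK : (amat M i <= kermx (bm Om M i))%MS by apply/sub_kermxP.
  apply: (@submx_trans _ _ _ _ _ _ (kermx (bm Om M i))); first by apply/sub_kermxP.
  rewrite -(geq_leqif (mxrank_leqif_sup aK)) mxrank_ker (eqP (fr i)) -w'i -wi.
  by rewrite addnK.
pose phi := eqtype.dfwith (T := fun j => 'M[K]_(v j, w j)) psi (i := i) phii.
have phiI : phi i = phii by rewrite /phi eqtype.dfwith_in.
have phiO j : j != i -> phi j = psi j by move=> ji; rewrite /phi eqtype.dfwith_out // eq_sym.
have outx b (k : dart A i b) : rep_x p k *m psi b = phii *m rep_x M k.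
  have := congr1 (fun Y => unflatx Y k) phiiE.
  by rewrite /W flatKx flat_mul flatKx.
have outt : rep_t p i = phii *m rep_t M i.
  by have := congr1 (@unflatt _ _ _ _ _ _ _) phiiE; rewrite /W flatKt flat_mul flatKt.
have m : is_morphism p M phi.
  split=> [a b k|a]; last first.
    by have [->|ai] := eqVneq a i; rewrite ?phiI // phiO // tpsi.
  have [ai|ai] := eqVneq a i.
    subst a; have bi : b != i by rewrite eq_sym; exact: dart_neq k.
    by rewrite phiI phiO.
  rewrite (phiO a) //; have [bi|bi] := eqVneq b i; last by rewrite phiO // xpsi.
  (* For arrows into [i], equality is checked after the injective map [amat M i], that is, after one
     more arrow out of [i] or after t. *)
  subst b; rewrite phiI; apply: (row_free_inj (fr i)).
  rewrite -mulmxA -phiiE !flat_mul; apply: flat_inj => [c l|].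
    rewrite !flatKx -!mulmxA (mulmxA (psi a)) psiM xE // -!mulmxA; congr (_ *m (_ *m _)).
    rewrite (mulmxA (f i)) -fx -!mulmxA fpsi.
    by rewrite -(f'x _ _ l) (mulmxA (rep_x q l)) p0x !mulmxA.
  rewrite !flatKt psiM xE // -!mulmxA; congr (_ *m (_ *m _)).
  by rewrite -ft -f't p0t.
have [_ _ stp] := lp; exists phi => //; exact: stable_morphism_inj m.
Qed.

End Subrepresentations.

(** * Weights of the quiver varieties *)

Section Weights.
Context {K : numFieldType} {n : nat} {A : sym_gcm n} (h : realization K A).
Context (omega : 'I_n -> 'Hom(h, K^o)) (Homega : is_fundamental_weights omega).
Context (Om : orientation A) {d : {ffun 'I_n -> nat}}.
Implicit Types v : {ffun 'I_n -> nat}.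
Local Notation hd v := (@hdim n A d v).
Local Notation r := (@simple_reflection K n A h).
Local Notation word := (@word_reflection K n A h).
Local Notation al := (simple_root h).
Local Notation lam := (weight_of omega d).
Local Notation wt v := (lam - root_of h v).

(** The pairing with the coroot is the Euler characteristic of the complex at [i]. *)
Lemma pairing_weight v i :
  (wt v : 'Hom(h, K^o)) (simple_coroot h i) = (hd v i)%:R - (v i)%:R *+ 2 :> K.
Proof.
rewrite add_lfunE opp_lfunE /weight_of /root_of !sum_lfunE.
have -> : \sum_j (omega j *+ d j) (simple_coroot h i) = (d i)%:R :> K.
  rewrite (bigD1 i) //= big1 => [|j ji]; rewrite -scaler_nat scale_lfunE Homega.
    by rewrite addr0 eqxx /GRing.scale /= mulr1.
  by rewrite eq_sym (negbTE ji) scaler0.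
have -> : \sum_j (al j *+ v j) (simple_coroot h i) =
    (v i)%:R *+ 2 - (\sum_b edge_mult A i b * v b)%:R :> K.
  have eii : edge_mult A i i = 0%N by rewrite /edge_mult eqxx.
  rewrite (bigD1 i) //= [in RHS](bigD1 i) //= eii mul0n add0n.
  rewrite -scaler_nat scale_lfunE simple_pairing gcm_diag natr_sum -sumrN.
  congr (_ + _); first by rewrite /GRing.scale /= mulr_natr.
  apply: eq_bigr => j ji; rewrite -scaler_nat scale_lfunE simple_pairing.
  rewrite /edge_mult eq_sym (negbTE ji) natrM /GRing.scale /= mulrC -mulNr.
  have /gcm_offdiag le : i != j by rewrite eq_sym.
  by rewrite -[A i j in LHS]opprK -(ler0_norm (le A)) mulrNz natr_absz.
rewrite hdimE natrD.
have key (x y z : K) : x - (y - z) = x + z - y by ring.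
exact: key.
Qed.

Lemma root_of_off v v' i : (forall j, j != i -> v' j = v j) ->
  root_of h v' = root_of h v + ((v' i)%:R - (v i)%:R : K) *: al i.
Proof.
move=> off; rewrite /root_of (bigD1 i) //= [in RHS](bigD1 i) //=.
rewrite (eq_bigr (fun j => al j *+ v j)) => [|j /off -> //].
rewrite scalerBl !scaler_nat addrAC [X in _ = X + _]addrCA subrr addr0.
by [].
Qed.

Lemma refl_weight v v' i : (forall j, j != i -> v' j = v j) ->
  (v i + v' i)%N = hd v i -> r i (wt v) = wt v'.
Proof.
move=> off e; have key (x y : K) : x + y - x *+ 2 = y - x by ring.
have /(congr1 (fun c : K => wt v - c *: al i)) := key (v i)%:R (v' i)%:R.
by rewrite -natrD e -pairing_weight -reflE => ->; rewrite (root_of_off off) opprD addrA.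
Qed.

Definition support v := exists p : rep K A v d, lambda_st Om p.

(** Restriction at [i] leaves a space of dimension rank(bm), which can be extended again to any
    dimension between rank(bm) and hdim - rank(bm). As rank(bm) <= v i, the dimension hdim - v i is
    among them. *)
Lemma support_refl v i : support v ->
  exists v', [/\ support v', forall j, j != i -> v' j = v j & (v i + v' i)%N = hd v i].
Proof.
move=> [p lp]; pose v' : {ffun 'I_n -> nat} := [ffun j => if j == i then hd v i - v i else v j]%N.
have off j : j != i -> v' j = v j by move=> /negbTE ji; rewrite ffunE ji.
have v'i : v' i = (hd v i - v i)%N by rewrite ffunE eqxx.
have le := lambda_rank i lp.
have [q R] := restriction_exists Om (p := p) (@lower_off n v i (eps i p)) (lower_at v i _).
have lq := restriction_lambda R lp.
have q0 : eps i q = 0%N := restriction_eps0 Om R.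
have li : lower v i (eps i p) i = \rank (bm Om p i) by have [_ ->] := restriction_dims Om R.
have leb : (\rank (bm Om p i) <= v i)%N by rewrite rank_leq_col.
exists v'; split=> //; last by rewrite v'i subnKC //; move: le; lia.
have [|||p' lp' _] := @extension_exists K n A Om d v' (lower v i (eps i p)) i q lq q0; last by exists p'.
  by move=> j ji; rewrite lower_off // off.
  by rewrite li v'i; move: le; lia.
  by rewrite (hdim_off (@lower_off n v i (eps i p))) li v'i; move: le leb; lia.
Qed.

Lemma support_word s v : support v -> exists2 v', support v' & wt v' = word s (wt v).
Proof.
move=> sv; elim: s => [|i s [u su e]]; first by exists v.
have [u' [su' off eu]] := support_refl i su; exists u' => //=.
by rewrite -e (refl_weight off eu).
Qed.

(** The defect [x] of exactness at [i] gives wt v' = s lam + x alpha_i. Applying the inverse of s,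
    lam + x s^-1 alpha_i is again the weight of a nonempty variety, so x s^-1 alpha_i is minus a
    nonnegative combination of simple roots. As [i :: s] is reduced it is also a nonnegative one,
    and x = 0. *)
Lemma reduced_restriction i s v (M : rep K A v d) :
  reduced h (i :: s) -> wt v = word (i :: s) lam -> lambda_st Om M ->
  exists v' (M' : rep K A v' d), [/\ lambda_st Om M', is_restriction i M M',
    wt v' = word s lam & (v i + v' i)%N = hd v i].
Proof.
move=> red ev lM; pose v' := lower v i (eps i M).
have off := @lower_off n v i (eps i M); rewrite -/v' in off.
have [M' RM] := restriction_exists Om (p := M) off (lower_at v i _).
have lM' := restriction_lambda RM lM.
have le : (v i + v' i <= hd v i)%N.
  by have [_ ->] := restriction_dims Om RM; exact: lambda_rank.
pose x := (hd v i - (v i + v' i))%N.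
(* The reflected dimension vector: its value at [i] is hdim - v i. *)
pose v2 : {ffun 'I_n -> nat} := [ffun j => v' j + (j == i) * x]%N.
have v2i : v2 i = (v' i + x)%N by rewrite ffunE eqxx mul1n.
have off2 j : j != i -> v2 j = v' j by move=> /negbTE ji; rewrite ffunE ji addn0.
have e2 : wt v2 = word s lam.
  have : r i (wt v) = wt v2.
    apply: refl_weight => [j ji|]; first by rewrite off2 // off.
    by rewrite v2i addnA subnKC.
  by rewrite ev /= reflK.
have e' : wt v' = word s lam + al i *+ x.
  rewrite -e2 (root_of_off off2) v2i natrD [_ + x%:R]addrC addrK scaler_nat.
  by rewrite opprD addrA subrK.
suff x0 : x = 0%N.
  exists v', M'; split=> //; first by rewrite e' x0 mulr0n addr0.
  by apply/eqP; rewrite eqn_leq le -subn_eq0 -/x x0.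
have [|v3 _] := @support_word (rev s) v'; first by exists M'.
rewrite e' wordD wordMn word_revK => /addrI e3.
have nb := reduced_cons_nonneg red.
have b0 : word (rev s) (al i) *+ x = 0.
  apply: nonneg_root_opp; first exact: nonneg_rootMn.
  by rewrite -e3 opprK; exists v3.
apply: contrapT => /eqP x0.
have : x%:R *: word (rev s) (al i) == 0 by rewrite scaler_nat b0.
rewrite scaler_eq0 pnatr_eq0 (negbTE x0) /= => /eqP b.
have ai0 : al i = 0.
  by rewrite -(word_Krev s (al i)) b -[X in word s X](mulr0n 0) wordMn mulr0n.
have /(_ _ i)/eqP := @simple_root_free_sum K n A h (fun j => (j == i)%:R).
rewrite eqxx oner_eq0 => H; apply: notF; apply: H; rewrite big1 // => j _.
by case: eqP => [->|_]; rewrite ?ai0 ?scaler0 ?scale0r.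
Qed.

End Weights.

(** * Demazure crystals *)

Section Chain.
Context {K : numFieldType} {n : nat} {A : sym_gcm n} (Om : orientation A).
Context {d : {ffun 'I_n -> nat}}.
Implicit Types (v : {ffun 'I_n -> nat}) (X Y : @graded_subset K n A Om d).

Lemma lower_inj i c v v' : (c <= v i)%N -> (c <= v' i)%N ->
  lower v i c = lower v' i c -> v = v'.
Proof.
move=> le le' e; apply/ffunP => j; have /ffunP/(_ j) := e.
have [->|ji] := eqVneq j i; last by rewrite !lower_off.
by rewrite !lower_at => E; rewrite -(subnK le) E subnK.
Qed.

Lemma etilde_crystal i X : crystal X ->
  crystal (etilde_max i X) /\ eps_comp i (etilde_max i X) = 0%N.
Proof.
move=> /crystalP[v [P [cP ->]]]; have [iP _ _] := cP.
have [c gc] := generic_eps_exists i iP.1.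
have [cR gR] := component_red cP gc; rewrite (etilde_gr cP gc); split.
  by apply/crystalP; exists (lower v i c), (lcl Om (Red i P (lower v i c))).
exact/(eps_compP i 0%N cR).
Qed.

Lemma etilde_inj i X Y : crystal X -> crystal Y -> eps_comp i X = eps_comp i Y ->
  etilde_max i X = etilde_max i Y -> X = Y.
Proof.
move=> /crystalP[v [P [cP ->]]] /crystalP[v' [P' [cP' ->]]] e.
have gc := (eps_compP i _ cP).1 e; have gc' := (eps_compP i _ cP').1 erefl.
move: gc gc'; move: (eps_comp i (gr Om P')) => c gc gc'.
rewrite (etilde_gr cP gc) (etilde_gr cP' gc') => eR.
have /(lower_inj (generic_le gc) (generic_le gc')) ev := congr1 (@tag _ _) eR.
subst v'; congr gr.
have [[cR _] [cR' _]] := (component_red cP gc, component_red cP' gc').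
exact: component_red_inj cP cP' gc gc' erefl (gr_inj cR cR' eR).
Qed.

(** [etilde_inj] leaves at most one element for [xget] to choose. *)
Lemma ftilde_powP i c X Y : ftilde_pow i c Y = Some X <->
  [/\ crystal X, eps_comp i X = c & etilde_max i X = Y].
Proof.
rewrite /ftilde_pow; set S := [set Some Z | Z in _].
split=> [e|H].
  have [[_ [Z HZ _]]|nS] := pselect (exists x, S x).
    have : S (xget None S) by apply: xgetPex; exists (Some Z), Z.
    by rewrite e => -[Z' HZ' [<-]].
  by move: e; rewrite xgetPN // => x Sx; apply: nS; exists x.
have SX : S (Some X) by exists X.
have [Z [cZ eZ tZ] <-] : S (xget None S) by apply: xgetPex; exists (Some X).
have [cX eX tX] := H; congr Some; apply: (@etilde_inj i) => //; first by rewrite eX.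
by rewrite tX.
Qed.

Lemma is_restriction_id v i (p : rep K A v d) : eps i p = 0%N -> is_restriction i p p.
Proof.
move=> e; exists (fun=> 1%:M); first by split=> *; rewrite ?mulmx1 mul1mx.
move=> j; split; first by rewrite row_free_unit unitmx1.
case: eqP => // ->; apply/eqmxP; rewrite submx1 andbT sub1mx /row_full eqn_leq rank_leq_row.
by rewrite -subn_eq0; apply/eqP.
Qed.

Lemma etilde_id i X : crystal X -> eps_comp i X = 0%N -> etilde_max i X = X.
Proof.
move=> /crystalP[v [P [cP ->]]] /(eps_compP i _ cP) g0; rewrite (etilde_gr cP g0).
have [iP lP _] := cP; have := generic_red iP lP g0.
have -> : lower v i 0 = v by apply/ffunP => j; rewrite ffunE mul0n subn0.
move=> [iR lR]; congr gr; apply: component_sub => //.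
have [_ sub] := generic_dense Om iP g0; move=> p /sub; apply: zcl_sub.
by move=> q [Pq eq0]; apply: sub_zcl; exists q => //; exact: is_restriction_id.
Qed.

(** The inequality allowing an extension holds for the dimension of [X], hence for every smaller
    one: the string has no gap between its bottom and [X]. *)
Lemma etilde_string i X k : crystal X -> (k <= eps_comp i X)%N ->
  exists Z, ftilde_pow i k (etilde_max i X) = Some Z.
Proof.
move=> /crystalP[v [P [cP ->]]]; set c := eps_comp i _ => le.
have gc : generic_eps P i c by exact/(eps_compP i _ cP).
rewrite (etilde_gr cP gc); have [cQ gQ] := component_red cP gc.
have := component_hdim cP gc; have cv := generic_le gc.
pose v' := lower v i c; rewrite -/v' in cQ gQ *.
have v'i : v' i = (v i - c)%N by rewrite lower_at.
set Q := lcl Om _ in cQ gQ * => leh.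
pose u : {ffun 'I_n -> nat} := [ffun j => v' j + (j == i) * k]%N.
have ui : u i = (v' i + k)%N by rewrite ffunE eqxx mul1n.
have off j : j != i -> v' j = u j by move=> /negbTE ji; rewrite [RHS]ffunE ji addn0.
have ev' : lower u i k = v'.
  apply/ffunP => j; have [->|ji] := eqVneq j i; first by rewrite lower_at ui addnK.
  by rewrite lower_off // off.
have [||cU gU eU] := component_ext cQ gQ off; first by rewrite ui leq_addr.
  by rewrite ui; move: leh v'i le cv; lia.
move: gU; rewrite ui addKn => gU.
exists (gr Om (lcl Om (Ext Om i [set q | Q q /\ eps i q = 0%N] u))).
apply/ftilde_powP; split; last by rewrite (etilde_gr cU gU) ev' eU.
  by apply/crystalP; eexists; eexists; split; first exact: cU.
exact/(eps_compP i _ cU).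
Qed.

Lemma iter_ftilde_etilde i X : crystal X ->
  iter (eps_comp i X) (obind (ftilde i)) (Some (etilde_max i X)) = Some X.
Proof.
move=> cX; have [cY eY] := etilde_crystal i cX.
suff H k : (k <= eps_comp i X)%N ->
    iter k (obind (ftilde i)) (Some (etilde_max i X)) = ftilde_pow i k (etilde_max i X).
  by rewrite H //; apply/ftilde_powP.
elim: k => [_|k IH le] /=.
  by apply/esym/ftilde_powP; split=> //; exact: etilde_id.
have [Z eZ] := etilde_string cX (ltnW le).
rewrite IH ?(ltnW le) // eZ /= /ftilde.
by have /ftilde_powP[_ -> ->] := eZ.
Qed.

Lemma iter_ftilde_crystal i m X Y : crystal Y ->
  iter m (obind (ftilde i)) (Some Y) = Some X ->
  crystal X /\ etilde_max i X = etilde_max i Y.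
Proof.
move=> cY; elim: m X => [X [<-] //|m IH X] /=.
case e: (iter _ _ _) => [Z|//] /=; have [_ <-] := IH _ e.
by move=> /ftilde_powP[].
Qed.

Lemma demazure_cons i s X : demazure_crystal (i :: s) X <->
  exists2 Y, demazure_crystal s Y & exists m, iter m (obind (ftilde i)) (Some Y) = Some X.
Proof.
split=> [[[|m ms] // [ems]]|[Y [ms ems eY] [m e]]].
  rewrite /ftilde_monomial /=.
  case e: (foldr _ _ _) => [Y|] eX; last first.
    suff N : iter m (obind (ftilde i)) (@None (@graded_subset K n A Om d)) = None.
      by rewrite N in eX.
    by elim: (m) => //= k ->.
  by exists Y; [exists ms|exists m].
exists (m :: ms); first by rewrite /= ems.
by rewrite -e -eY.
Qed.

Lemma rep0_eq v (p q : rep K A v d) : v = [ffun=> 0%N] -> p = q.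
Proof. by move=> v0; apply: eq_rep => *; apply: mx_dim0; rewrite v0 ffunE. Qed.

Lemma component0 : component Om [set: rep K A [ffun=> 0%N] d].
Proof.
pose z : rep K A [ffun=> 0%N] d := Rep (fun _ _ _ => 0) (fun _ => 0).
split=> // [|p _].
  apply: irrI; first by exists z.
  by move=> f g p q _ _ _ fp _ gq; exists p; split=> //; rewrite (rep0_eq p q).
split; first by exists 1%N => // *; apply: mx_dim0; rewrite ffunE.
  by move=> i; apply: mx_dim0; rewrite ffunE.
by move=> S _ _ i; apply: mx_dim0; rewrite ffunE.
Qed.

Lemma crystal_topE : crystal_top Om d = gr Om [set: rep K A [ffun=> 0%N] d].
Proof.
congr existT; apply/seteqP; split=> // x _.
by have [y <-] := pt_surj x; exists y.
Qed.

Lemma demazure_sub_crystal s X : demazure_crystal s X -> crystal X.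
Proof.
elim: s X => [X [[|//] _ [<-]]|i s IH X].
  by rewrite crystal_topE; apply/crystalP; do 2 eexists; split; first exact: component0.
move=> /demazure_cons[Y /IH cY [m e]].
by have [] := iter_ftilde_crystal cY e.
Qed.

Definition subreps X w (M : rep K A w d) := forall p : stable_rep Om (tag X) d,
  tagged X (pt p) -> is_subrep (set_val p) M.

Lemma subrepsP v (P : set (rep K A v d)) w (M : rep K A w d) : component Om P ->
  subreps (gr Om P) M <-> forall p, P p -> is_subrep p M.
Proof.
move=> cP; have [_ lP _] := cP; split=> [H p Pp|H y Py].
  have [y ey] := stable_rep_val (lP p Pp); rewrite -ey; apply: H.
  by apply/liftP; rewrite (component_gstable cP) ey.
by apply: H; rewrite -(component_gstable cP); apply/liftP.
Qed.

Lemma lcl_subreps v (P : set (rep K A v d)) w (M : rep K A w d) : component Om (lcl Om P) ->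
  stable M -> (forall p, P p -> is_subrep p M) -> subreps (gr Om (lcl Om P)) M.
Proof.
by move=> cP sM H; apply/(subrepsP _ cP) => p [zp [_ _ sp]]; exact: subrep_zcl zp sp.
Qed.

Lemma etilde_subreps i X w (M : rep K A w d) : crystal X -> stable M ->
  subreps X M -> subreps (etilde_max i X) M.
Proof.
move=> /crystalP[v [P [cP ->]]] sM /(subrepsP _ cP) PM; have [iP _ _] := cP.
have [c gc] := generic_eps_exists i iP.1; have [cR _] := component_red cP gc.
rewrite (etilde_gr cP gc); apply: lcl_subreps => // q [p Pp R].
exact: is_subrep_trans (restriction_subrep R) (PM p Pp).
Qed.

Lemma etilde_subreps_restriction i X w w' (M : rep K A w d) (M' : rep K A w' d) :
  crystal X -> stable M' -> is_restriction i M M' -> subreps X M ->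
  subreps (etilde_max i X) M'.
Proof.
move=> /crystalP[v [P [cP ->]]] sM RM /(subrepsP _ cP) PM; have [iP _ _] := cP.
have [c gc] := generic_eps_exists i iP.1; have [cR _] := component_red cP gc.
rewrite (etilde_gr cP gc); apply: lcl_subreps => // q [p Pp R].
exact: restriction_sub_subrep R (PM p Pp) RM.
Qed.

(** Generic points of [X] extend points of [etilde_max i X] and are absorbed by [M] through
    [extension_subrep]; closedness reaches the remaining points. *)
Lemma subreps_extension i X w w' (M : rep K A w d) (M' : rep K A w' d) :
  crystal X -> lambda_st Om M -> is_restriction i M M' ->
  (w i + w' i)%N = @hdim n A d w i -> subreps (etilde_max i X) M' -> subreps X M.
Proof.
move=> /crystalP[v [P [cP ->]]] lM RM ew; have [iP lP _] := cP.
have [c gc] := generic_eps_exists i iP.1; have [cR _] := component_red cP gc.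
have [_ lR] := generic_red iP lP gc; have [_ dense] := generic_dense Om iP gc.
rewrite (etilde_gr cP gc) => /(subrepsP _ cR) QM; apply/(subrepsP _ cP) => p Pp.
have [_ _ sp] := lP p Pp; have [_ _ sM] := lM.
apply: (subrep_zcl sM _ (dense p Pp) sp) => {sp}p1 [Pp1 e1].
have [q Rq R] := generic_restriction Om Pp1 e1.
exact: extension_subrep (lP p1 Pp1) lM R (QM q (sub_lcl lR Rq)) RM ew.
Qed.

End Chain.

Section Demazure.
Context {K : numFieldType} {n : nat} {A : sym_gcm n} (h : realization K A).
Context (omega : 'I_n -> 'Hom(h, K^o)) (Homega : is_fundamental_weights omega).
Context (Om : orientation A) {d : {ffun 'I_n -> nat}}.

(** [X] consists of subrepresentations of [M] exactly when the bottom [etilde_max i X] of its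
    i-string consists of subrepresentations of M'. From an element Y of the smaller Demazure crystal
    to the bottom of its string the property is kept, because a restriction is a subrepresentation;
    from the bottom back to [X], the operators f~_i climb the string. *)
Lemma demazure_subreps s w (M : rep K A w d) (X : graded_subset Om d) :
  reduced h s -> weight_of omega d - root_of h w = word_reflection s (weight_of omega d) ->
  lambda_st Om M -> crystal X -> demazure_crystal s X <-> subreps X M.
Proof.
elim: s w M X => [|i s IH] w M X red ew lM cX.
  have w0 : w = [ffun=> 0%N].
    apply: (@root_of_inj K n A h); rewrite -[LHS]opprK.
    rewrite -[X in - X](addKr (weight_of omega d)) ew addNr oppr0.
    by rewrite /root_of big1 // => j _; rewrite ffunE mulr0n.
  split=> [[[|//] _ [<-]] p _|].
    exists (fun j => 0); first by split=> *; apply: mx_dim0; rewrite ffunE.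
    by move=> j; rewrite /row_free mxrank0 ffunE.
  have /crystalP[v [P [cP XE]]] := cX.
  rewrite XE => /(subrepsP _ cP) PM; have [[[p0 Pp0] _] _ _] := cP.
  have v0 : v = [ffun=> 0%N].
    apply/ffunP => j; have [phi _ /(_ j)] := PM p0 Pp0.
    rewrite /row_free => /eqP e; rewrite ffunE; apply/eqP; rewrite -leqn0 -e.
    by rewrite (leq_trans (rank_leq_col _)) // w0 ffunE.
  subst v; exists [::] => //; rewrite /ftilde_monomial /= crystal_topE; congr (Some (gr _ _)).
  by apply/seteqP; split=> // p _; rewrite (rep0_eq p p0).
have [w' [M' [lM' RM ew' eww]]] := reduced_restriction Homega red ew lM.
have [_ _ sM'] := lM'.
have IH' Y := IH w' M' Y (@reduced_catr _ _ _ h [:: i] s red) ew' lM'.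
rewrite demazure_cons; split=> [[Y dY [m e]]|XM].
  have cY := demazure_sub_crystal dY.
  have [_ eXY] := iter_ftilde_crystal cY e.
  apply: (subreps_extension cX lM RM eww); rewrite eXY.
  by apply: etilde_subreps => //; exact/IH'.
exists (etilde_max i X); last by exists (eps_comp i X); exact: iter_ftilde_etilde.
have [cY _] := etilde_crystal i cX; apply/IH' => //.
exact: etilde_subreps_restriction XM.
Qed.

End Demazure.

Theorem proposition6p1 (R : realType) (n : nat) (A : sym_gcm n)
    (h : realization R[i] A)
    (omega : 'I_n -> 'Hom(h, (R[i])^o)) (Homega : is_fundamental_weights omega)
    (Om : orientation A) (d : {ffun 'I_n -> nat})
    (w : 'Hom(h, (R[i])^o) -> 'Hom(h, (R[i])^o)) (Hw : weyl_group w)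
    (s : seq 'I_n) (Hs : reduced_expression w s)
    (vw : {ffun 'I_n -> nat})
    (Hvw : weight_of omega d - root_of h vw = w (weight_of omega d))
    (xtw : rep R[i] A vw d) (Hxtw : lambda_st Om xtw)
    (X : graded_subset Om d) (HX : crystal X) :
  demazure_crystal s X <->
  (forall p : stable_rep Om (tag X) d,
     tagged X (pt p) -> is_subrep (set_val p) xtw).
Proof.
have [ws min] := Hs; apply: (demazure_subreps Homega) => //.
  by move=> s' e; apply: min; rewrite e.
by rewrite Hvw ws.
Qed.
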